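(* Let $u_{n,\varepsilon}$ denote the solution of the $p$-eikonal equation on the random geometric graph, $$\mathcal{A}_{n,\varepsilon}u_{n,\varepsilon}(x)=f(x)\ \text{ if } x\in X\setminus\Gamma,\qquad u_{n,\varepsilon}(x)=0\ \text{ if }x\in\Gamma,$$ and let $g=\rho^{-1/p}f^{1/p}$. There exist $C,c>0$ such that for $\varepsilon$ sufficiently small and any $0<\lambda\le 1$ we have $$\mathbb{P}\left(\max_{x\in X}\big(u_{n,\varepsilon}(x)-d_g(x,\Gamma)\big)\le C\Big(\sqrt{\varepsilon}+\big(n\varepsilon^{p+d}\big)^{\frac1p}+\lambda\Big)\right)\ge 1-3n^2\exp(-cn\varepsilon^d\lambda^2).$$
   Context: Setting. $\Omega\subset\mathbb{R}^d$ is open, bounded and connected with $C^{1,1}$ boundary $\partial\Omega$; $R>0$ denotes the reach of $\partial\Omega$. $x_1,\dots,x_n$ are i.i.d. random variables on $\Omega$ with density $\rho$, where $\rho$ is Lipschitz continuous and $0<\rho_{min}\le\rho(x)\le\rho_{max}$ for all $x\in\Omega$. Put $X=\{x_1,\dots,x_n\}$. The set $\Gamma\subset X$ is a nonempty subset of the vertices with $\mathrm{dist}(\Gamma,\partial\Omega)\ge R$; no other assumption is placed on $\Gamma$. The function $f$ is Lipschitz continuous and positive, with $0<f_{min}\le f\le f_{max}$. $p\ge 1$. Kernel. $\eta:[0,\infty)\to[0,\infty)$ is smooth and nonincreasing, $\eta(0)>0$, $\eta(t)=0$ for $t>1$, and $\int_{B(0,1)}\eta(|z|)\,dz=1$. For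 $\varepsilon>0$, $\eta_\varepsilon(t)=\varepsilon^{-d}\eta(t/\varepsilon)$. The constant $\sigma_p$ is $\sigma_p=\int_{\mathbb{R}^d}\eta(|z|)(z_1)_+^p\,dz$, where $a_+=\max\{a,0\}$. Graph operator. For $u:X\to\mathbb{R}$ and $x\in X$, $$\mathcal{A}_{n,\varepsilon}u(x)=\frac{1}{n\sigma_p\varepsilon^p}\sum_{y\in X}\eta_\varepsilon(|x-y|)\,(u(x)-u(y))_+^p.$$ Geodesic distance. For a positive function $g$ on $\overline\Omega$, $$d_g(x,y)=\inf\Big\{\int_0^1 g(\gamma(t))|\gamma'(t)|\,dt:\ \gamma\in C^1([0,1];\overline\Omega),\ \gamma(0)=x,\ \gamma(1)=y\Big\},\qquad d_g(x,\Gamma)=\min_{y\in\Gamma}d_g(x,y).$$ The constants $C,c$ depend only on the geodesic diameter $\max_{x,y\in\overline\Omega}d_1(x,y)$ of $\Omega$, the $C^{1,1}$ bound on (equivalently the reach of) $\partial\Omega$, the kernel $\eta$, $d$, $\rho_{min},\rho_{max},\mathrm{Lip}(\rho)$, $f_{min},f_{max},\mathrm{Lip}(f)$ and $p$ (in particular not on $n,\varepsilon,\lambda$). *)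

(* Defs.v *)
From HB Require Import structures.
From mathcomp Require Import all_boot all_order all_algebra.
From mathcomp Require Import all_classical all_reals all_analysis.
Set Implicit Arguments.
Unset Strict Implicit.
Unset Printing Implicit Defensive.
Import Order.TTheory GRing.Theory Num.Theory.
Import numFieldNormedType.Exports.
Local Open Scope classical_set_scope.
Local Open Scope ring_scope.

Definition measure_rV_display : measure_display -> measure_display.
Proof. exact. Qed.

(* The product sigma-algebra on row vectors; over the reals it is the Borel
   sigma-algebra. *)
Section measurable_rV.
Context {d : measure_display} {T : sigmaRingType d}.
Variable n : nat.

Let coord : 'I_n -> 'rV[T]_n -> T := fun i v => v ord0 i.

Let rV_set0 : g_sigma_preimage coord set0.
Proof. exact: sigma_algebra0. Qed.

Let rV_setC A : g_sigma_preimage coord A -> g_sigma_preimage coord (~` A).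
Proof. exact: sigma_algebraC. Qed.

Let rV_bigcup (F : (set 'rV[T]_n)^nat) :
  (forall i, g_sigma_preimage coord (F i)) ->
  g_sigma_preimage coord (\bigcup_i (F i)).
Proof. exact: sigma_algebra_bigcup. Qed.

HB.instance Definition _ := @isMeasurable.Build (measure_rV_display d)
  'rV[T]_n (g_sigma_preimage coord) rV_set0 rV_setC rV_bigcup.

End measurable_rV.

Lemma measurable_rV_coord d (T : sigmaRingType d) n (i : 'I_n) :
  measurable_fun [set: 'rV[T]_n] (fun v : 'rV[T]_n => v ord0 i).
Proof.
move=> _ Y mY; rewrite setTI; apply: sub_sigma_algebra => /=.
rewrite -bigcup_seq/=; exists i => /=; first by rewrite mem_index_enum.
by exists Y => //; rewrite setTI.
Qed.

Lemma measurable_fun_rVP d1 d2 (T1 : measurableType d1) (T2 : measurableType d2)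
    n (f : T1 -> 'rV[T2]_n) :
  (forall i, measurable_fun [set: T1] (fun x => f x ord0 i)) ->
  measurable_fun [set: T1] f.
Proof.
move=> mf; apply: (@measurability _ _ _ _ _ _
  (\big[setU/set0]_(i < n) preimage_set_system [set: 'rV[T2]_n]
     (fun v : 'rV[T2]_n => v ord0 i) measurable)) => //.
move=> _ [B + <-]; rewrite -bigcup_seq/= => -[i _ [Y mY <-]].
by rewrite !setTI; have := mf i measurableT Y mY; rewrite setTI.
Qed.

Section lebesgue_rV.
Context {R : realType}.

Definition cons_rV n (x : measurableTypeR R * 'rV[R]_n) : 'rV[R]_(1 + n) :=
  row_mx (x.1%:M) x.2.

Definition uncons_rV n (v : 'rV[R]_(1 + n)) : measurableTypeR R * 'rV[R]_n :=
  (v ord0 ord0, rsubmx v).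

Lemma cons_rV0 n x : @cons_rV n x ord0 ord0 = x.1.
Proof.
have -> : ord0 = lshift n (@ord0 0) by exact/val_inj.
by rewrite row_mxEl mxE eqxx mulr1n.
Qed.

Lemma cons_rVS n x (i : 'I_n) : cons_rV x ord0 (lift ord0 i) = x.2 ord0 i.
Proof.
have -> : lift ord0 i = rshift 1 i by exact/val_inj.
by rewrite row_mxEr.
Qed.

Lemma cons_rVK n : cancel (@cons_rV n) (@uncons_rV n).
Proof.
by move=> [x v]; rewrite /uncons_rV cons_rV0 /cons_rV row_mxKr.
Qed.

Lemma measurable_cons_rV n : measurable_fun setT (@cons_rV n).
Proof.
apply: measurable_fun_rVP => i; case: (split_ordP i) => j ->.
- rewrite (ord1 j); under eq_fun do rewrite row_mxEl mxE eqxx mulr1n.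
  exact: measurable_fst.
- under eq_fun do rewrite row_mxEr.
  by apply: (measurableT_comp (measurable_rV_coord j)); exact: measurable_snd.
Qed.

Lemma measurable_uncons_rV n : measurable_fun setT (@uncons_rV n).
Proof.
apply: measurable_fun_pair; first exact: measurable_rV_coord.
apply: measurable_fun_rVP => i.
under eq_fun do rewrite mxE.
exact: measurable_rV_coord.
Qed.

Section step.
Variables (n : nat) (mu : {sigma_finite_measure set 'rV[R]_n -> \bar R}).

Definition cons_measure : set 'rV[R]_(1 + n) -> \bar R :=
  pushforward (lebesgue_measure \x mu)%E (@cons_rV n).

Let cons_measure0 : cons_measure set0 = 0%E.
Proof. by rewrite /cons_measure /pushforward preimage_set0 measure0. Qed.

Let cons_measure_ge0 A : (0 <= cons_measure A)%E.
Proof. by rewrite /cons_measure /pushforward; exact: measure_ge0. Qed.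

Let cons_measure_sigma_additive : semi_sigma_additive cons_measure.
Proof.
exact: (@measure_semi_sigma_additive _ _ _
  (measure_function_pushforward__canonical__measure_function_Measure
     (lebesgue_measure \x mu)%E (@measurable_cons_rV n))).
Qed.

HB.instance Definition _ := isMeasure.Build _ _ _ cons_measure
  cons_measure0 cons_measure_ge0 cons_measure_sigma_additive.

Let cons_measure_sigma_finite : sigma_finite setT cons_measure.
Proof.
have /sigma_finiteP[F [FT ndF Foo]] := sigma_finiteT (@lebesgue_measure R).
have /sigma_finiteP[G [GT ndG Goo]] := sigma_finiteT mu.
exists (fun k => @uncons_rV n @^-1` (F k `*` G k)).
  apply/esym; rewrite -subTset => v _; rewrite -preimage_bigcup /=.
  have [[k _ Fk] [l _ Gl]] : (\bigcup_k F k) (uncons_rV v).1 /\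
      (\bigcup_k G k) (uncons_rV v).2 by rewrite -FT -GT.
  exists (maxn k l) => //; split => /=.
    exact: (subsetPset _ _ (ndF _ _ (leq_maxl k l))).
  exact: (subsetPset _ _ (ndG _ _ (leq_maxr k l))).
move=> k; have [[mF Fk] [mG Gk]] := (Foo k, Goo k); split.
  rewrite -[X in measurable X]setTI; apply: measurable_uncons_rV => //.
  exact: measurableX.
rewrite /cons_measure /pushforward -comp_preimage.
rewrite (_ : _ \o _ = id); last by apply/funext => x /=; rewrite cons_rVK.
by rewrite product_measure1E// lte_mul_pinfty// ge0_fin_numE.
Qed.

HB.instance Definition _ := Measure_isSigmaFinite.Build _ _ _ 
  cons_measure cons_measure_sigma_finite.
End step.

(* Lebesgue measure on R^n as an iterated product; its value on boxes is given
   by [lebesgue_rV_box]. *)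
Fixpoint lebesgue_rV n : {sigma_finite_measure set 'rV[R]_n -> \bar R} :=
  if n is m.+1 then cons_measure (lebesgue_rV m) else \d_(0 : 'rV[R]_0).

Lemma lebesgue_rV_box n (A : 'I_n -> set R) : (forall i, measurable (A i)) ->
  lebesgue_rV n [set v | forall i, A i (v ord0 i)] =
  (\prod_(i < n) lebesgue_measure (A i))%E.
Proof.
elim: n A => [|n ih] A mA.
  by rewrite big_ord0 /= diracE mem_set//= => -[].
have mbox : measurable [set v : 'rV[R]_n | forall i, A (lift ord0 i) (v ord0 i)].
  rewrite (_ : [set v | _] = \bigcap_(i in [set: 'I_n])
      ((fun v : 'rV[R]_n => v ord0 i) @^-1` A (lift ord0 i))); last first.
    by apply/seteqP; split => [v Av i _|v Av i]; [exact: Av|exact: (Av i)].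
  apply: fin_bigcap_measurable => // i _.
  by rewrite -[X in measurable X]setTI; exact: measurable_rV_coord.
rewrite big_ord_recl -ih => [|i]; last exact: mA.
rewrite /= /cons_measure /pushforward.
rewrite -(@product_measure1E _ _ _ _ _ (@lebesgue_measure R) (lebesgue_rV n))//;
  last exact: mA.
congr ((_ \x _)%E _); apply/seteqP; split => -[x v] /=.
  by move=> Axv; split => [|i]; [have := Axv ord0|have := Axv (lift ord0 i)];
    rewrite ?cons_rV0 ?cons_rVS.
move=> [Ax Av] i; case: (unliftP ord0 i) => [j|] ->.
  by rewrite cons_rVS.
by rewrite cons_rV0.
Qed.
End lebesgue_rV.

(* Infima of distances, lengths, etc. are real-valued: they are only meant for
   nonempty index sets (the infimum of the empty set is 0). Quantities that
   could a priori be infinite are extended reals. *)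
Section geometry.
Context {R : realType} {d : nat}.
Implicit Types (x y z : 'rV[R]_d) (A B Omega : set 'rV[R]_d).

(* The norm of the library on ['rV[R]_d] is the maximum norm, which gives the
   same topology. *)
Definition enorm x : R := Num.sqrt (\sum_i x ord0 i ^+ 2).

Definition elipschitz A (L : R) (h : 'rV[R]_d -> R) :=
  {in A &, forall x y, `|h x - h y| <= L * enorm (x - y)}.

Definition boundary A := closure A `\` A^°.

Definition setdist A B : R := inf [set enorm (x - y) | x in A & y in B].

(* The largest s such that every point at distance less than s from [A] has a
   unique nearest point in [A]. *)
Definition reach A : \bar R := ereal_sup [set s%:E | s in
  [set s | 0 <= s /\ forall x, setdist [set x] A < s ->
     exists! y, A y /\ enorm (x - y) = setdist [set x] A]].

(* Continuously differentiable with Lipschitz derivative. *)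
Definition C11 (h : 'rV[R]_d -> R) := (forall x, differentiable h x) /\
  exists L : R, forall x y v,
    `|'d h x v - 'd h y v| <= L * enorm (x - y) * enorm v.

(* The curves are parametrized by [R]; only their restrictions to [0, 1] are
   used, and each function in C^1([0, 1]) extends to such a curve. *)
Definition C1_curve (gamma : R -> 'rV[R]_d) :=
  (forall t, derivable gamma t 1) /\ continuous (derive1 gamma).

Definition geodist Omega (g : 'rV[R]_d -> R) x y : R :=
  inf [set \int[lebesgue_measure]_(t in `[0, 1])
             (g (gamma t) * enorm (derive1 gamma t)) | gamma in
    [set gamma | [/\ C1_curve gamma,
       forall t, 0 <= t <= 1 -> closure Omega (gamma t),
       gamma 0 = x & gamma 1 = y]]].

Definition geodist_set Omega (g : 'rV[R]_d -> R) x A : R :=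
  inf [set geodist Omega g x y | y in A].

Definition geodiam Omega : \bar R := ereal_sup
  [set (geodist Omega (cst 1) x y)%:E | x in closure Omega & y in closure Omega].

End geometry.

(* Near each boundary point, after a rigid motion, [Omega] is the set of points
   above the graph of a C^{1,1} function of the other coordinates. *)
Definition C11_boundary (R : realType) (d : nat) (Omega : set 'rV[R]_d) :=
  forall x0, boundary Omega x0 ->
  exists (s : R) (Q : 'M[R]_d) (k : 'I_d) (h : 'rV[R]_d.-1 -> R),
    [/\ 0 < s, Q *m Q^T = 1%:M, C11 h &
      forall x, enorm (x - x0) < s ->
        let z := (x - x0) *m Q in Omega x <-> h (col' k z) < z ord0 k].

Section graph_eikonal.
Context {R : realType} {d : nat}.
Implicit Types (eta : R -> R) (p eps : R) (X Gamma : set 'rV[R]_d.+1)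
  (u : 'rV[R]_d.+1 -> R).

(* [eta] is smooth on the closed half-line: it is the restriction of a smooth
   function on [R]. *)
Definition smooth_nonneg eta := exists2 eta' : R -> R,
  forall k t, derivable (derive1n k eta') t 1 &
  forall t, 0 <= t -> eta t = eta' t.

Definition kernel_profile eta :=
  [/\ smooth_nonneg eta,
      forall t, 0 <= t -> 0 <= eta t,
      forall s t, 0 <= s -> s <= t -> eta t <= eta s,
      0 < eta 0 /\ (forall t, 1 < t -> eta t = 0) &
      \int[lebesgue_rV d.+1]_(z in [set z | enorm z < 1]) eta (enorm z) = 1].

Definition eta_eps eta eps (t : R) : R := eps ^- d.+1 * eta (t / eps).

Definition sigma_p eta p : R :=
  \int[lebesgue_rV d.+1]_(z in setT)
     (eta (enorm z) * (Num.max (z ord0 ord0) 0) `^ p).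

(* [n] is the sample size, which is almost surely the cardinality of [X]; the
   sum is over the finite set [X]. *)
Definition graph_op n eta p eps X u (x : 'rV[R]_d.+1) : R :=
  (n%:R * sigma_p eta p * eps `^ p)^-1 *
  \sum_(y \in X) (eta_eps eta eps (enorm (x - y)) * (Num.max (u x - u y) 0) `^ p).

Definition eikonal_sol n eta p eps X Gamma (f : 'rV[R]_d.+1 -> R) u :=
  (forall x, (X `\` Gamma) x -> graph_op n eta p eps X u x = f x) /\
  (forall x, Gamma x -> u x = 0).

End graph_eikonal.

Section probability_notions.
Context {R : realType} {disp disp' : measure_display}
  {T : measurableType disp} {T' : measurableType disp'}.
Variable P : probability T R.

Definition mutually_independent n (x : 'I_n -> {RV P >-> T'}) :=
  forall (J : {set 'I_n}) (A : 'I_n -> set T'), (forall i, measurable (A i)) ->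
    P (\bigcap_(i in [set i | i \in J]) x i @^-1` A i) =
    (\prod_(i in J) P (x i @^-1` A i))%E.

Definition has_density (mu : {measure set T' -> \bar R}) (D : set T')
    (rho : T' -> R) (x : {RV P >-> T'}) :=
  (forall w, D (x w)) /\
  forall A, measurable A ->
    distribution P x A = (\int[mu]_(y in A `&` D) (rho y)%:E)%E.

(* Lower bound on the probability of an event not known to be measurable. *)
Definition prob_ge (E : set T) (q : R) :=
  exists F : set T, [/\ measurable F, F `<=` E & (q%:E <= P F)%E].

End probability_notions.

(* Main.v *)
(* The solution is compared with a barrier. Choose y in Gamma and a curve from
   the given point z to y that is almost a geodesic for g, cut it into pieces of
   length h <= eps and push the division points zeta_k to distance at least
   A sqrt eps from the boundary; by the reach condition this lengthens the chain
   at most by the factor 1 / (1 - A sqrt eps / r). With ell_k the discrete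
   weighted length from zeta_k to y, increased by a factor 1 + O(sqrt eps + lam),
   the barrier is
     min (b + min_k (ell_k + |x - zeta_k|^2 / sqrt eps)) (M |x - y|) + O(B),
   where B = (n eps^(p+d))^(1/p) pays for a single edge of the graph. Were u to
   exceed it, then at a maximum of u minus the barrier the operator would be at
   most f at the barrier too; but the barrier is a strict supersolution: in the
   interior because kernel sums in a half-space direction concentrate around their
   means, uniformly in the direction and the point; within eps of the boundary
   because the zeta_k are so far away that the slope is at least A, and balls of
   radius comparable to eps contain many sample points. A chain of such balls
   gives the a priori bound u <= O(B + 1), which makes Perron's method work.
   Uniformity comes from nets of size polynomial in 1/eps, which the exponential
   absorbs. *)

Require Import Defs.
From HB Require Import structures.
From mathcomp Require Import all_boot all_order all_algebra.
From mathcomp Require Import all_classical all_reals all_analysis.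
From mathcomp Require Import measurable_realfun ring lra.
Set Implicit Arguments.
Unset Strict Implicit.
Unset Printing Implicit Defensive.
Import Order.TTheory GRing.Theory Num.Theory.
Import numFieldNormedType.Exports.
Local Open Scope classical_set_scope.
Local Open Scope ring_scope.

(** * The Euclidean norm *)

(** No smoothness of the distance function enters. At a sample point x whose minimal paraboloid is
    the k-th, the barrier drops towards its neighbours at least as much as that paraboloid, and
    comparing k with k + 1 forces the slope 2 |x - zeta_k| / sqrt eps to be at least about
    g(zeta_k): minimality replaces the eikonal equation. The width sqrt eps balances the curvature
    error over one kernel radius, (1 / sqrt eps) eps, against the variation of g between x and
    zeta_k. Supersolutions only need lower bounds on sums over the sample, so only lower tails are
    estimated; their event does not mention Gamma, which may therefore depend on the sample. At the
    boundary and on the cone no sharp constant is sought: the slope is made so large that the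
    neighbours in one ball of radius comparable to eps outweigh the right-hand side. The C^{1,1}
    charts only supply some tiny exterior ball at each boundary point; the reach enlarges it to
    radius r, hence the constants see the boundary through r alone. When sqrt eps + lam is not
    small, the a priori bound already gives the claim. *)

Section euclid.
Context {R : realType} {d : nat}.
Implicit Types (x y z : 'rV[R]_d) (a t : R).

Definition edot x y : R := \sum_i x ord0 i * y ord0 i.

Lemma edotC x y : edot x y = edot y x.
Proof. by apply: eq_bigr => i _; rewrite mulrC. Qed.

Lemma edotDl x y z : edot (x + y) z = edot x z + edot y z.
Proof. by rewrite -big_split; apply: eq_bigr => i _; rewrite mxE mulrDl. Qed.

Lemma edotZl a x y : edot (a *: x) y = a * edot x y.
Proof. by rewrite mulr_sumr; apply: eq_bigr => i _; rewrite mxE mulrA. Qed.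

Lemma edotNl x y : edot (- x) y = - edot x y.
Proof. by rewrite -scaleN1r edotZl mulN1r. Qed.

Lemma edotBl x y z : edot (x - y) z = edot x z - edot y z.
Proof. by rewrite edotDl edotNl. Qed.

Lemma edotDr x y z : edot x (y + z) = edot x y + edot x z.
Proof. by rewrite edotC edotDl !(edotC x). Qed.

Lemma edotZr a x y : edot x (a *: y) = a * edot x y.
Proof. by rewrite edotC edotZl edotC. Qed.

Lemma edotNr x y : edot x (- y) = - edot x y.
Proof. by rewrite edotC edotNl edotC. Qed.

Lemma edotBr x y z : edot x (y - z) = edot x y - edot x z.
Proof. by rewrite edotDr edotNr. Qed.

Lemma edot0l x : edot 0 x = 0.
Proof. by rewrite -(scale0r x) edotZl mul0r. Qed.

Lemma edot_ge0 x : 0 <= edot x x.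
Proof. by apply: sumr_ge0 => i _; rewrite -expr2 sqr_ge0. Qed.

Lemma sqr_enorm x : enorm x ^+ 2 = edot x x.
Proof.
rewrite /enorm sqr_sqrtr; last by apply: sumr_ge0 => i _; exact: sqr_ge0.
by apply: eq_bigr => i _; rewrite expr2.
Qed.

Lemma enorm_ge0 x : 0 <= enorm x. Proof. exact: sqrtr_ge0. Qed.
Hint Resolve enorm_ge0 : core.

Lemma enorm_le x a : 0 <= a -> (enorm x <= a) = (edot x x <= a ^+ 2).
Proof. by move=> a0; rewrite -sqr_enorm ler_pXn2r ?nnegrE. Qed.

Lemma enormZ a x : enorm (a *: x) = `|a| * enorm x.
Proof.
apply: (@Num.Theory.pexpIrn _ 2); rewrite ?nnegrE ?mulr_ge0//.
by rewrite exprMn !sqr_enorm edotZl edotZr mulrA -expr2 real_normK ?num_real.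
Qed.

Lemma enormN x : enorm (- x) = enorm x.
Proof. by rewrite -scaleN1r enormZ normrN1 mul1r. Qed.

Lemma enormC x y : enorm (x - y) = enorm (y - x).
Proof. by rewrite -enormN opprB. Qed.

Lemma enorm_coord x i : `|x ord0 i| <= enorm x.
Proof.
rewrite -(@ler_pXn2r _ 2) ?nnegrE// real_normK ?num_real// sqr_enorm.
rewrite /edot (bigD1 i)//= -expr2 lerDl.
by apply: sumr_ge0 => j _; rewrite -expr2 sqr_ge0.
Qed.

Lemma enorm_eq0 x : (enorm x == 0) = (x == 0).
Proof.
apply/eqP/eqP => [x0|->]; last by rewrite -(scale0r 0) enormZ normr0 mul0r.
apply/rowP => i; rewrite mxE; apply/eqP; rewrite -normr_le0 -x0.
exact: enorm_coord.
Qed.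

Lemma enorm0 : enorm (0 : 'rV[R]_d) = 0.
Proof. by apply/eqP; rewrite enorm_eq0. Qed.

Lemma enorm_gt0 x : (0 < enorm x) = (x != 0).
Proof. by rewrite lt_neqAle enorm_ge0 eq_sym enorm_eq0 andbT. Qed.

Lemma edotD2 x y : edot (x + y) (x + y) = edot x x + 2 * edot x y + edot y y.
Proof. by rewrite edotDl !edotDr (edotC y x); ring. Qed.

Lemma edotB2 x y : edot (x - y) (x - y) = edot x x - 2 * edot x y + edot y y.
Proof. by rewrite edotD2 edotNr edotNl edotNr; ring. Qed.

Lemma edot_le x y : edot x y <= enorm x * enorm y.
Proof.
have [->|y0] := eqVneq y 0; first by rewrite edotC edot0l enorm0 mulr0.
have [->|x0] := eqVneq x 0; first by rewrite edot0l enorm0 mul0r.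
have := edot_ge0 (enorm y *: x - enorm x *: y).
rewrite edotB2 !edotZl !edotZr -!sqr_enorm.
move: x0 y0; rewrite -!enorm_gt0.
move: (enorm x) (enorm y) (edot x y) => a b c a0 b0 h.
have : 0 <= (2 * a * b) * (a * b - c) by apply: le_trans h _; lra.
by rewrite pmulr_rge0 ?subr_ge0// !mulr_gt0.
Qed.

Lemma edot_abs_le x y : `|edot x y| <= enorm x * enorm y.
Proof.
by rewrite ler_norml edot_le andbT lerNl -edotNl -(enormN x) edot_le.
Qed.

Lemma enormD x y : enorm (x + y) <= enorm x + enorm y.
Proof.
rewrite enorm_le ?addr_ge0// edotD2 -!sqr_enorm sqrrD.
by have := edot_le x y; lra.
Qed.

Lemma enormB x y : enorm (x - y) <= enorm x + enorm y.
Proof. by rewrite -(enormN y) enormD. Qed.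

Lemma enorm_tri x y z : enorm (x - z) <= enorm (x - y) + enorm (y - z).
Proof. by rewrite -{1}(subrK y x) -addrA enormD. Qed.

Lemma enorm_dist_le x y : `|enorm x - enorm y| <= enorm (x - y).
Proof.
rewrite ler_norml; apply/andP; split.
  by rewrite lerNl opprB lerBlDl -{1}(subrK x y) addrC (enormC x) enormD.
by rewrite lerBlDl addrC -{1}(subrK y x) enormD.
Qed.

Lemma enorm_dirE x : x != 0 -> enorm ((enorm x)^-1 *: x) = 1.
Proof.
move=> x0; rewrite enormZ ger0_norm ?invr_ge0//.
by rewrite mulVf ?enorm_eq0.
Qed.

Lemma enorm_dirK x : enorm x *: ((enorm x)^-1 *: x) = x.
Proof.
have [->|x0] := eqVneq x 0; first by rewrite !scaler0.
by rewrite scalerA divff ?scale1r ?enorm_eq0.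
Qed.

Lemma mxnorm_le_enorm x : `|x| <= enorm x.
Proof.
rewrite [leLHS]/Num.norm /= mx_normrE; apply/bigmax_leP; split => // -[i j] _ /=.
by rewrite (ord1 i); exact: enorm_coord.
Qed.

Lemma coord_le_mxnorm x i : `|x ord0 i| <= `|x|.
Proof.
by rewrite [leRHS]/Num.norm /= mx_normrE; apply/bigmax_geP; right; exists (ord0, i).
Qed.

Lemma enorm_le_mxnorm x : enorm x <= d%:R * `|x|.
Proof.
rewrite enorm_le ?mulr_ge0// exprMn.
apply: (@le_trans _ _ (\sum_(i < d) `|x| ^+ 2)).
  apply: ler_sum => i _; rewrite -expr2 -[leLHS]real_normK ?num_real//.
  by rewrite ler_pXn2r ?nnegrE// coord_le_mxnorm.
rewrite sumr_const card_ord -[leLHS]mulr_natl ler_wpM2r ?sqr_ge0//.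
by rewrite -natrX ler_nat; case: (d) => // k; rewrite leq_pmulr.
Qed.

Lemma nbhs_enormP x (A : set 'rV[R]_d) :
  nbhs x A <-> exists2 e, 0 < e & forall y, enorm (x - y) < e -> A y.
Proof.
split=> [/nbhs_ballP[e /= e0 eA]|[e e0 eA]].
  exists e => // y xy; apply: eA; rewrite -ball_normE /=.
  exact: le_lt_trans (mxnorm_le_enorm _) xy.
apply/nbhs_ballP.
(* Adding 1 keeps the denominator positive when [d] is 0. *)
exists (e / (d%:R + 1)) => [/=|y]; first by rewrite divr_gt0// ltr_wpDl.
rewrite -ball_normE /= ltr_pdivlMr ?ltr_wpDl// => xy; apply: eA.
apply: le_lt_trans xy; apply: le_trans (enorm_le_mxnorm _) _.
by rewrite mulrC ler_wpM2l// lerDl.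
Qed.

Lemma open_enormP (A : set 'rV[R]_d) : open A <->
  forall x, A x -> exists2 e, 0 < e & forall y, enorm (x - y) < e -> A y.
Proof.
rewrite openE; split => AA x Ax; first by apply/nbhs_enormP; exact: AA.
by apply/nbhs_enormP; exact: AA.
Qed.

Lemma closure_enormP (A : set 'rV[R]_d) x : closure A x <->
  forall e, 0 < e -> exists2 y, A y & enorm (x - y) < e.
Proof.
split => [clA e e0|clA B /nbhs_enormP[e e0 eB]].
  have [|y [Ay xy]] := clA [set y | enorm (x - y) < e]; last by exists y.
  by apply/nbhs_enormP; exists e.
by have [y Ay xy] := clA e e0; exists y; split => //; exact: eB.
Qed.

Lemma closed_enorm (A : set 'rV[R]_d) :
  (forall x, (forall e, 0 < e -> exists2 y, A y & enorm (x - y) < e) -> A x) ->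
  closed A.
Proof.
move=> AA; apply/closure_id/seteqP; split; first exact: subset_closure.
by move=> x /closure_enormP; exact: AA.
Qed.

Lemma lipschitz_continuous_enorm (h : 'rV[R]_d -> R) (L : R) :
  (forall x y, `|h x - h y| <= L * enorm (x - y)) -> continuous h.
Proof.
move=> hL x; apply/(@cvgrPdist_lt _ _ _ (nbhs x)) => e e0; apply/nbhs_enormP.
exists (e / (`|L| + 1)) => [|y]; first by rewrite divr_gt0// ltr_wpDl.
rewrite ltr_pdivlMr ?ltr_wpDl// => xy; apply: le_lt_trans xy.
apply: le_trans (hL _ _) _; rewrite mulrC ler_wpM2l//.
by apply: le_trans (ler_norm _) _; rewrite lerDl.
Qed.

Lemma continuous_enorm : continuous (@enorm R d).
Proof.
by apply: (@lipschitz_continuous_enorm _ 1) => x y; rewrite mul1r enorm_dist_le.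
Qed.

Lemma continuous_enormB x : continuous (fun y => enorm (x - y)).
Proof.
apply: (@lipschitz_continuous_enorm _ 1) => y z; rewrite mul1r.
apply: le_trans (enorm_dist_le _ _) _.
by rewrite opprB addrC addrA subrK enormC.
Qed.

Lemma compact_closed_ball_enorm x a : compact [set y | enorm (x - y) <= a].
Proof.
apply: bounded_closed_compact.
  exists (`|x| + `|a|); split => [|M MM y /= xy]; first by rewrite num_real.
  apply/ltW; apply: le_lt_trans MM; rewrite -[y in leLHS](subKr x).
  apply: le_trans (ler_normB _ _) _; rewrite lerD2l.
  apply: le_trans (mxnorm_le_enorm _) _; apply: le_trans xy _; exact: ler_norm.
apply: closed_enorm => y cy; apply/ler_addgt0Pr => e e0.
have [z /= xz yz] := cy e e0.
apply: le_trans (enorm_tri x z y) _; rewrite lerD// enormC; exact: ltW.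
Qed.

Lemma bounded_set_enorm (A : set 'rV[R]_d) : bounded_set A ->
  exists2 M, 0 < M & forall x, A x -> enorm x <= M.
Proof.
move=> [M [Mr MA]]; exists (d%:R * (`|M| + 1) + 1).
  by rewrite ltr_wpDl// mulr_ge0.
move=> x Ax; apply: le_trans (enorm_le_mxnorm _) _.
rewrite -[leLHS]addr0 lerD// ler_wpM2l//; apply: MA => //.
by apply: le_lt_trans (ler_norm _) _; rewrite ltrDl.
Qed.

End euclid.
#[global] Hint Extern 0 (is_true (0 <= enorm _)) => exact: enorm_ge0 : core.

(** * Distance functions and reach *)

Section distance.
Context {R : realType} {d : nat}.
Implicit Types (x y z a b : 'rV[R]_d) (S : set 'rV[R]_d).

Definition sdist S x : R := setdist [set x] S.

Lemma sdist_set S x :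
  [set enorm (z - y) | z in [set x] & y in S] = [set enorm (x - y) | y in S].
Proof.
apply/seteqP; split => t [z]; first by move=> -> [y Sy <-]; exists y.
by move=> Sz <-; exists x => //; exists z.
Qed.

Lemma sdist_le S x y : S y -> sdist S x <= enorm (x - y).
Proof.
move=> Sy; rewrite /sdist /setdist sdist_set.
apply: ge_inf; last by exists y.
by exists 0; apply/lbP => ? [z _ <-]; exact: enorm_ge0.
Qed.

Lemma sdist_ge S x (t : R) : S !=set0 ->
  (forall y, S y -> t <= enorm (x - y)) -> t <= sdist S x.
Proof.
move=> [y Sy] tS; rewrite /sdist /setdist sdist_set.
apply: lb_le_inf; first by exists (enorm (x - y)), y.
by apply/lbP => ? [z Sz <-]; exact: tS.
Qed.

Lemma sdist_ge0 S x : S !=set0 -> 0 <= sdist S x.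
Proof. by move=> S0; apply: sdist_ge => // y _; exact: enorm_ge0. Qed.

Lemma sdist_tri S x y : S !=set0 -> sdist S x <= sdist S y + enorm (x - y).
Proof.
move=> S0; rewrite -lerBlDr; apply: sdist_ge => // z Sz; rewrite lerBlDr addrC.
apply: le_trans (sdist_le x Sz) _; exact: enorm_tri.
Qed.

Lemma sdist_lip S x y : S !=set0 -> `|sdist S x - sdist S y| <= enorm (x - y).
Proof.
move=> S0; rewrite ler_norml lerBlDl sdist_tri// andbT lerNl opprB lerBlDl.
by rewrite enormC sdist_tri.
Qed.

Lemma continuous_sdist S : S !=set0 -> continuous (sdist S).
Proof.
move=> S0; apply: (@lipschitz_continuous_enorm _ _ _ 1) => x y.
by rewrite mul1r sdist_lip.
Qed.

Lemma compact_minimizer (A : set 'rV[R]_d) (h : 'rV[R]_d -> R) :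
  A !=set0 -> compact A -> continuous h ->
  exists2 a, A a & forall b, A b -> h a <= h b.
Proof.
move=> A0 cA ch; have [|a /set_mem Aa amin] := @compact_EVT_min _ _ h A A0 cA.
  exact: continuous_subspaceT.
by exists a => // b /mem_set; exact: amin.
Qed.

Lemma compact_maximizer (A : set 'rV[R]_d) (h : 'rV[R]_d -> R) :
  A !=set0 -> compact A -> continuous h ->
  exists2 a, A a & forall b, A b -> h b <= h a.
Proof.
move=> A0 cA ch; have [|a /set_mem Aa amin] := @compact_EVT_max _ _ h A A0 cA.
  exact: continuous_subspaceT.
by exists a => // b /mem_set; exact: amin.
Qed.

Lemma nearest_exists S x : closed S -> S !=set0 ->
  exists2 y, S y & enorm (x - y) = sdist S x.
Proof.
move=> cS S0; have [y0 Sy0] := S0.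
have [|||b [Sb _] bmin] := @compact_minimizer
    (S `&` [set y | enorm (x - y) <= enorm (x - y0)]) (fun y => enorm (x - y)).
- by exists y0; split => //=.
- by rewrite setIC; apply: compact_closedI => //; exact: compact_closed_ball_enorm.
- exact: continuous_enormB.
exists b => //; apply/eqP; rewrite eq_le sdist_le// andbT.
apply: sdist_ge => // y Sy; have [xy|/ltW xy] := leP (enorm (x - y)) (enorm (x - y0)).
  by apply: bmin.
by apply: le_trans (bmin y0 _) xy; split => //=.
Qed.

(** Equality case of the triangle inequality: it forces [edot u v = enorm u * enorm v], and then the
    squared norm of the difference of the two sides vanishes. This is what aligns points with normal
    rays below. *)
Lemma enorm_add_eq (u v : 'rV[R]_d) : enorm (u + v) = enorm u + enorm v ->
  enorm v *: u = enorm u *: v.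
Proof.
move=> /(congr1 (fun t : R => t ^+ 2)); rewrite sqr_enorm edotD2 sqrrD.
rewrite -!sqr_enorm => h; apply/eqP; rewrite -subr_eq0 -enorm_eq0 -sqrf_eq0.
rewrite sqr_enorm edotB2 !edotZl !edotZr -!sqr_enorm.
have -> : edot u v = enorm u * enorm v by lra.
by apply/eqP; ring.
Qed.

(** * Distance to a set with unique nearest points *)

Section unique_nearest.
Variables (S : set 'rV[R]_d) (r : R).
Hypotheses (S0 : S !=set0) (cS : closed S).
Hypothesis uS : forall x, sdist S x < r ->
  forall a b, S a -> S b -> enorm (x - a) = sdist S x ->
  enorm (x - b) = sdist S x -> a = b.
Local Notation D := (sdist S).

(** Continuity of the nearest-point map, by compactness: on the points of [S] within [D x + 1] of x
    but at least m from a, the distance to x attains a minimum, which uniqueness puts strictly above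
    [D x]. *)
Lemma near_nearest x a (m : R) : D x < r -> S a -> enorm (x - a) = D x -> 0 < m ->
  exists2 v, 0 < v & forall b, S b -> enorm (x - b) <= D x + v -> enorm (b - a) < m.
Proof.
move=> xr Sa xa m0.
pose A := S `&` [set b | enorm (x - b) <= D x + 1] `&` [set b | m <= enorm (b - a)].
have [A0|/set0P A0] := eqVneq A set0.
  exists 1 => // b Sb xb; rewrite ltNge; apply/negP => ab.
  by have : A b by []; rewrite A0.
have cA : compact A.
  rewrite /A setIAC setIC; apply: compact_closedI.
    exact: compact_closed_ball_enorm.
  apply: closedI => //; apply: closed_enorm => b cb.
  apply/ler_addgt0Pr => e e0; have [z /= mz bz] := cb e e0.
  apply: le_trans mz _; apply: le_trans (enorm_tri z b a) _.
  by rewrite addrC lerD2l enormC ltW.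
have [b [[Sb xb] mb] bmin] := compact_minimizer A0 cA (@continuous_enormB _ _ x).
have Db : D x < enorm (x - b).
  rewrite lt_neqAle sdist_le// andbT; apply/eqP => /esym xbE.
  by move: mb; rewrite (uS xr Sb Sa xbE xa) /= subrr enorm0 leNgt m0.
exists (Num.min 1 ((enorm (x - b) - D x) / 2)).
  by rewrite lt_min ltr01/= divr_gt0// subr_gt0.
move=> c Sc; rewrite -lerBlDl le_min => /andP[c1 c2].
rewrite ltNge; apply/negP => mc.
have : enorm (x - b) <= enorm (x - c).
  by apply: bmin; split => //; split => //=; rewrite -lerBlDl.
lra.
Qed.

(** The distance grows with slope 1 in the direction n away from the nearest point a. A nearest
    point b of [x + h *: n] is close to a by [near_nearest], so [edot n (x - b)] is almost [D x],
    and expanding the square of [x + h *: n - b] gives a gain of more than k h. *)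
Lemma sdist_slope x (k e0 : R) : 0 < D x -> D x < r -> 0 <= k -> k < 1 -> 0 < e0 ->
  exists2 y, enorm (y - x) < e0 & D x + k * enorm (y - x) < D y.
Proof.
move=> x0 xr k0 k1 e00; have [a Sa xa] := nearest_exists x cS S0.
have m0 : 0 < (1 - k) * D x by rewrite mulr_gt0// subr_gt0.
have [v v0 vP] := near_nearest xr Sa xa m0.
pose h := Num.min (v / 2) (e0 / 2).
have h0 : 0 < h by rewrite lt_min !divr_gt0.
have [hv he] : h <= v / 2 /\ h <= e0 / 2 by split; rewrite ge_min lexx ?orbT.
pose n := (D x)^-1 *: (x - a).
have nn : enorm n = 1.
  by rewrite /n -xa enorm_dirE// -enorm_gt0 xa.
have na : edot n (x - a) = D x.
  by rewrite edotZl -sqr_enorm xa expr2 mulrA mulVf ?mul1r// gt_eqF.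
clearbody n.
have ynx : enorm (x + h *: n - x) = h.
  by rewrite addrAC subrr add0r enormZ nn mulr1 gtr0_norm.
exists (x + h *: n); rewrite ynx; first lra.
have [b Sb xb] := nearest_exists (x + h *: n) cS S0.
have Dy : D (x + h *: n) <= D x + h by rewrite -{2}ynx sdist_tri.
have ab : enorm (b - a) < (1 - k) * D x.
  apply: vP => //; apply: le_trans (enorm_tri _ (x + h *: n) _) _.
  rewrite xb enormC ynx; lra.
have nb : k * D x <= edot n (x - b).
  have -> : x - b = x - a - (b - a) by rewrite opprB addrA subrK.
  rewrite edotBr; have := edot_le n (b - a); rewrite nn.
  rewrite na.
  lra.
have : D (x + h *: n) ^+ 2 = enorm (x - b) ^+ 2 + 2 * h * edot n (x - b) + h ^+ 2.
  rewrite -xb (addrAC x) sqr_enorm (edotD2 (x - b)) !edotZr edotZl -!sqr_enorm nn.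
  by rewrite (edotC (x - b)); ring.
have xbD : D x <= enorm (x - b) by exact: sdist_le.
have Dy0 := sdist_ge0 (x + h *: n) S0.
move: (enorm _) xbD (edot _ _) nb (D (_ + _)) Dy0 Dy => B xbD E nb Y Y0 Dy Y2.
rewrite ltNge; apply/negP => Yle; have kh0 : 0 <= k * h by rewrite mulr_ge0// ltW.
have : Y ^+ 2 <= (D x + k * h) ^+ 2 by apply: lerXn2r => //; rewrite nnegrE; lra.
have : D x ^+ 2 <= B ^+ 2 by apply: lerXn2r; rewrite ?nnegrE//; lra.
have : h * (k * D x) <= h * E by rewrite ler_pM2l.
have : k ^+ 2 * h ^+ 2 < h ^+ 2.
  by rewrite gtr_pMl ?exprn_gt0// expr_lt1.
rewrite Y2 sqrrD; lra.
Qed.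

(** Stands in for following the gradient flow of the distance for time t: instead,
    [D z - k * enorm (x - z)] is maximized on the closed ball of radius t, with k so close to 1 that
    the loss is at most e. *)
Lemma sdist_ext x (t : R) : 0 < D x -> 0 <= t -> D x + t < r ->
  exists2 y, enorm (y - x) <= t & D y = D x + t.
Proof.
move=> x0 t0 xtr.
have B0 : [set y | enorm (x - y) <= t] !=set0 by exists x; rewrite /= subrr enorm0.
have cB := @compact_closed_ball_enorm R d x t.
have [y xy ymax] := compact_maximizer B0 cB (continuous_sdist S0).
exists y; first by rewrite enormC.
apply/eqP; rewrite eq_le; apply/andP; split.
  by apply: le_trans (sdist_tri y x S0) _; rewrite lerD2l enormC.
apply/ler_addgt0Pl => e e0.
pose k := Num.max 0 (1 - e / (t + 1)).
have k0 : 0 <= k by rewrite le_max lexx.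
have k1 : k < 1 by rewrite gt_max ltr01/= ltrBlDr ltrDl divr_gt0// ltr_wpDl.
have ke : t <= k * t + e.
  have : (1 - e / (t + 1)) * t <= k * t by rewrite ler_wpM2r// le_max lexx orbT.
  suff : e / (t + 1) * t <= e by lra.
  by rewrite mulrAC ler_pdivrMr ?ltr_wpDl// ler_pM2l// lerDl.
have cf : continuous (fun z => D z - k * enorm (x - z)).
  apply: (@lipschitz_continuous_enorm _ _ _ (1 + k)) => u v.
  have -> : D u - k * enorm (x - u) - (D v - k * enorm (x - v)) =
      (D u - D v) - k * (enorm (x - u) - enorm (x - v)) by ring.
  apply: le_trans (ler_normB _ _) _; rewrite mulrDl mul1r lerD ?sdist_lip//.
  rewrite normrM ger0_norm// ler_wpM2l//.
  apply: le_trans (enorm_dist_le _ _) _.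
  by rewrite opprB addrC addrA subrK enormC.
(* By [sdist_slope], z can only lie on the sphere of radius t. *)
have [z /= xz zmax] := compact_maximizer B0 cB cf.
have Dz : D x + k * enorm (x - z) <= D z.
  have := zmax x; rewrite /= subrr enorm0 mulr0 subr0 => /(_ t0); lra.
suff xzt : t <= enorm (x - z).
  have := ymax z xz; have : k * t <= k * enorm (x - z) by rewrite ler_wpM2l.
  lra.
rewrite leNgt; apply/negP => xzt.
have Dz0 : 0 < D z by apply: lt_le_trans x0 _; apply: le_trans Dz; rewrite lerDl mulr_ge0.
have Dzr : D z < r.
  apply: le_lt_trans xtr; apply: le_trans (sdist_tri z x S0) _.
  by rewrite lerD2l enormC.
have [|w zw wD] := sdist_slope Dz0 Dzr k0 k1 (_ : 0 < t - enorm (x - z)).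
  by rewrite subr_gt0.
have xw := enorm_tri x z w; rewrite (enormC z w) in xw.
have : D w - k * enorm (x - w) <= D z - k * enorm (x - z) by apply: zmax => /=; lra.
have : k * enorm (x - w) <= k * (enorm (x - z) + enorm (w - z)) by rewrite ler_wpM2l.
lra.
Qed.

(** The nearest point does not change along the normal ray up to distance r. Beyond x, the point y
    of [sdist_ext] is at distance p from a, which is equality in the triangle inequality through x,
    so y is the point of the ray; before x the 1-Lipschitz bound suffices. *)
Lemma sdist_ray x a (p : R) : 0 < D x -> D x < r -> S a -> enorm (x - a) = D x ->
  0 <= p -> p < r -> D (a + p *: ((D x)^-1 *: (x - a))) = p.
Proof.
move=> x0 xr Sa xa p0 pr; set n := (D x)^-1 *: (x - a).
have nn : enorm n = 1 by rewrite /n -xa enorm_dirE// -enorm_gt0 xa.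
have xE : x = a + D x *: n.
  by rewrite /n scalerA divff ?gt_eqF// scale1r addrC subrK.
have le_p : D (a + p *: n) <= p.
  apply: le_trans (sdist_le _ Sa) _.
  by rewrite addrAC subrr add0r enormZ nn mulr1 ger0_norm.
apply/eqP; rewrite eq_le le_p/=; have [px|xp] := leP p (D x).
  have := sdist_tri x (a + p *: n) S0.
  have -> : x - (a + p *: n) = (D x - p) *: n.
    by rewrite [in LHS]xE scalerBl opprD addrACA subrr add0r.
  by rewrite enormZ nn mulr1 ger0_norm ?subr_ge0//; lra.
have [||y yx yD] := @sdist_ext x (p - D x) x0; first by rewrite subr_ge0 ltW.
  by rewrite addrC subrK.
have yp : D y = p by lra.
have ya : p <= enorm (y - a) by rewrite -yp sdist_le.
have eqy : enorm (y - x + (x - a)) = enorm (y - x) + enorm (x - a).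
  apply/eqP; rewrite eq_le enormD/= addrA subrK xa.
  by apply: le_trans ya; lra.
have yxE : enorm (y - x) = p - D x.
  move: eqy; rewrite addrA subrK xa => eqy; apply/eqP; rewrite eq_le yx/=.
  rewrite lerBlDr; lra.
suff -> : a + p *: n = y by rewrite yp.
have := enorm_add_eq eqy; rewrite xa yxE => /(congr1 ( *:%R (D x)^-1)).
rewrite scalerA mulVf ?gt_eqF// scale1r scalerA mulrC -scalerA -/n => yE.
have -> : y = (p - D x) *: n + x by rewrite -yE subrK.
by rewrite scalerBl; move: (D x *: n) xE => w ->; rewrite addrCA subrK.
Qed.

End unique_nearest.

Lemma reach_unique S (r : R) x : reach S = r%:E -> sdist S x < r ->
  forall a b, S a -> S b -> enorm (x - a) = sdist S x ->
  enorm (x - b) = sdist S x -> a = b.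
Proof.
move=> Sr xr a b Sa Sb xa xb.
have : ((sdist S x)%:E < reach S)%E by rewrite Sr lte_fin.
rewrite /reach => /ereal_sup_gt[_ [s [s0 sP] <-]]; rewrite lte_fin => /sP[c [_ cu]].
by rewrite -(cu a)// (cu b).
Qed.

Lemma reach_nonempty S (r : R) : 0 < r -> reach S = r%:E -> S !=set0.
Proof.
move=> r0 Sr; have : (0 < reach S)%E by rewrite Sr lte_fin.
rewrite /reach => /ereal_sup_gt[_ [s [s0 sP] <-]]; rewrite lte_fin => s1.
apply/set0P/negP => /eqP S0; have [] := sP 0; last by move=> y [[]]; rewrite S0.
suff -> : setdist [set (0 : 'rV[R]_d)] S = 0 by [].
rewrite /setdist S0 (_ : [set _ | _ in _ & _ in _] = set0) ?inf0//.
by apply/seteqP; split => // _ [u _ [v []]].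
Qed.

End distance.

(** * Domains with C^{1,1} boundary *)

Section domain.
Context {R : realType} {d : nat}.
Implicit Types (x y z a b : 'rV[R]_d) (Omega : set 'rV[R]_d).

Lemma boundary_closed Omega : closed (boundary Omega).
Proof.
rewrite /boundary setDE; apply: closedI; first exact: closed_closure.
by apply: open_closedC; exact: open_interior.
Qed.

Lemma boundaryP Omega x : open Omega ->
  boundary Omega x <-> closure Omega x /\ ~ Omega x.
Proof. by rewrite /boundary => /interior_id ->. Qed.

(** Among the points outside Omega of the segment, which the inequality between distances describes,
    take c closest to x. The points q slightly nearer to x must then lie in Omega, so c is in the
    closure. *)
Lemma segment_boundary Omega x y : open Omega -> Omega x -> ~ Omega y ->
  exists2 c, boundary Omega c & enorm (x - c) + enorm (c - y) <= enorm (x - y).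
Proof.
move=> oO Ox nOy.
pose h c := enorm (x - c) + enorm (c - y).
have hc : continuous h.
  apply: (@lipschitz_continuous_enorm _ _ _ 2) => u v.
  have -> : h u - h v =
    (enorm (x - u) - enorm (x - v)) + (enorm (u - y) - enorm (v - y)).
    by rewrite /h; ring.
  apply: le_trans (ler_normD _ _) _; rewrite mulr_natl mulr2n lerD//.
    apply: le_trans (enorm_dist_le _ _) _.
    by rewrite opprB addrC addrA subrK enormC.
  apply: le_trans (enorm_dist_le _ _) _.
  by rewrite opprB addrA subrK.
pose A := ~` Omega `&` [set c | h c <= enorm (x - y)].
have hclosed : closed [set c | h c <= enorm (x - y)].
  have -> : [set c | h c <= enorm (x - y)] = h @^-1` [set t | t <= enorm (x - y)] by [].
  by apply: preimage_closed => [c _|]; [exact: hc|exact: closed_le].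
have cA : compact A.
  have -> : A = [set c | enorm (x - c) <= enorm (x - y)] `&` A.
    rewrite setIC; apply/esym/setIidl => c [_ /=]; apply: le_trans.
    by rewrite /h lerDl.
  apply: compact_closedI; first exact: compact_closed_ball_enorm.
  by apply: closedI => //; exact: open_closedC.
have A0 : A !=set0 by exists y; split => //=; rewrite /h subrr enorm0 addr0.
have [c [nOc hxc] cmin] := compact_minimizer A0 cA (@continuous_enormB _ _ x).
exists c => //; apply/boundaryP => //; split => //.
have xc : x != c by apply/eqP => xc; apply: nOc; rewrite -xc.
have xc0 : 0 < enorm (x - c) by rewrite enorm_gt0 subr_eq0.
apply/closure_enormP => e e0.
pose s := Num.min (1 / 2) (e / 2 / enorm (x - c)).
have s0 : 0 < s by rewrite lt_min !divr_gt0.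
have s1 : s <= 1 / 2 by rewrite ge_min lexx.
have se : s * enorm (x - c) <= e / 2.
  by rewrite -ler_pdivlMr// ge_min lexx orbT.
pose q := c + s *: (x - c).
have xq : enorm (x - q) = (1 - s) * enorm (x - c).
  have -> : x - q = (1 - s) *: (x - c) by rewrite /q scalerBl scale1r opprD addrA.
  by rewrite enormZ ger0_norm//; lra.
have qc : enorm (q - c) = s * enorm (x - c).
  by rewrite /q addrAC subrr add0r enormZ gtr0_norm.
exists q; last by rewrite enormC qc; lra.
apply: contrapT => nOq; have /cmin : A q.
  split => //=; have := enorm_tri q c y; rewrite /h xq qc.
  by move: hxc; rewrite /= /h; lra.
have := mulr_gt0 s0 xc0; rewrite xq; lra.
Qed.

Lemma sdist_in_domain Omega x y : open Omega -> Omega x ->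
  enorm (x - y) < sdist (boundary Omega) x -> Omega y.
Proof.
move=> oO Ox xy; apply: contrapT => nOy.
have [c Sc] := segment_boundary oO Ox nOy.
have := sdist_le x Sc; have := enorm_ge0 (c - y); lra.
Qed.

Lemma sdist_gt0 Omega x : open Omega -> boundary Omega !=set0 -> Omega x ->
  0 < sdist (boundary Omega) x.
Proof.
move=> oO S0 Ox; have [e e0 eO] := (open_enormP _).1 oO x Ox.
apply: lt_le_trans e0 _; apply: sdist_ge => // y /(boundaryP _ oO)[_ nOy].
by rewrite leNgt; apply/negP => /eO.
Qed.

Lemma mvt_lower (f D : R -> R) (B : R) :
  (forall t : R, is_derive t (1 : R) f (D t)) ->
  (forall t, 0 < t -> t < 1 -> D 0 - D t <= B) -> f 0 + D 0 - B <= f 1.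
Proof.
move=> df DB; have [|c /=] := @MVT R f D 0 1 ltr01 (fun t _ => df t).
  apply: continuous_subspaceT => t.
  apply: differentiable_continuous; apply/derivable1_diffP.
  exact: (@ex_derive _ _ _ _ _ _ _ (df t)).
rewrite in_itv/= => /andP[c0 c1]; rewrite subr0 mulr1.
have := DB c c0 c1; lra.
Qed.

Lemma C11_taylor_ge (h : 'rV[R]_d -> R) : C11 h ->
  exists2 L : R, 0 < L & forall w, h 0 + 'd h 0 w - L * enorm w ^+ 2 <= h w.
Proof.
move=> [dh [L hL]]; exists (`|L| + 1) => [|w]; first by rewrite ltr_wpDl.
pose D (t : R) : R := 'd h (t *: w) w.
have df (t : R) : is_derive t (1 : R) (fun t : R => h (t *: w) : R) (D t).
  have dt : differentiable (fun t : R => t *: w) t by [].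
  have dft : differentiable (fun t : R => h (t *: w)) t.
    exact: (differentiable_comp dt).
  apply: DeriveDef; first exact/derivable1_diffP.
  rewrite deriveE// (_ : (fun t : R => h (t *: w)) = h \o (fun t : R => t *: w))//.
  rewrite diff_comp//= (_ : 'd _ t 1 = w)//.
  by have dw := is_diff_scalel t w; rewrite diff_val scale1r.
have D0 : D 0 = 'd h 0 w by exact: (congr1 (fun y => 'd h y w : R) (scale0r w)).
have h0 : h (0 *: w) = h 0 by exact: (congr1 h (scale0r w)).
have h1 : h (1 *: w) = h w by exact: (congr1 h (scale1r w)).
suff DB t : 0 < t -> t < 1 -> D 0 - D t <= (`|L| + 1) * enorm w ^+ 2.
  by have := mvt_lower df DB; rewrite D0 h0 h1.
move=> t0 t1; rewrite D0.
apply: le_trans (ler_norm _) _; apply: le_trans (hL _ _ _) _.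
rewrite sub0r enormN enormZ (gtr0_norm t0) expr2.
move: (enorm w) (enorm_ge0 w) => W W0; clear - t0 t1 W0.
rewrite -!mulrA; set V := t * (W * W).
have V0 : 0 <= V by rewrite mulr_ge0 ?mulr_ge0// ltW.
apply: (@le_trans _ _ (`|L| * V)); first by rewrite ler_wpM2r// ler_norm.
apply: ler_pM => //; first by rewrite lerDl.
by rewrite /V ler_piMl ?mulr_ge0// ltW.
Qed.

Lemma edot_mulmx (Q : 'M[R]_d) x y : Q *m Q^T = 1%:M ->
  edot (x *m Q) (y *m Q) = edot x y.
Proof.
have E u v : edot u v = (u *m v^T) 0 0.
  by rewrite mxE; apply: eq_bigr => i _; rewrite mxE.
by move=> QQ; rewrite !E trmx_mul mulmxA -(mulmxA x) QQ mulmx1.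
Qed.

Lemma enorm_mulmx (Q : 'M[R]_d) x : Q *m Q^T = 1%:M -> enorm (x *m Q) = enorm x.
Proof.
move=> QQ; apply: (@pexpIrn _ 2); rewrite ?nnegrE//.
by rewrite !sqr_enorm edot_mulmx.
Qed.

End domain.

Section C11_domain.
Context {R : realType} {d : nat}.
Implicit Types (x y z a b : 'rV[R]_d) (Omega : set 'rV[R]_d).

Lemma enorm_col' (k : 'I_d) z : enorm (col' k z) <= enorm z.
Proof.
rewrite enorm_le// sqr_enorm /edot; case: d k z => [[]//|m] k z /=.
rewrite (bigD1_ord k)//= -[leLHS]add0r lerD//.
  by rewrite -expr2 sqr_ge0.
by apply: ler_sum => i _; rewrite !mxE.
Qed.

(** N is the normal of the graph of l, assembled from its coordinates; its k-th coordinate is 1,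
    hence it does not vanish. *)
Lemma graph_normal (k : 'I_d) (l : {linear 'rV[R]_d.-1 -> R}) :
  exists2 N, N != 0 & forall z, edot N z = z ord0 k - l (col' k z).
Proof.
pose N : 'rV[R]_d := \row_j ((delta_mx 0 j : 'rV[R]_d) ord0 k - l (col' k (delta_mx 0 j))).
have NE z : edot N z = z ord0 k - l (col' k z).
  rewrite {2 3}(row_sum_delta z) summxE !linear_sum/=.
  rewrite -big_split/=.
  apply: eq_bigr => j _; rewrite !linearZ/= !mxE/=.
  rewrite mulrBl (mulrC (k == j)%:R) (mulrC (l _)); congr (_ + _).
  exact/esym/mulrN.
exists N => //; apply/eqP => N0.
have := NE (delta_mx 0 k); rewrite N0 edot0l.
have -> : col' k (delta_mx 0 k : 'rV[R]_d) = 0.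
  by apply/rowP => j; rewrite !mxE /= [lift k j == k]eq_sym (negbTE (neq_lift _ _)).
by rewrite linear0 subr0 mxE !eqxx/= => /eqP; rewrite eq_sym oner_eq0.
Qed.

(** In the chart, q lies on the downward normal of the graph, at a distance t |N| so small that the
    quadratic error of [C11_taylor_ge] cannot bring points of Omega into the ball: this is the bound
    t <= 1 / (2 L). Points outside the chart are too far away because t |N| <= r0 / 4. *)
Lemma exterior_touching Omega s (e : R) : open Omega -> C11_boundary Omega ->
  boundary Omega s -> 0 < e ->
  exists q, [/\ 0 < enorm (q - s), enorm (q - s) < e &
    forall z, Omega z -> enorm (q - s) <= enorm (z - q)].
Proof.
move=> oO C Ss e0; have [r0 [Q [k [h [r00 QQ hC11 hO]]]]] := C s Ss.
have [L L0 hL] := C11_taylor_ge hC11.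
have nOs : ~ Omega s by case: ((boundaryP s oO).1 Ss).
have h0 : 0 <= h 0.
  rewrite leNgt; apply/negP => h0; apply: nOs; apply/hO.
    by rewrite subrr enorm0.
  by rewrite subrr mul0mx (_ : col' k 0 = 0) ?mxE//; apply/rowP => i; rewrite !mxE.
have [N N0 NE] := graph_normal k ('d h 0).
have n0 : 0 < enorm N by rewrite enorm_gt0.
have QQ' : Q^T *m Q = 1%:M by exact: mulmx1C.
pose t := Num.min (1 / (2 * L)) (Num.min (e / 2) (r0 / 4) / enorm N).
have t0 : 0 < t by rewrite lt_min !divr_gt0 ?mulr_gt0// lt_min !divr_gt0.
have tL : t * (2 * L) <= 1 by rewrite -ler_pdivlMr ?mulr_gt0// ge_min lexx.
have te : t * enorm N <= Num.min (e / 2) (r0 / 4).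
  by rewrite -ler_pdivlMr// ge_min lexx orbT.
move: te; rewrite le_min => /andP[te tr].
exists (s - t *: (N *m Q^T)).
have qs : enorm (s - t *: (N *m Q^T) - s) = t * enorm N.
  rewrite addrAC subrr add0r enormN enormZ gtr0_norm// -(enorm_mulmx (N *m Q^T) QQ).
  by rewrite -mulmxA QQ' mulmx1.
rewrite qs; split; [exact: mulr_gt0|lra|move=> z Oz].
have [sz|sz] := leP r0 (enorm (z - s)).
  have := enorm_tri z (s - t *: (N *m Q^T)) s; rewrite qs; lra.
have /hO := Oz => /(_ sz) /=; set w := (z - s) *m Q => hw.
have := hL (col' k w) => hL'.
have NW : - (L * enorm w ^+ 2) <= edot N w.
  rewrite NE; have : L * enorm (col' k w) ^+ 2 <= L * enorm w ^+ 2.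
    by rewrite ler_pM2l// ler_pXn2r ?nnegrE// enorm_col'.
  lra.
have -> : z - (s - t *: (N *m Q^T)) = (z - s) + t *: (N *m Q^T).
  by rewrite opprB addrA addrC addrA (addrC (- s)).
rewrite -(enorm_mulmx (z - s + _) QQ) mulmxDl -/w -scalemxAl -mulmxA QQ' mulmx1.
rewrite -(@ler_pXn2r _ 2) ?nnegrE ?mulr_ge0 ?(ltW t0)// sqr_enorm edotD2.
rewrite !edotZr edotZl -!sqr_enorm (edotC w).
have : t * - (L * enorm w ^+ 2) <= t * edot N w by rewrite ler_pM2l.
have : t * (2 * L) * enorm w ^+ 2 <= 1 * enorm w ^+ 2 by rewrite ler_wpM2r ?sqr_ge0.
rewrite exprMn (expr2 t) -mulrA; lra.
Qed.

End C11_domain.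

(** * Pushing a domain into its interior *)

Section reach_domain.
Context {R : realType} {d : nat}.
Implicit Types (x y z a b c s n : 'rV[R]_d).
Variables (Omega : set 'rV[R]_d) (r : R).
Hypotheses (oO : open Omega) (C11O : C11_boundary Omega) (r0 : 0 < r)
  (rO : reach (boundary Omega) = r%:E).
Local Notation S := (boundary Omega).
Local Notation D := (sdist S).

Let S0 : S !=set0 := reach_nonempty r0 rO.
Let cS : closed S := @boundary_closed _ _ Omega.
Let uS x (xr : D x < r) := reach_unique rO xr.

Lemma sdist_across x y : Omega x -> ~ Omega y -> D x + D y <= enorm (x - y).
Proof.
move=> Ox Oy; have [c Sc] := segment_boundary oO Ox Oy.
by apply: le_trans; apply: lerD; rewrite ?(enormC c) sdist_le.
Qed.

(* The last clause says that the ball of radius r around [s - r n] lies outside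
   Omega. *)
Lemma normal_frame x : Omega x -> D x < r -> exists s n,
  [/\ enorm n = 1, x = s + D x *: n,
    forall p, 0 < p -> p < r -> D (s + p *: n) = p /\ Omega (s + p *: n) &
    forall z, Omega z -> r + D z <= enorm (z - s + r *: n)].
Proof.
move=> Ox xr; have x0 := sdist_gt0 oO S0 Ox.
have [s Ss xs] := nearest_exists x cS S0.
have ray p := sdist_ray S0 cS uS x0 xr Ss xs (p := p).
set n := (D x)^-1 *: (x - s) in ray.
have nn : enorm n = 1 by rewrite /n -xs enorm_dirE// -enorm_gt0 xs.
have xE : x = s + D x *: n.
  by rewrite /n scalerA divff ?gt_eqF// scale1r addrC subrK.
clearbody n; exists s, n; split => //.
  move=> p p0 pr; have Dp := ray p (ltW p0) pr; split => //.
  apply: contrapT => nO; have := sdist_across Ox nO; rewrite Dp [in leRHS]xE.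
  rewrite opprD addrACA subrr add0r -scalerBl enormZ nn mulr1.
  by rewrite ler_normr => /orP[]; lra.
have [q [q0 qr qO]] := exterior_touching oO C11O Ss r0.
have Dq : D q = enorm (q - s).
  apply/eqP; rewrite eq_le sdist_le//=; apply: sdist_ge => // b /(boundaryP _ oO)[clb _].
  apply/ler_addgt0Pr => e e0; have [z Oz bz] := (closure_enormP _ _).1 clb e e0.
  by have := qO z Oz; have := enorm_tri q b z; rewrite (enormC q z); lra.
have nOq : ~ Omega q by move=> /qO; rewrite subrr enorm0; lra.
(* x and q are on opposite sides of the boundary with the common nearest point s, so [sdist_across]
   gives equality in the triangle inequality: q lies on the line through s along n. *)
have qE : q = s - D q *: n.
  have eq1 : enorm (x - s + (s - q)) = enorm (x - s) + enorm (s - q).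
    apply/eqP; rewrite eq_le enormD addrA subrK xs (enormC s) -Dq.
    exact: sdist_across.
  have := enorm_add_eq eq1; rewrite (enormC s) -Dq xs [X in X - s]xE.
  rewrite [s + _]addrC addrK scalerA mulrC -scalerA => /(scalerI (lt0r_neq0 x0)) ->.
  by rewrite subKr.
have [tau tE] : exists tau : R, D q = tau by exists (D q).
rewrite tE in Dq qE; rewrite -Dq in q0 qr.
(* The normal ray of q, prolonged to any p < r, stays outside Omega: a point of it in Omega would be
   at least [p + D q] away from q, which is on the same side of s. *)
have ext p : 0 < p -> p < r -> forall z, Omega z -> p + D z <= enorm (z - s + p *: n).
  move=> p0 pr z Oz; have q1 : D q < r by rewrite tE.
  have q2 : 0 < D q by rewrite tE.
  have qs : enorm (q - s) = D q by rewrite tE Dq.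
  have := sdist_ray S0 cS uS q2 q1 Ss qs (ltW p0) pr.
  rewrite tE [X in X - s]qE addrAC subrr add0r scalerN scalerA mulVf ?gt_eqF// scale1r.
  rewrite scalerN => Dc; have nOc : ~ Omega (s - p *: n).
    move=> /sdist_across/(_ nOq); rewrite Dc tE [X in _ - X]qE.
    have -> : s - p *: n - (s - tau *: n) = (tau - p) *: n.
      by apply/rowP => i; rewrite !mxE; ring.
    rewrite enormZ nn mulr1 ler_normr => /orP[]; lra.
  have := sdist_across Oz nOc; rewrite Dc addrC.
  by have -> : z - (s - p *: n) = z - s + p *: n by rewrite opprB addrA addrAC.
(* Rays are controlled only for p < r; the ball of radius r is reached in the limit. *)
move=> z Oz; apply/ler_addgt0Pr => e e0.
pose p := Num.max (r / 2) (r - e / 2).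
have p0 : 0 < p by rewrite lt_max divr_gt0.
have pr : p < r by rewrite gt_max; apply/andP; split; lra.
have pe : r - p <= e / 2.
  by rewrite lerBlDr -lerBlDl; rewrite le_max lexx orbT.
have := ext p p0 pr z Oz.
have : enorm (z - s + p *: n) <= enorm (z - s + r *: n) + (r - p).
  have -> : z - s + p *: n = z - s + r *: n - (r - p) *: n.
    by rewrite scalerBl opprB addrA addrAC addrK.
  apply: le_trans (enormB _ _) _; rewrite lerD2l enormZ nn mulr1 ger0_norm//.
  by rewrite subr_ge0 ltW.
lra.
Qed.

(** When x is too close to the boundary, a is the point [s + t *: n] of its normal ray. The last
    clause is the variational inequality of a projection onto the set [t <= D], up to a quadratic
    defect: by [normal_frame] the open ball of radius r + t around [s - r *: n] contains no b with
    [t <= D b]. *)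
Lemma push_exists x (t : R) : Omega x -> 0 < t -> t < r -> exists a,
  [/\ Omega a, t <= D a, enorm (x - a) <= t, (t <= D x -> a = x) &
    forall b, Omega b -> t <= D b ->
      edot (x - a) (b - a) <= t * enorm (b - a) ^+ 2 / (2 * r)].
Proof.
move=> Ox t0 tr; have [tx|xt] := leP t (D x).
  exists x; split => //; first by rewrite subrr enorm0 ltW.
  by move=> b _ _; rewrite subrr edot0l divr_ge0 ?mulr_ge0 ?sqr_ge0// ltW.
have [s [n [nn xE int ext]]] := normal_frame Ox (lt_trans xt tr).
have [Da Oa] := int t t0 tr; have x0 := sdist_gt0 oO S0 Ox.
have xa : x - (s + t *: n) = (D x - t) *: n.
  by rewrite [X in X - _]xE opprD addrACA subrr add0r -scalerBl.
exists (s + t *: n); split => //; rewrite ?Da//.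
  by rewrite xa enormZ nn mulr1 ler0_norm; lra.
move=> b Ob tb; rewrite xa edotZl.
have := ext b Ob; have -> : b - s + r *: n = b - (s + t *: n) + (r + t) *: n.
  by rewrite scalerDl opprD !addrA (addrAC _ (- (t *: n))) addrNK.
move: (b - _) => g rbg.
have rtg : (r + t) ^+ 2 <= enorm (g + (r + t) *: n) ^+ 2.
  apply: lerXn2r; rewrite ?nnegrE//; first lra.
  by apply: le_trans rbg; rewrite lerD2l.
move: rtg; rewrite sqr_enorm edotD2 !edotZr edotZl -!sqr_enorm nn expr1n mulr1.
rewrite (edotC g) ler_pdivlMr ?mulr_gt0//.
have := sqr_ge0 (enorm g); move: (enorm g ^+ 2) (edot n g) => G E G0 h.
have h1 : 0 <= G + 2 * ((r + t) * E) by lra.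
have h2 : (t - D x) * 0 <= (t - D x) * (G + 2 * ((r + t) * E)).
  by rewrite ler_pM2l// subr_gt0.
have [E0|E0] := leP 0 E.
  have : 0 <= (t - D x) * (r * E) by rewrite !mulr_ge0//; lra.
  have : 0 <= t * G by rewrite mulr_ge0// ltW.
  lra.
have : 0 <= (t - D x) * (t * - E) by rewrite !mulr_ge0//; lra.
have : 0 <= D x * G by rewrite mulr_ge0// ltW.
lra.
Qed.

(** Adding the two variational inequalities of [push_exists] shows that pushing expands distances at
    most by the factor 1 / (1 - t / r). *)
Lemma push_lipschitz (t : R) x a x' a' : 0 < t -> t < r ->
  edot (x - a) (a' - a) <= t * enorm (a' - a) ^+ 2 / (2 * r) ->
  edot (x' - a') (a - a') <= t * enorm (a - a') ^+ 2 / (2 * r) ->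
  (1 - t / r) * enorm (a - a') <= enorm (x - x').
Proof.
move=> t0 tr h1 h2.
have [->|aa] := eqVneq a a'; first by rewrite subrr enorm0 mulr0.
rewrite -subr_eq0 -enorm_gt0 in aa.
rewrite -(ler_pM2r aa) -mulrA -expr2.
apply: le_trans (edot_le _ _).
have E : edot (x - x') (a - a') =
    enorm (a - a') ^+ 2 - edot (x - a) (a' - a) - edot (x' - a') (a - a').
  rewrite sqr_enorm -(opprB a a') edotNr opprK -edotDl -edotBl.
  by congr edot; apply/rowP => i; rewrite !mxE; ring.
rewrite E; rewrite (enormC a') in h1.
have -> : (1 - t / r) * enorm (a - a') ^+ 2 =
  enorm (a - a') ^+ 2 - (t * enorm (a - a') ^+ 2 / (2 * r) +
   t * enorm (a - a') ^+ 2 / (2 * r)) by field; rewrite gt_eqF.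
lra.
Qed.

(** For the direction u from z to x the exterior ball of radius r gives [edot n u <= 1 / 4]: z,
    being deeper than x, is hardly seen in an outward direction. Hence [n - u] moves x both inwards
    and towards z, and the interior ball of radius r / 2 on the normal ray contains a ball around c.
    Its sample points are the neighbours across which a steep paraboloid centred at z drops. *)
Lemma boundary_inner_ball x z (e t : R) : Omega x -> Omega z ->
  D x < e -> 2 * D x <= D z -> enorm (x - z) <= r / 8 -> 0 < enorm (x - z) ->
  0 < t -> t <= 1 -> e <= r * t / 36 ->
  exists c, [/\ Omega c, t * e / 2 <= D c, enorm (x - c) <= 2 * t * e &
    3 / 4 * (t * e) * enorm (x - z) <= edot (x - z) (x - c)].
Proof.
move=> Ox Oz xe xz xzr xz0 t0 t1 er.
have x0 := sdist_gt0 oO S0 Ox; have e0 : 0 < e by apply: lt_trans xe.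
have rt : r * t <= r by rewrite ler_piMr// ltW.
have xr : D x < r by lra.
have [s [n [nn xE int ext]]] := normal_frame Ox xr.
set v := x - z; pose u := (enorm v)^-1 *: v.
have uu : enorm u = 1 by rewrite enorm_dirE// -enorm_gt0.
have vE : v = enorm v *: u by rewrite enorm_dirK.
have sx : enorm (z - s) <= 2 * enorm v.
  apply: le_trans (enorm_tri z x s) _; rewrite enormC -/v [X in X - s]xE.
  rewrite addrAC subrr add0r enormZ nn mulr1 gtr0_norm//.
  have := sdist_tri z x S0; rewrite enormC -/v; lra.
have nz : - (2 * enorm v ^+ 2 / r) <= edot n (z - x).
  have rz2 : r ^+ 2 <= enorm (z - s + r *: n) ^+ 2.
    rewrite ler_pXn2r ?nnegrE ?(ltW r0)//; apply: le_trans (ext z Oz).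
    by rewrite lerDl sdist_ge0.
  have rz : (r + D z) ^+ 2 <= enorm (z - s + r *: n) ^+ 2.
    rewrite ler_pXn2r ?nnegrE ?ext//; have := sdist_ge0 z S0; lra.
  move: rz; rewrite [leRHS]sqr_enorm edotD2 !edotZr edotZl -!sqr_enorm nn expr1n mulr1.
  have -> : z - x = (z - s) - D x *: n by rewrite [X in _ - X = _]xE opprD addrA.
  rewrite edotBr edotZr -sqr_enorm nn expr1n mulr1 (edotC (z - s)).
  have sx2 : enorm (z - s) ^+ 2 <= 4 * enorm v ^+ 2.
    have -> : 4 * enorm v ^+ 2 = (2 * enorm v) ^+ 2 by ring.
    by rewrite ler_pXn2r ?nnegrE ?mulr_ge0.
  move: (edot n _) (enorm _ ^+ 2) sx2 => E W WV h.
  rewrite lerNl ler_pdivlMr//.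
  have : 0 <= D z ^+ 2 by rewrite sqr_ge0.
  have : r * (2 * D x) <= r * D z by rewrite ler_pM2l.
  have : 0 <= r * D x by rewrite mulr_ge0// ltW.
  lra.
have nu : edot n u <= 1 / 4.
  have nv : edot n v = - edot n (z - x) by rewrite -edotNr opprB.
  rewrite -(ler_pM2l xz0) -/v -edotZr -vE nv.
  have : 2 * enorm v ^+ 2 / r <= enorm v * (1 / 4).
    rewrite ler_pdivrMr// expr2.
    have : enorm v * enorm v <= enorm v * (r / 8) by rewrite ler_pM2l.
    lra.
  lra.
have te0 : 0 < t * e by rewrite mulr_gt0.
pose c := x + (t * e) *: (n - u).
have nu2 : enorm (n - u) <= 2.
  by apply: le_trans (enormB _ _) _; rewrite nn uu; lra.
have xc : x - c = (t * e) *: (u - n).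
  by rewrite /c opprD addrA subrr add0r -scalerN opprB.
have p0 : 0 < r / 2 by lra.
have p1 : r / 2 < r by lra.
have [Do Oo] := int (r / 2) p0 p1.
have oc : enorm (s + r / 2 *: n - c) <= r / 2 - t * e / 2.
  pose g := D x *: n + (t * e) *: (n - u).
  have -> : s + r / 2 *: n - c = - (g - r / 2 *: n).
    rewrite /c /g [X in - (X + _)]xE; apply/rowP => i; rewrite !mxE; ring.
  have tr : t * e <= r by rewrite -[leRHS]mul1r ler_pM// ?(ltW t0) ?(ltW e0)//; lra.
  rewrite enormN enorm_le; last lra.
  have gn : enorm g <= 3 * e.
    apply: le_trans (enormD _ _) _; rewrite !enormZ nn mulr1 !gtr0_norm//.
    have : t * e * enorm (n - u) <= t * e * 2 by rewrite ler_pM2l.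
    have : t * e <= 1 * e by rewrite ler_pM2r.
    lra.
  have gE : 3 / 4 * (t * e) <= edot g n.
    rewrite /g edotDl !edotZl edotBl -sqr_enorm nn expr1n (edotC u).
    have : t * e * (edot n u) <= t * e * (1 / 4) by rewrite ler_pM2l.
    lra.
  rewrite edotB2 !edotZr !edotZl -!sqr_enorm nn expr1n.
  have g2 : enorm g ^+ 2 <= 9 * e * e.
    have -> : 9 * e * e = (3 * e) ^+ 2 by ring.
    by rewrite ler_pXn2r ?nnegrE//; lra.
  have : r / 2 * (3 / 4 * (t * e)) <= r / 2 * edot g n by rewrite ler_pM2l.
  have : e * e <= r * t / 36 * e by rewrite ler_pM2r.
  have : 0 <= (t * e) * (t * e) by rewrite mulr_ge0// ltW.
  move: (edot g n) (enorm g ^+ 2) g2 => E G; lra.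
exists c; split.
- by apply: (sdist_in_domain oO Oo); rewrite Do; lra.
- have := sdist_tri (s + r / 2 *: n) c S0; rewrite Do; lra.
- rewrite xc enormZ gtr0_norm// enormC.
  by rewrite mulrC -mulrA ler_wpM2r// ltW.
- rewrite xc {2}vE edotZl edotZr edotBr -sqr_enorm uu expr1n (edotC u).
  rewrite [leLHS]mulrC; rewrite ler_pM2l//.
  have : t * e * (edot n u) <= t * e * (1 / 4) by rewrite ler_pM2l.
  lra.
Qed.

End reach_domain.

(** * Lebesgue measure on R^n *)

Section lebesgue_invariance.
Context {R : realType}.
Local Open Scope ereal_scope.

Lemma lebesgue_measure_shift (a : R) (A : set R) : measurable A ->
  pushforward (@lebesgue_measure R) (fun x : measurableTypeR R => (x + a)%R : measurableTypeR R) A =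
  lebesgue_measure A.
Proof.
have ms : measurable_fun setT (fun x : measurableTypeR R => (x + a)%R : measurableTypeR R).
  exact: measurable_funD.
pose mixin := isMeasurableFun.Build _ _ _ _ _ ms.
pose F : {mfun _ >-> _} := HB.pack (fun x : measurableTypeR R => (x + a)%R : measurableTypeR R) mixin.
move=> mA; apply/esym.
apply: (@lebesgue_measure_unique R (pushforward lebesgue_measure F)) => //= _ [[u v]] _ <-.
rewrite /pushforward /=.
have -> : (fun x => (x + a)%R) @^-1` `]u, v]%classic = `](u - a)%R, (v - a)%R]%classic.
  by apply/seteqP; split => x /=; rewrite !in_itv/= ltrBlDr lerBrDr.
rewrite !lebesgue_measure_itv/= !lte_fin ltrD2r; case: ifP => // _.
by rewrite -!EFinD; congr (_%:E); ring.
Qed.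

Lemma integral_shift (a : R) (f : R -> \bar R) :
  measurable_fun setT f -> (forall x, 0 <= f x) ->
  \int[lebesgue_measure]_x f (x + a)%R = \int[lebesgue_measure]_x f x.
Proof.
move=> mf f0.
have ms : measurable_fun setT (fun x : measurableTypeR R => (x + a)%R : measurableTypeR R).
  exact: measurable_funD.
have := @ge0_integral_pushforward _ _ _ _ R _ ms lebesgue_measure setT f measurableT mf (fun x _ => f0 x).
rewrite preimage_setT => <-.
by apply: eq_measure_integral => A mA _; exact: lebesgue_measure_shift.
Qed.

Lemma integral_cons_rV n (f : 'rV[R]_(1 + n) -> \bar R) :
  measurable_fun setT f -> (forall x, 0 <= f x) ->
  \int[lebesgue_rV (1 + n)]_x f x =
  \int[lebesgue_measure]_t \int[lebesgue_rV n]_v f (cons_rV (t, v)).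
Proof.
move=> mf f0; rewrite /= /cons_measure.
rewrite (@ge0_integral_pushforward _ _ _ _ R _ (@measurable_cons_rV R n))//.
rewrite preimage_setT fubini_tonelli1//; last by move=> x; exact: f0.
by apply: measurableT_comp => //; exact: measurable_cons_rV.
Qed.

Lemma measurable_rV_add n (a : 'rV[R]_n) : measurable_fun setT (fun x : 'rV[R]_n => (x + a)%R).
Proof.
apply: measurable_fun_rVP => i; under eq_fun do rewrite mxE.
by apply: measurable_funD => //; exact: measurable_rV_coord.
Qed.

Lemma integral_rV_shift n (a : 'rV[R]_n) (f : 'rV[R]_n -> \bar R) :
  measurable_fun setT f -> (forall x, 0 <= f x) ->
  \int[lebesgue_rV n]_x f (x + a)%R = \int[lebesgue_rV n]_x f x.
Proof.
elim: n a f => [|n ih] a f mf f0.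
  by apply: eq_integral => x _; congr f; apply/rowP => -[].
have ma := measurable_rV_add a.
rewrite -[n.+1]/(1 + n)%N in a f mf f0 ma *.
rewrite [LHS]integral_cons_rV//; last exact: measurableT_comp.
rewrite [RHS](integral_cons_rV mf f0).
have mc := @measurable_cons_rV R n.
have -> : \int[lebesgue_measure]_t (\int[lebesgue_rV n]_v f (cons_rV (t, v) + a)%R) =
  \int[lebesgue_measure]_t (\int[lebesgue_rV n]_v f (cons_rV ((t + a ord0 ord0)%R, v))).
  apply: eq_integral => t _.
  rewrite -(ih (rsubmx a) (fun v => f (cons_rV ((t + a ord0 ord0)%R, v))))//; last first.
    apply: measurableT_comp => //; apply: measurableT_comp => //.
  apply: eq_integral => v _; congr f; apply/rowP => i; rewrite mxE.
  have [j ->|j ->] := split_ordP i; rewrite /cons_rV ?row_mxEl ?row_mxEr !mxE//.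
  rewrite (ord1 j) eqxx !mulr1n; congr (_ + _)%R.
  by congr (a _ _); apply/val_inj.
rewrite (integral_shift (a ord0 ord0) (f := fun t => \int[lebesgue_rV n]_v f (cons_rV (t, v))))//.
- apply: (@measurable_fun_fubini_tonelli_F _ _ _ _ R (lebesgue_rV n) (f \o @cons_rV R n)).
    by apply: measurableT_comp.
  by move=> x; exact: f0.
- by move=> t; apply: integral_ge0.
Qed.

Section haar.
Variables (n : nat) (T Ti : 'rV[R]_n -> 'rV[R]_n).
Hypotheses (mT : measurable_fun setT T) (TB : forall x y, T (x - y)%R = (T x - T y)%R)
  (TiK : forall x, T (Ti x) = x).
Local Notation mu := (lebesgue_rV n).

Lemma measurable_rV_addf d (U : measurableType d) (f g : U -> 'rV[R]_n) :
  measurable_fun setT f -> measurable_fun setT g ->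
  measurable_fun setT (fun x => f x + g x)%R.
Proof.
move=> mf mg; apply: measurable_fun_rVP => i; under eq_fun do rewrite mxE.
apply: measurable_funD.
- by apply: (measurableT_comp (measurable_rV_coord i)).
- by apply: (measurableT_comp (measurable_rV_coord i)).
Qed.

Lemma measurable_rV_oppf d (U : measurableType d) (f : U -> 'rV[R]_n) :
  measurable_fun setT f -> measurable_fun setT (fun x => - f x)%R.
Proof.
move=> mf; apply: measurable_fun_rVP => i; under eq_fun do rewrite mxE.
by apply: measurableT_comp => //; exact: (measurableT_comp (measurable_rV_coord i)).
Qed.

(* Both sides are [\int f(x) g(T y - x)] over the product, up to translations. *)
Lemma haar_exchange (f g : 'rV[R]_n -> \bar R) :
  measurable_fun setT f -> measurable_fun setT g ->
  (forall x, 0 <= f x) -> (forall x, 0 <= g x) ->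
  (\int[mu]_x f x) * (\int[mu]_x g (T x)) =
  (\int[mu]_x g (- (x : 'rV[R]_n))%R) * (\int[mu]_x f (T x)).
Proof.
move=> mf mg f0 g0.
have mfT : measurable_fun setT (fun x => f (T x)) by exact: measurableT_comp.
have mgT : measurable_fun setT (fun x => g (T x)) by exact: measurableT_comp.
have mgN : measurable_fun setT (fun x : 'rV[R]_n => g (- x)%R).
  by apply: measurableT_comp => //; exact: measurable_rV_oppf.
have TD (x y : 'rV[R]_n) : T (x + Ti y)%R = (T x + y)%R.
  rewrite -[y in RHS]TiK -[in RHS](opprK (T (Ti y))) -[X in (_ - X)%R]sub0r.
  by rewrite -{1}(subrr (T 0%R)) -TB subrr -TB -TB sub0r opprK.
have m1 : measurable_fun setT (fun z : 'rV[R]_n * 'rV[R]_n => f z.1 * g (T z.2 - z.1)%R).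
  apply: emeasurable_funM; first exact: measurableT_comp.
  apply: measurableT_comp => //; apply: measurable_rV_addf; first exact: measurableT_comp.
  by apply: measurable_rV_oppf.
have m2 : measurable_fun setT (fun z : 'rV[R]_n * 'rV[R]_n => f (z.1 + T z.2)%R * g (- z.1)%R).
  apply: emeasurable_funM.
    apply: measurableT_comp => //; apply: measurable_rV_addf => //.
    exact: measurableT_comp.
  by apply: measurableT_comp => //; apply: measurable_rV_oppf.
transitivity (\int[mu]_x \int[mu]_y (f x * g (T y - x)%R)).
  rewrite -ge0_integralZr//; last exact: integral_ge0.
  apply: eq_integral => x _; rewrite -ge0_integralZl//.
  rewrite -(integral_rV_shift (- Ti x) (f := fun y => f x * g (T y)))//.
  - apply: eq_integral => y _; congr (_ * g _).
    by rewrite TB TiK.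
  - by apply: emeasurable_funM => //; exact: measurable_cst.
  - by move=> y; rewrite mule_ge0.
rewrite (fubini_tonelli (fun z : 'rV[R]_n * 'rV[R]_n => f z.1 * g (T z.2 - z.1)%R))//=; last by move=> z; rewrite mule_ge0.
transitivity (\int[mu]_y \int[mu]_x (f (x + T y)%R * g (- x)%R)).
  apply: eq_integral => y _.
  rewrite -(integral_rV_shift (T y) (f := fun x => f x * g (T y - x)%R))//.
  - by apply: eq_integral => x _; rewrite opprD addrCA subrr addr0.
  - apply: emeasurable_funM => //; apply: measurableT_comp => //.
    by apply: measurable_rV_addf => //; apply: measurable_rV_oppf.
  - by move=> x; rewrite mule_ge0.
rewrite -(fubini_tonelli (fun z : 'rV[R]_n * 'rV[R]_n => f (z.1 + T z.2)%R * g (- z.1)%R))//=; last by move=> z; rewrite mule_ge0.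
rewrite -ge0_integralZr//; last exact: integral_ge0.
apply: eq_integral => x _; rewrite -ge0_integralZl//.
rewrite -(integral_rV_shift (Ti x) (f := fun y => g (- x)%R * f (T y)))//.
- by apply: eq_integral => y _; rewrite muleC TD addrC.
- by apply: emeasurable_funM => //; exact: measurable_cst.
- by move=> y; rewrite mule_ge0.
Qed.

End haar.
End lebesgue_invariance.

Section measurable_euclid.
Context {R : realType} {n : nat}.

Lemma measurable_edot (a : 'rV[R]_n) : measurable_fun setT (edot a).
Proof.
apply: measurable_sum => i; apply: measurable_funM => //.
exact: measurable_rV_coord.
Qed.

Lemma measurable_enorm : measurable_fun setT (@enorm R n).
Proof.
have -> : @enorm R n = Num.sqrt \o (fun x => \sum_i x ord0 i ^+ 2) by [].
apply: measurableT_comp.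
  by apply: continuous_measurable_fun; exact: sqrt_continuous.
by apply: measurable_sum => i; apply: measurable_funX; exact: measurable_rV_coord.
Qed.

Lemma measurable_scale_rV (c : R) :
  measurable_fun setT (fun x : 'rV[R]_n => c *: x).
Proof.
apply: measurable_fun_rVP => i; under eq_fun do rewrite mxE.
by apply: measurable_funM => //; exact: measurable_rV_coord.
Qed.

End measurable_euclid.

Section volume.
Context {R : realType} {n : nat}.
Local Notation mu := (lebesgue_rV n).

Definition cube (z : 'rV[R]_n) (a : R) : set 'rV[R]_n :=
  [set v | forall i, `[z ord0 i - a, z ord0 i + a]%classic (v ord0 i)].

Lemma measurable_rV_box (A : 'I_n -> set R) : (forall i, measurable (A i)) ->
  measurable [set v : 'rV[R]_n | forall i, A i (v ord0 i)].
Proof.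
move=> mA; rewrite (_ : [set v | _] = \bigcap_(i in [set: 'I_n])
      ((fun v : 'rV[R]_n => v ord0 i) @^-1` A i)); last first.
  by apply/seteqP; split => [v Av i _|v Av i]; [exact: Av|exact: (Av i)].
apply: fin_bigcap_measurable => // i _.
by rewrite -[X in measurable X]setTI; exact: measurable_rV_coord.
Qed.

Lemma measurable_cube z a : measurable (cube z a).
Proof.
apply: (@measurable_rV_box (fun i => `[z ord0 i - a, z ord0 i + a]%classic)) => i.
exact: measurable_itv.
Qed.

Lemma volume_cube z a : 0 < a -> mu (cube z a) = ((2 * a) ^+ n)%:E.
Proof.
move=> a0; rewrite /cube (lebesgue_rV_box (A := fun i => `[z ord0 i - a, z ord0 i + a]%classic)); last by move=> i; exact: measurable_itv.
rewrite (eq_bigr (fun=> (2 * a)%:E)); last first.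
  move=> i _; rewrite lebesgue_measure_itv/= lte_fin.
  rewrite (_ : _ - a < _ + a); last by lra.
  by rewrite -EFinD; congr (_%:E); ring.
by rewrite prodEFin prodr_const card_ord.
Qed.

Lemma integral_indic_cube z a : 0 < a ->
  (\int[mu]_x (\1_(cube z a) x)%:E = ((2 * a) ^+ n)%:E)%E.
Proof.
move=> a0; rewrite integral_indic//; last exact: measurable_cube.
by rewrite setIT; exact: volume_cube.
Qed.

Lemma cube_enorm z a y : 0 <= a -> cube z a y -> enorm (z - y) <= n%:R * a.
Proof.
move=> a0 zy; rewrite enorm_le ?mulr_ge0// exprMn.
apply: (@le_trans _ _ (\sum_(i < n) a ^+ 2)).
  apply: ler_sum => i _; rewrite -expr2 -[leLHS]real_normK ?num_real//.
  rewrite ler_pXn2r ?nnegrE// !mxE ler_norml.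
  by have := zy i; rewrite /= in_itv/=; lra.
rewrite sumr_const card_ord -[leLHS]mulr_natl ler_wpM2r ?sqr_ge0//.
by rewrite -natrX ler_nat; case: (n) => // k; rewrite leq_pmulr.
Qed.

Lemma enorm_cube z a y : enorm (z - y) <= a -> cube z a y.
Proof.
move=> zy i /=; rewrite in_itv/=.
have := le_trans (enorm_coord (z - y) i) zy; rewrite !mxE ler_norml; lra.
Qed.

Lemma measurable_eball z (a : R) : measurable [set y : 'rV[R]_n | enorm (z - y) < a].
Proof.
have m : measurable_fun setT (fun y : 'rV[R]_n => enorm (z - y)).
  apply: measurableT_comp; first exact: measurable_enorm.
  by apply: measurable_rV_addf => //; exact: measurable_rV_oppf.
have := m measurableT _ (measurable_itv `]-oo, a[); rewrite setTI.
by congr measurable; apply/seteqP; split => y /=; rewrite in_itv.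
Qed.

End volume.

Section change_of_variables.
Context {R : realType} {n : nat}.
Local Notation mu := (lebesgue_rV n).
Local Open Scope ereal_scope.
Implicit Types f : 'rV[R]_n -> \bar R.

(** [haar_exchange] with the indicator of the unit ball as second function: this ball is invariant
    under T and under the opposite, and its measure, positive and finite by comparison with cubes,
    cancels. *)
Lemma integral_isometry (T : 'rV[R]_n -> 'rV[R]_n) f :
  measurable_fun setT T -> (forall x y, T (x - y)%R = (T x - T y)%R) ->
  (forall x, T (T x) = x) -> (forall x, enorm (T x) = enorm x) ->
  measurable_fun setT f -> (forall x, 0 <= f x) ->
  \int[mu]_x f (T x) = \int[mu]_x f x.
Proof.
move=> mT TB TK Te mf f0.
pose B := [set y : 'rV[R]_n | enorm (0 - y) < 1]%R.
have mB : measurable B by exact: measurable_eball.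
have BE y : B y <-> (enorm y < 1)%R by rewrite /B /= sub0r enormN.
have mi : measurable_fun setT (fun y => (\1_B y)%:E : \bar R).
  by apply/measurable_EFinP; exact: measurable_indic.
have i0 y : 0 <= (\1_B y)%:E :> \bar R by rewrite lee_fin indicE.
have iE y z : (enorm y = enorm z)%R -> \1_B y = \1_B z :> R.
  move=> yz; rewrite !indicE; congr (nat_of_bool _)%:R.
  by apply/idP/idP; rewrite !inE => /BE ?; apply/BE; rewrite ?yz// -yz.
have iB : \int[mu]_x (\1_B x)%:E = mu B by rewrite integral_indic// setIT.
have E1 : \int[mu]_x (\1_B (T x))%:E = mu B.
  by rewrite -iB; apply: eq_integral => y _; rewrite (iE _ y).
have E2 : \int[mu]_x (\1_B (- (x : 'rV[R]_n))%R)%:E = mu B.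
  by rewrite -iB; apply: eq_integral => y _; rewrite (iE _ y) ?enormN.
have := haar_exchange mT TB TK mf mi f0 i0.
rewrite E1 E2 muleC => E.
have a0 : (0 < (n.+1%:R)^-1 :> R)%R by rewrite invr_gt0.
have B0 : 0 < mu B.
  apply: (@lt_le_trans _ _ (mu (cube 0 (n.+1%:R)^-1))).
    by rewrite volume_cube// lte_fin exprn_gt0// mulr_gt0.
  apply: le_measure; rewrite ?inE//; first exact: measurable_cube.
  move=> y /(cube_enorm (ltW a0)) ya; apply: (le_lt_trans ya).
  by rewrite ltr_pdivrMr// mul1r ltr_nat.
have Boo : mu B < +oo.
  apply: (@le_lt_trans _ _ (mu (cube 0 1))); last by rewrite volume_cube// ltry.
  apply: le_measure; rewrite ?inE//; first exact: measurable_cube.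
  by move=> y /ltW; exact: enorm_cube.
have Bf : mu B \is a fin_num by rewrite ge0_fin_numE// ltW.
by apply/eqP; rewrite eq_le -(lee_pmul2l Bf B0) -[X in _ && X](lee_pmul2l Bf B0) E lexx.
Qed.

(** The same device with the cube of half-side 1, whose scaled volume is known. *)
Lemma integral_scale (c : R) f : (0 < c)%R ->
  measurable_fun setT f -> (forall x, 0 <= f x) ->
  \int[mu]_x f (c^-1 *: x) = (c ^+ n)%:E * \int[mu]_x f x.
Proof.
move=> c0 mf f0; pose B := @cube R n 0 1.
have mB : measurable B by exact: measurable_cube.
have mi : measurable_fun setT (fun y => (\1_B y)%:E : \bar R).
  by apply/measurable_EFinP; exact: measurable_indic.
have i0 y : 0 <= (\1_B y)%:E :> \bar R by rewrite lee_fin indicE.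
have TB (x y : 'rV[R]_n) : (c^-1 *: (x - y) = c^-1 *: x - c^-1 *: y)%R.
  by rewrite scalerBr.
have TK (x : 'rV[R]_n) : (c^-1 *: (c *: x) = x)%R.
  by rewrite scalerA mulVf ?scale1r// gt_eqF.
have E1 : \int[mu]_x (\1_B (c^-1 *: (x : 'rV[R]_n))%R)%:E = mu (@cube R n 0 c).
  transitivity (\int[mu]_x (\1_(@cube R n 0 c) x)%:E); last first.
    by rewrite integral_indic ?setIT//; exact: measurable_cube.
  apply: eq_integral => y _; rewrite !indicE; congr (_%:R%:E); congr nat_of_bool.
  have H i : (- 1 <= c^-1 * y ord0 i <= 1)%R = (- c <= y ord0 i <= c)%R.
    by rewrite ler_pdivlMl// ler_pdivrMl// mulr1 mulrN mulr1.
  apply/idP/idP; rewrite !inE => yB i; have := yB i;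
    by rewrite /= !in_itv/= !mxE !sub0r !add0r H.
have E2 : \int[mu]_x (\1_B (- (x : 'rV[R]_n))%R)%:E = mu B.
  transitivity (\int[mu]_x (\1_B x)%:E); last by rewrite integral_indic ?setIT.
  apply: eq_integral => y _; rewrite !indicE; congr (_%:R%:E); congr nat_of_bool.
  have H i : (- 1 <= - y ord0 i <= 1)%R = (- 1 <= y ord0 i <= 1)%R.
    by rewrite lerN2 (lerNl (y _ _)) andbC.
  apply/idP/idP; rewrite !inE => yB i; have := yB i;
    by rewrite /= !in_itv/= !mxE !sub0r !add0r H.
have := haar_exchange (@measurable_scale_rV R n c^-1) TB TK mf mi f0 i0.
rewrite E1 E2.
rewrite !volume_cube// mulr1 exprMn muleC EFinM -muleA.
have c2 : 0 < ((2 : R) ^+ n)%:E by rewrite lte_fin exprn_gt0.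
by move=> E; apply/eqP; rewrite eq_le -(lee_pmul2l _ c2)// -[X in _ && X](lee_pmul2l _ c2)// E lexx.
Qed.

End change_of_variables.

Section rotate.
Context {R : realType} {d : nat}.
Local Notation mu := (lebesgue_rV d.+1).
Implicit Types (e x : 'rV[R]_d.+1).

Definition e0 : 'rV[R]_d.+1 := delta_mx 0 0.

Lemma edot_e0 x : edot x e0 = x ord0 ord0.
Proof.
rewrite /edot (bigD1 ord0)//= big1 ?addr0.
  by rewrite mxE !eqxx mulr1.
by move=> i i0; rewrite mxE (negbTE i0) andbF mulr0.
Qed.

(* The Householder reflection exchanging e and the first basis vector. *)
Lemma rotation_exists e : enorm e = 1 ->
  exists T : 'rV[R]_d.+1 -> 'rV[R]_d.+1,
  [/\ measurable_fun setT T, forall x y, T (x - y) = T x - T y,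
     forall x, T (T x) = x, forall x, enorm (T x) = enorm x &
     forall x, (T x) ord0 ord0 = edot e x].
Proof.
move=> ee; have e00 : edot e0 e0 = 1 by rewrite edot_e0 mxE !eqxx.
have ee1 : edot e e = 1 by rewrite -sqr_enorm ee expr1n.
have [eE|ne] := eqVneq e e0.
  exists id; split => // x; by rewrite eE edotC edot_e0.
pose w := e - e0; pose k := 2 / edot w w.
have ww : edot w w != 0 by rewrite -sqr_enorm sqrf_eq0 enorm_eq0 subr_eq0.
have wwE : edot w w = 2 - 2 * edot e e0 by rewrite edotB2 ee1 e00; ring.
have weE : edot w e = 1 - edot e e0 by rewrite edotBl ee1 (edotC e0).
have ew : e - w = e0 by rewrite subKr.
have kw : k * edot w w = 2 by rewrite /k mulfVK.
clearbody k w; pose T x := x - (k * edot w x) *: w.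
have dT x y : edot (T x) (T y) = edot x y.
  rewrite /T !edotBl !edotBr !edotZl !edotZr (edotC x w) (edotC w y).
  transitivity (edot x y - k * edot w x * edot w y * (2 - k * edot w w)).
    by rewrite (edotC y w); ring.
  by rewrite kw subrr mulr0 subr0.
exists T; split.
- rewrite /T; apply: measurable_rV_addf => //; apply: measurable_rV_oppf.
  apply: measurable_fun_rVP => i; under eq_fun do rewrite mxE.
  by apply: measurable_funM => //; apply: measurable_funM => //; exact: measurable_edot.
- by move=> x y; rewrite /T edotBr; apply/rowP => i; rewrite !mxE; ring.
- move=> x; rewrite /T edotBr edotZr.
  have -> : k * (edot w x - k * edot w x * edot w w) = - (k * edot w x).
    transitivity (k * edot w x - (k * edot w w) * (k * edot w x)); first by ring.
    by rewrite kw; ring.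
  by rewrite scaleNr opprK subrK.
- by move=> x; apply: (@pexpIrn _ 2); rewrite ?nnegrE// !sqr_enorm dT.
- move=> x; rewrite -edot_e0.
  have Te : T e = e0.
    have we : k * edot w e = 1.
      have -> : k * edot w e = k * edot w w / 2.
        by rewrite wwE weE; field.
      by rewrite kw divff.
    by rewrite /T we scale1r ew.
  by rewrite -Te dT edotC.
Qed.

(** Translation, central symmetry, scaling and a reflection bring every centre and direction back to
    one reference integral, so that all kernel moments can be compared with [sigma_p]. *)
Lemma integral_radial (F : R -> R -> \bar R) (x e : 'rV[R]_d.+1) (c : R) :
  measurable_fun setT (fun z : 'rV[R]_d.+1 => F (enorm z) (z ord0 ord0)) ->
  (forall s t, 0 <= F s t)%E -> enorm e = 1 -> 0 < c ->
  (\int[mu]_y F (enorm (x - y) / c)%R (edot e (x - y) / c)%R =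
   (c ^+ d.+1)%:E * \int[mu]_z F (enorm z) (z ord0 ord0))%E.
Proof.
move=> mF F0 ee c0; have [T [mT TB TK Te T0]] := rotation_exists ee.
pose G (z : 'rV[R]_d.+1) := F (enorm z) (z ord0 ord0).
have G0 z : (0 <= G z)%E by exact: F0.
have mGT : measurable_fun setT (fun z => G (T z)) by exact: (measurableT_comp mF).
have mc := @measurable_scale_rV R d.+1 c^-1.
have mGTc : measurable_fun setT (fun z : 'rV[R]_d.+1 => G (T (c^-1 *: z))) by exact: (measurableT_comp mGT).
have mN : measurable_fun setT (fun z : 'rV[R]_d.+1 => - z) by exact: measurable_rV_oppf.
transitivity (\int[mu]_y G (T (c^-1 *: (- ((y : 'rV[R]_d.+1) + (- x)))))%R)%E.
  apply: eq_integral => y _; rewrite opprB /G Te T0 edotZr enormZ ger0_norm ?invr_ge0 ?ltW//.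
  by rewrite !(mulrC c^-1).
rewrite (integral_rV_shift (- x) (f := fun y : 'rV[R]_d.+1 => G (T (c^-1 *: (- y)))))//; last first.
  exact: (measurableT_comp mGTc mN).
rewrite (integral_isometry (T := -%R) (f := fun y : 'rV[R]_d.+1 => G (T (c^-1 *: y))))//.
- rewrite (integral_scale (f := fun y => G (T y)))//.
  by rewrite (integral_isometry (f := G)).
- by move=> y z; rewrite opprD.
- exact: opprK.
- exact: enormN.
Qed.

End rotate.

(** * The kernel *)

Section power.
Context {R : realType}.
Implicit Types a b p s : R.

(** Young's inequality [conjugate_powR] for s and 1 with the exponents p and p / (p - 1); the
    exponent 1 is separate because it has no finite conjugate. *)
Lemma powR_bernoulli p s : 1 <= p -> 0 <= s -> 1 + p * (s - 1) <= s `^ p.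
Proof.
move=> p1 s0; move: p1; rewrite le_eqVlt => /predU1P[<-|p1].
  by rewrite powRr1//; lra.
have p0 : 0 < p by lra.
have q0 : 0 < p / (p - 1) by rewrite divr_gt0// subr_gt0.
have pq : p^-1 + (p / (p - 1))^-1 = 1.
  by rewrite invf_div; field; rewrite gt_eqF.
have := conjugate_powR s0 ler01 p0 q0 pq; rewrite powR1 mulr1 mul1r.
have -> : (p / (p - 1))^-1 = 1 - p^-1 by rewrite -[in RHS]pq addrAC subrr add0r.
move=> /(ler_wpM2l (ltW p0)); rewrite mulrDr mulrBr mulr1 divff ?gt_eqF// mulrCA divff ?gt_eqF//.
by lra.
Qed.

Lemma powR_sub_le p a b : 1 <= p -> 0 <= a -> a <= 1 -> 0 <= b ->
  a `^ p <= Num.max (a - b) 0 `^ p + p * b.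
Proof.
move=> p1 a0 a1 b0; have p0 : 0 < p by lra.
have [ab|ba] := leP a b.
  apply: (@le_trans _ _ (p * b)); last by rewrite lerDr powR_ge0.
  apply: (@le_trans _ _ (1 * b)); last by rewrite ler_wpM2r.
  rewrite mul1r; apply: le_trans ab; move: a0; rewrite le_eqVlt => /predU1P[<-|a0].
    by rewrite powR0// gt_eqF.
  by rewrite ge1r_powR// a0.
have a0' : 0 < a by lra.
have ab0 : 0 <= a - b by rewrite subr_ge0 ltW.
rewrite (max_idPl _)//.
have s0 : 0 <= (a - b) / a by rewrite divr_ge0.
have -> : a - b = (a - b) / a * a by rewrite divfK// gt_eqF.
rewrite powRM//; have := powR_bernoulli p1 s0.
have := ge1r_powR (_ : 0 < a <= 1) p1; rewrite a0' a1 => /(_ isT) ap.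
move/(ler_wpM2r (powR_ge0 a p)).
have -> : (1 + p * ((a - b) / a - 1)) * a `^ p = a `^ p - p * b * (a `^ p / a).
  by field; rewrite gt_eqF.
have : p * b * (a `^ p / a) <= p * b * 1.
  by rewrite ler_wpM2l ?mulr_ge0 ?(ltW p0)// ler_pdivrMr// mul1r.
lra.
Qed.

Lemma ler_powR2 p a b : 0 <= p -> 0 <= a -> a <= b -> a `^ p <= b `^ p.
Proof.
by move=> p0 a0 ab; apply: ge0_ler_powR => //; rewrite nnegrE// (le_trans a0).
Qed.

End power.

Section kernel.
Context {R : realType} {d : nat}.
Variables (eta : R -> R) (p : R).
Hypotheses (kP : kernel_profile (d := d) eta) (p1 : 1 <= p).
Local Notation mu := (lebesgue_rV d.+1).

Let p0 : 0 < p. Proof. by move: p1; lra. Qed.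

Lemma kernel_ge0 t : 0 <= t -> 0 <= eta t.
Proof. by case: kP => _ + _ _ _; exact. Qed.

Lemma kernel_nincr s t : 0 <= s -> s <= t -> eta t <= eta s.
Proof. by case: kP => _ _ + _ _; exact. Qed.

Lemma kernel0_gt0 : 0 < eta 0.
Proof. by case: kP => _ _ _ []. Qed.

Lemma kernel_out t : 1 < t -> eta t = 0.
Proof. by case: kP => _ _ _ [_ +] _; exact. Qed.

Lemma kernel_le0 t : 0 <= t -> eta t <= eta 0.
Proof. by move=> t0; apply: kernel_nincr. Qed.

(** Only the decrease of eta has to be controlled, so the minimum of its derivative is enough. The
    range up to 2 covers arguments [enorm z + kap] with both terms at most 1. *)
Lemma kernel_lipschitz : exists2 L, 0 < L &
  forall s t, 0 <= s -> s <= t -> t <= 2 -> eta s <= eta t + L * (t - s).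
Proof.
case: kP => -[h dh eh] _ _ _ _.
have dh0 t : derivable h t 1 by exact: (dh 0%N).
have dh1 t : derivable (derive1 h) t 1 by exact: (dh 1%N).
have ch t : {for t, continuous h}.
  exact/differentiable_continuous/derivable1_diffP.
have ch1 t : {for t, continuous (derive1 h)}.
  exact/differentiable_continuous/derivable1_diffP.
have [c _ cmin] := @EVT_min R (derive1 h) 0 2 (ltW (ltr0n R 2)) (continuous_subspaceT ch1).
exists (`|derive1 h c| + 1) => [|s t s0 st t2]; first by rewrite ltr_wpDl.
move: st; rewrite le_eqVlt => /predU1P[->|st].
  by rewrite subrr mulr0 addr0.
have [x|x] := @MVT R h (derive1 h) s t st _ (continuous_subspaceT ch).
  by move=> _; apply: DeriveDef => //; rewrite derive1E.
rewrite in_itv/= => /andP[sx xt] E.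
rewrite !eh ?(le_trans s0 (ltW st))//.
have := cmin x; rewrite in_itv/= (le_trans s0 (ltW sx)) (le_trans (ltW xt) t2) => /(_ isT) hx.
have : (- (`|derive1 h c| + 1)) * (t - s) <= derive1 h x * (t - s).
  rewrite ler_wpM2r ?subr_ge0 ?(ltW st)//; apply: le_trans hx.
  by have := ler_norm (- derive1 h c); rewrite normrN; lra.
rewrite -E; lra.
Qed.

Lemma kernel_pos_radius : exists t0, [/\ 0 < t0, t0 < 1 & 0 < eta t0].
Proof.
have [L L0 hL] := kernel_lipschitz.
pose t0 := Num.min (1 / 2) (eta 0 / (2 * L)).
have t00 : 0 < t0 by rewrite lt_min !divr_gt0// ?mulr_gt0// kernel0_gt0.
have t02 : t0 <= 1 / 2 by rewrite ge_min lexx.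
have t0L : t0 * (2 * L) <= eta 0 by rewrite -ler_pdivlMr ?mulr_gt0// ge_min lexx orbT.
exists t0; split => //; first lra.
have := hL 0 t0 (lexx _) (ltW t00) (_ : t0 <= 2); rewrite subr0.
have := kernel0_gt0; lra.
Qed.

Lemma measurable_kernel (h : 'rV[R]_d.+1 -> R) : measurable_fun setT h ->
  (forall x, 0 <= h x) -> measurable_fun setT (fun x => eta (h x)).
Proof.
move=> mh h0; case: kP => -[k dk ek] _ _ _ _.
have -> : (fun x => eta (h x)) = k \o h by apply/funext => x /=; rewrite ek.
apply: measurableT_comp => //; apply: continuous_measurable_fun => t.
by apply/differentiable_continuous/derivable1_diffP; exact: (dk 0%N).
Qed.

(* The slack [kap] allows for the discretization of the centre and direction. *)
Definition ktest (kap s t : R) : R :=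
  eta (`|s| + kap) * Num.max (t - 3 * kap) 0 `^ p.

Lemma ktest_ge0 kap s t : 0 <= kap -> 0 <= ktest kap s t.
Proof. by move=> k0; rewrite mulr_ge0 ?powR_ge0// kernel_ge0// addr_ge0. Qed.

Lemma measurable_ktest kap (h l : 'rV[R]_d.+1 -> R) : 0 <= kap ->
  measurable_fun setT h -> measurable_fun setT l ->
  measurable_fun setT (fun z => ktest kap (h z) (l z)).
Proof.
move=> k0 mh ml; apply: measurable_funM.
  apply: measurable_kernel; last by move=> x; rewrite addr_ge0.
  by apply: measurable_funD => //; apply: measurableT_comp => //; exact: normr_measurable.
apply: (measurableT_comp (measurable_powR _)).
apply: measurable_maxr => //; exact: measurable_funB.
Qed.

Lemma ktest_le kap s t : 0 <= kap -> t <= `|s| -> ktest kap s t <= eta 0.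
Proof.
move=> k0 ts; have [s1|s1] := leP `|s| 1; last first.
  rewrite /ktest kernel_out ?mul0r ?(ltW kernel0_gt0)//.
  by apply: lt_le_trans s1 _; rewrite lerDl.
rewrite -[leRHS]mulr1 ler_pM ?powR_ge0 ?kernel_ge0 ?addr_ge0//.
  by apply: kernel_le0; rewrite addr_ge0.
apply: (@le_trans _ _ (1 `^ p)); last by rewrite powR1.
apply: ler_powR2; rewrite ?(ltW p0) ?le_max ?lexx ?orbT//.
by rewrite ge_max ler01 andbT; lra.
Qed.

Local Notation sig := (sigma_p (d := d) eta p).

Lemma coord0_le (z : 'rV[R]_d.+1) : z ord0 ord0 <= enorm z.
Proof. by apply: le_trans (ler_norm _) (enorm_coord _ _). Qed.

Let mK kap : 0 <= kap ->
  measurable_fun setT (fun z : 'rV[R]_d.+1 => (ktest kap (enorm z) (z ord0 ord0))%:E).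
Proof.
move=> k0; apply/measurable_EFinP; apply: measurable_ktest => //.
  exact: measurable_enorm.
exact: measurable_rV_coord.
Qed.

Lemma sigma_integrandE (z : 'rV[R]_d.+1) :
  eta (enorm z) * Num.max (z ord0 ord0) 0 `^ p = ktest 0 (enorm z) (z ord0 ord0).
Proof. by rewrite /ktest mulr0 subr0 addr0 ger0_norm. Qed.

Lemma ktest_cube kap (z : 'rV[R]_d.+1) : 0 <= kap ->
  ktest kap (enorm z) (z ord0 ord0) <= eta 0 * \1_(cube 0 1) z.
Proof.
move=> k0; have [z1|z1] := leP (enorm z) 1; last first.
  rewrite /ktest kernel_out ?mul0r ?mulr_ge0 ?(ltW kernel0_gt0)// ?indicE//.
  by rewrite ger0_norm//; apply: lt_le_trans z1 _; rewrite lerDl.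
rewrite indicE mem_set ?mulr1; first by rewrite ktest_le// ger0_norm// coord0_le.
by apply: enorm_cube; rewrite sub0r enormN.
Qed.

Lemma integral_cube1 (c : R) : 0 <= c ->
  (\int[mu]_z (c * \1_(cube 0 1) z)%:E = (c * 2 ^+ d.+1)%:E)%E.
Proof.
move=> c0; under eq_integral do rewrite EFinM.
have mi : measurable_fun setT (fun z : 'rV[R]_d.+1 => (\1_(cube 0 1) z : R)%:E).
  by apply/measurable_EFinP/measurable_indic; exact: measurable_cube.
rewrite ge0_integralZl_EFin//.
by rewrite integral_indic_cube// mulr1.
Qed.

Lemma sigma_fin :
  (\int[mu]_z (ktest 0 (enorm z) (z ord0 ord0))%:E = sig%:E)%E.
Proof.
rewrite /sigma_p /Rintegral fineK; last first.
  rewrite ge0_fin_numE; last by apply: integral_ge0 => z _; rewrite lee_fin sigma_integrandE ktest_ge0.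
  apply: (@le_lt_trans _ _ (\int[mu]_z (eta 0 * \1_(cube 0 1) z)%:E)%E); last first.
    by rewrite integral_cube1 ?ltry// ltW// kernel0_gt0.
  apply: ge0_le_integral => //.
  - by move=> z _; rewrite lee_fin sigma_integrandE ktest_ge0.
  - by under eq_fun do rewrite sigma_integrandE; exact: mK.
  - apply/measurable_EFinP; apply: measurable_funM => //.
    by apply: measurable_indic; exact: measurable_cube.
  - by move=> z _; rewrite lee_fin sigma_integrandE ktest_cube.
by apply: eq_integral => z _; rewrite sigma_integrandE.
Qed.

Lemma sigma_gt0 : 0 < sig.
Proof.
have [t0 [t00 t01 et0]] := kernel_pos_radius.
rewrite -lte_fin -sigma_fin.
(* With this s the cube of half-side s / 2 around [s *: e0] stays in the ball of radius t0, since
   its points are within (d + 1) s / 2 + s of the origin. *)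
pose s := t0 / (d.+2)%:R; have s0 : 0 < s by rewrite divr_gt0.
have sE : s * (d.+2)%:R = t0 by rewrite /s divfK.
pose Q := cube (s *: @e0 R d) (s / 2).
have mQ : measurable Q by exact: measurable_cube.
have Qd (z : 'rV[R]_d.+1) : Q z -> enorm z <= t0.
  move=> /cube_enorm; rewrite ltW ?divr_gt0// => /(_ isT) zs.
  have -> : z = s *: e0 - (s *: e0 - z) by rewrite subKr.
  apply: le_trans (enormB _ _) _; rewrite enormZ gtr0_norm//.
  have -> : enorm (@e0 R d) = 1.
    apply: (@pexpIrn _ 2); rewrite ?nnegrE// sqr_enorm edot_e0 mxE !eqxx expr1n//.
  rewrite mulr1 -sE -natr1; have : 0 <= d.+1%:R * s by rewrite mulr_ge0// ltW.
  lra.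
have Q0 (z : 'rV[R]_d.+1) : Q z -> s / 2 <= z ord0 ord0.
  by move=> /(_ ord0); rewrite /= in_itv/= !mxE !eqxx mulr1; lra.
pose c := eta t0 * (s / 2) `^ p.
have c0 : 0 < c by rewrite mulr_gt0// powR_gt0// divr_gt0.
apply: (@lt_le_trans _ _ (\int[mu]_z (c * \1_Q z)%:E)%E).
  under eq_integral do rewrite EFinM.
  have mi : measurable_fun setT (fun z : 'rV[R]_d.+1 => (\1_Q z : R)%:E).
    exact/measurable_EFinP/measurable_indic.
  rewrite ge0_integralZl_EFin ?(ltW c0)//.
  rewrite integral_indic_cube ?divr_gt0//.
  by rewrite -EFinM lte_fin mulr_gt0// exprn_gt0// mulr_gt0// divr_gt0.
apply: ge0_le_integral => //.
- by move=> z _; rewrite lee_fin indicE mulr_ge0// ltW.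
- by apply/measurable_EFinP; apply: measurable_funM => //; exact: measurable_indic.
- exact: mK.
move=> z _; rewrite lee_fin indicE; have [/set_mem Qz|_] := boolP (z \in Q); last first.
  by rewrite mulr0 ktest_ge0.
rewrite mulr1 /ktest mulr0 subr0 addr0 ger0_norm//.
rewrite ler_pM ?(ltW et0) ?powR_ge0//; first by rewrite kernel_nincr// Qd.
apply: ler_powR2; first exact: ltW.
  by rewrite divr_ge0// ltW.
by rewrite le_max Q0.
Qed.

(** The slack costs only O(kap): eta is Lipschitz, [powR_sub_le] handles the power, and both
    integrands live in the cube of half-side 1, which makes the pointwise error integrable. *)
Lemma ktest_moment : exists2 C, 0 < C & forall kap, 0 <= kap -> kap <= 1 ->
  ((sig - C * kap)%:E <= \int[mu]_z (ktest kap (enorm z) (z ord0 ord0))%:E)%E.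
Proof.
have [L L0 hL] := kernel_lipschitz; have e00 := kernel0_gt0.
pose C1 := L + eta 0 * (p * 3); have C10 : 0 < C1.
  by rewrite addr_gt0// !mulr_gt0.
exists (C1 * 2 ^+ d.+1) => [|kap k0 k1]; first by rewrite mulr_gt0// exprn_gt0.
have pw (z : 'rV[R]_d.+1) : ktest 0 (enorm z) (z ord0 ord0) <=
    ktest kap (enorm z) (z ord0 ord0) + C1 * kap * \1_(cube 0 1) z.
  have [z1|z1] := leP (enorm z) 1; last first.
    rewrite {1}/ktest kernel_out ?mul0r ?addr_ge0 ?ktest_ge0//; last first.
      by rewrite addr0 ger0_norm.
    by rewrite !mulr_ge0 ?(ltW C10)// indicE.
  rewrite indicE mem_set ?mulr1; last by apply: enorm_cube; rewrite sub0r enormN.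
  rewrite /ktest mulr0 subr0 addr0 !ger0_norm//.
  have a1 := coord0_le z; set a := z ord0 ord0 in a1 *.
  have m0 : 0 <= Num.max a 0 by rewrite le_max lexx orbT.
  have m1 : Num.max a 0 <= 1 by rewrite ge_max ler01 andbT; lra.
  have A : Num.max a 0 `^ p <= Num.max (a - 3 * kap) 0 `^ p + p * (3 * kap).
    have k3 : 0 <= 3 * kap by lra.
    have := powR_sub_le p1 m0 m1 k3.
    suff -> : Num.max (Num.max a 0 - 3 * kap) 0 = Num.max (a - 3 * kap) 0 by [].
    have [a0|a0] := leP a 0; last by [].
    by rewrite !(max_idPr _)//; lra.
  have B : eta (enorm z) <= eta (enorm z + kap) + L * kap.
    have := hL (enorm z) (enorm z + kap) (enorm_ge0 _).
    by rewrite lerDl => /(_ k0); rewrite [_ + kap - _]addrAC subrr add0r; apply; lra.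
  have ek : 0 <= eta (enorm z + kap) by rewrite kernel_ge0// addr_ge0.
  have ek' : eta (enorm z + kap) <= eta 0 by rewrite kernel_le0// addr_ge0.
  have Mp1 : Num.max a 0 `^ p <= 1.
    apply: (@le_trans _ _ (1 `^ p)); last by rewrite powR1.
    by apply: ler_powR2 => //; exact: ltW.
  move: (powR_ge0 (Num.max a 0) p) A Mp1 B ek ek'.
  move: (Num.max a 0 `^ p) (Num.max (a - 3 * kap) 0 `^ p) (eta (enorm z)) (eta (enorm z + kap)).
  move=> M N E F M0 A M1 B F0 ek'.
  have h1 : E * M <= (F + L * kap) * M by rewrite ler_wpM2r.
  have h2 : L * kap * M <= L * kap * 1 by rewrite ler_wpM2l// mulr_ge0// ltW.
  have h3 : F * M <= F * (N + p * (3 * kap)) by rewrite ler_wpM2l.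
  have h4 : F * (p * (3 * kap)) <= eta 0 * (p * (3 * kap)).
    by apply: ler_wpM2r ek' => //; rewrite mulr_ge0 ?(ltW p0)// mulr_ge0.
  rewrite /C1; lra.
rewrite EFinB leeBlDr// -sigma_fin.
have c0 : 0 <= C1 * kap by rewrite mulr_ge0// ltW.
have -> : C1 * 2 ^+ d.+1 * kap = C1 * kap * 2 ^+ d.+1 by ring.
rewrite -integral_cube1// -ge0_integralD//; last 4 first.
- by move=> z _; rewrite lee_fin ktest_ge0.
- exact: mK.
- by move=> z _; rewrite lee_fin mulr_ge0// indicE.
- apply/measurable_EFinP; apply: measurable_funM => //.
  by apply: measurable_indic; exact: measurable_cube.
apply: ge0_le_integral => //.
- by move=> z _; rewrite lee_fin ktest_ge0.
- exact: mK.
- apply: emeasurable_funD; first exact: mK.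
  apply/measurable_EFinP; apply: measurable_funM => //.
  by apply: measurable_indic; exact: measurable_cube.
- by move=> z _; rewrite -EFinD lee_fin.
Qed.

End kernel.

(** * Concentration of kernel sums *)

Section open_measurable.
Context {R : realType} {n : nat}.

(** The sigma-algebra being generated by the coordinates, an open set is written as the union of the
    countably many cubes inside it whose centres have coordinates in Z / (k + 1) and whose half-side
    is 1 / (k + 1). *)
Lemma open_measurable_rV (A : set 'rV[R]_n) : open A -> measurable A.
Proof.
move=> /open_enormP oA.
pose c (u : nat * 'rV[int]_n) : 'rV[R]_n := \row_i ((u.2 ord0 i)%:~R / u.1.+1%:R).
pose a (u : nat * 'rV[int]_n) : R := u.1.+1%:R^-1.
pose F u := [set x | cube (c u) (a u) `<=` A /\ cube (c u) (a u) x].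
have -> : A = \bigcup_u F u.
  apply/seteqP; split => [x Ax|x [u _ [uA ux]]]; last exact: uA.
  have [e e0 eA] := oA x Ax.
  pose k := Num.truncn (n.*2%:R / e).
  have ke : n.*2%:R / k.+1%:R < e.
    have ne : 0 <= n.*2%:R / e :> R by rewrite divr_ge0// ltW.
    have /andP[_] := truncn_itv ne; rewrite -/k ltr_pdivrMr// => h.
    by rewrite ltr_pdivrMr// mulrC.
  pose u := (k, \row_i Num.floor (x ord0 i * k.+1%:R)).
  have k0 : 0 < k.+1%:R :> R by [].
  have ux : cube (c u) (a u) x.
    move=> i; rewrite /= in_itv/= /a /= !mxE /= ?mxE.
    have /andP[f1 f2] := floor_itv (x ord0 i * k.+1%:R).
    move: f1 f2; rewrite -ler_pdivrMr// -ltr_pdivlMr// intrD mulrDl mulr1z mul1r => f1 f2.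
    apply/andP; split; last exact: ltW.
    by rewrite lerBlDr (le_trans f1)// lerDl invr_ge0.
  exists u => //; split => // y uy; apply: eA; apply: le_lt_trans ke.
  apply: le_trans (enorm_tri x (c u) y) _; rewrite enormC.
  have a0 : 0 <= a u by rewrite invr_ge0.
  rewrite -addnn natrD mulrDl; apply: lerD; exact: cube_enorm.
apply: countable_bigcupT_measurable; first exact: countableP.
move=> u; have [uA|uA] := pselect (cube (c u) (a u) `<=` A).
  rewrite (_ : F u = cube (c u) (a u)); first exact: measurable_cube.
  by apply/seteqP; split => x // [].
by rewrite (_ : F u = set0)//; apply/seteqP; split => x // [].
Qed.

Lemma elipschitz_measurable (A : set 'rV[R]_n) (L : R) (h : 'rV[R]_n -> R) :
  open A -> elipschitz A L h -> measurable_fun A h.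
Proof.
move=> oA hL; apply: (measurability _ (RGenOInfty.measurableE R)).
move=> _ [_ [t ->] <-]; apply: open_measurable_rV; apply/open_enormP => x [Ax].
rewrite /= in_itv/= andbT => tx; have [e e0 eA] := (open_enormP _).1 oA x Ax.
exists (Num.min e ((h x - t) / (`|L| + 1))) => [|y].
  rewrite lt_min e0/=; apply: divr_gt0; last by rewrite ltr_wpDl.
  by move: tx; rewrite subr_gt0.
have L1 : 0 < `|L| + 1 by rewrite ltr_wpDl.
rewrite lt_min => /andP[/eA Ay]; rewrite (ltr_pdivlMr _ _ L1) => xy.
split => //=; rewrite in_itv/= andbT.
have := hL x y (mem_set Ax) (mem_set Ay) => /(le_trans (ler_norm _)).
have : L * enorm (x - y) <= enorm (x - y) * (`|L| + 1).
  rewrite mulrC ler_wpM2l//; apply: le_trans (ler_norm _) _; by rewrite lerDl.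
lra.
Qed.

End open_measurable.

Section density_bounds.
Context {R : realType} {n : nat} {disp : measure_display} {T : measurableType disp}.
Variables (P : probability T R) (Omega : set 'rV[R]_n) (rho : 'rV[R]_n -> R) (L : R)
  (X : {RV P >-> 'rV[R]_n}).
Hypotheses (oO : open Omega) (rL : elipschitz Omega L rho)
  (r0 : forall x, Omega x -> 0 <= rho x)
  (dX : has_density (lebesgue_rV n) Omega rho X).
Local Notation mu := (lebesgue_rV n).

Let mO : measurable Omega := open_measurable_rV oO.
Let mrho : measurable_fun Omega rho := elipschitz_measurable oO rL.

Lemma density_ge (A : set 'rV[R]_n) (c : R) : measurable A -> A `<=` Omega ->
  0 <= c -> (forall y, A y -> c <= rho y) ->
  (c%:E * mu A <= P (X @^-1` A))%E.
Proof.
move=> mA AO c0 cA; have := dX.2 A mA; rewrite /distribution /pushforward => ->.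
rewrite (setIidl AO) -(integral_cst mu mA); apply: ge0_le_integral => //.
by apply/measurable_EFinP; exact: measurable_funS mrho.
Qed.

Lemma density_le (A B : set 'rV[R]_n) (c : R) : measurable A -> measurable B ->
  A `&` Omega `<=` B -> 0 <= c -> (forall y, Omega y -> rho y <= c) ->
  (P (X @^-1` A) <= c%:E * mu B)%E.
Proof.
move=> mA mB AB c0 cA; have := dX.2 A mA; rewrite /distribution /pushforward => ->.
have mAO : measurable (A `&` Omega) by exact: measurableI.
apply: (@le_trans _ _ (c%:E * mu (A `&` Omega))%E); last first.
  by apply: lee_wpmul2l; rewrite ?lee_fin//; apply: le_measure; rewrite ?inE.
rewrite -(integral_cst mu mAO); apply: ge0_le_integral => //.
- by move=> y [_ Oy]; rewrite lee_fin r0.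
- by apply/measurable_EFinP; apply: measurable_funS mrho => // y [].
- by move=> y [_ Oy]; rewrite lee_fin; exact: cA.
Qed.

End density_bounds.

(** * Discretization of a test function *)

Section cells.
Context {R : realType} {disp : measure_display} {U : measurableType disp}.
Variables (N : nat) (F : U -> R).
Hypotheses (mF : measurable_fun setT F) (F0 : forall y, 0 <= F y) (F1 : forall y, F y <= 1).

(** Rounds F down to a multiple of 1 / (N + 1); the top index N + 1 occurs only where F is 1. With
    finitely many values, expectations of products are finite sums, for which independence of events
    is enough. *)
Definition cell (y : U) : 'I_N.+2 := inord (Num.truncn (N.+1%:R * F y)).
Definition level (c : 'I_N.+2) : R := c%:R / N.+1%:R.

Let NF y : 0 <= N.+1%:R * F y. Proof. by rewrite mulr_ge0. Qed.

Lemma cellE y : cell y = Num.truncn (N.+1%:R * F y) :> nat.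
Proof.
rewrite inordK//; rewrite truncn_lt_nat//.
apply: (@le_lt_trans _ _ (N.+1%:R * 1)); first by rewrite ler_wpM2l.
by rewrite mulr1 ltr_nat.
Qed.

Lemma level_cell y : level (cell y) <= F y <= level (cell y) + N.+1%:R^-1.
Proof.
have /andP[t1 t2] := truncn_itv (NF y).
rewrite /level cellE; apply/andP; split; first by rewrite ler_pdivrMr// (mulrC (F y)).
by rewrite -[X in _ + X]mul1r -mulrDl natr1 ler_pdivlMr// (mulrC (F y)) ltW.
Qed.

Lemma measurable_cell c : measurable (cell @^-1` [set c]).
Proof.
have -> : cell @^-1` [set c] =
    F @^-1` `[level c, level c + N.+1%:R^-1[%classic.
  apply/seteqP; split => y /=; rewrite in_itv/=.
    move=> <-; have /andP[-> _] := level_cell y => /=.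
    have /andP[_ t2] := truncn_itv (NF y).
    by rewrite /level cellE -[X in _ + X]mul1r -mulrDl natr1 ltr_pdivlMr// (mulrC (F y)).
  rewrite /level -[X in _ + X]mul1r -mulrDl natr1 ltr_pdivlMr// ler_pdivrMr//.
  rewrite (mulrC (F y)) => yc; apply: val_inj; rewrite /= cellE.
  by apply/eqP; rewrite truncn_eq.
by rewrite -[X in measurable X]setTI; apply: mF => //; exact: measurable_itv.
Qed.

Lemma level_ge0 c : 0 <= level c. Proof. by rewrite divr_ge0. Qed.

Lemma cell_support (B : set U) c : (forall y, ~ B y -> F y = 0) ->
  level c != 0 -> cell @^-1` [set c] `<=` B.
Proof.
move=> BF c0 y /= yc; apply: contrapT => /BF Fy; move: c0.
by rewrite -yc /level cellE Fy mulr0 truncn0 mul0r eqxx.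
Qed.

Lemma level_le1 c : level c <= 1.
Proof. by rewrite ler_pdivrMr// mul1r ler_nat -ltnS. Qed.

Lemma integral_cells (m : {measure set U -> \bar R}) (B : set U) : measurable B ->
  (forall y, ~ B y -> F y = 0) -> (m B < +oo)%E ->
  (\int[m]_y (F y)%:E <=
   \sum_(c < N.+2) (level c)%:E * m (cell @^-1` [set c]) + N.+1%:R^-1%:E * m B)%E.
Proof.
move=> mB BF Boo.
pose G y := \sum_(c < N.+2) level c * \1_(cell @^-1` [set c]) y + N.+1%:R^-1 * \1_B y.
have mc c : measurable_fun setT (fun y => level c * \1_(cell @^-1` [set c]) y : R).
  by apply: measurable_funM => //; apply: measurable_indic; exact: measurable_cell.
have c0 c y : 0 <= level c * \1_(cell @^-1` [set c]) y :> R.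
  by rewrite mulr_ge0 ?level_ge0// indicE.
apply: (@le_trans _ _ (\int[m]_y (G y)%:E)%E).
  apply: ge0_le_integral => //.
  - by move=> y _; rewrite lee_fin.
  - exact/measurable_EFinP.
  - apply/measurable_EFinP; apply: measurable_funD.
      by apply: measurable_sum.
    by apply: measurable_funM => //; exact: measurable_indic.
  move=> y _; rewrite lee_fin /G; have [By|nBy] := pselect (B y); last first.
    by rewrite BF// addr_ge0 ?sumr_ge0// mulr_ge0// indicE.
  rewrite [\1_B y]indicE mem_set// mulr1.
  have /andP[_ /le_trans] := level_cell y; apply; rewrite lerD2r.
  rewrite (bigD1 (cell y))//= indicE mem_set// mulr1 lerDl; exact: sumr_ge0.
rewrite /G; under eq_integral do rewrite EFinD.
have q1 y : (0 <= (\sum_(c < N.+2) level c * \1_(cell @^-1` [set c]) y)%:E)%E.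
  by rewrite lee_fin sumr_ge0.
have q2 : measurable_fun setT
    (fun y => (\sum_(c < N.+2) level c * \1_(cell @^-1` [set c]) y)%:E).
  by apply/measurable_EFinP; apply: measurable_sum.
have q3 y : (0 <= (N.+1%:R^-1 * \1_B y : R)%:E)%E by rewrite lee_fin mulr_ge0// indicE.
have q4 : measurable_fun setT (fun y => (N.+1%:R^-1 * \1_B y : R)%:E).
  by apply/measurable_EFinP; apply: measurable_funM => //; exact: measurable_indic.
rewrite ge0_integralD//.
have I (k : R) (A : set U) : 0 <= k -> measurable A ->
    (\int[m]_y (k * \1_A y)%:E = k%:E * m A)%E.
  move=> k0 mA; under eq_integral do rewrite EFinM.
  have mi : measurable_fun setT (fun y => (\1_A y : R)%:E).
    exact/measurable_EFinP/measurable_indic.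
  by rewrite ge0_integralZl_EFin// integral_indic// setIT.
rewrite I//; apply: leeD => //.
under eq_integral do rewrite -sumEFin.
rewrite ge0_integral_sum//.
- apply: lee_sum => c _; rewrite I ?level_ge0//; exact: measurable_cell.
- by move=> c; exact/measurable_EFinP.
- by move=> c y _; rewrite lee_fin.
Qed.

End cells.

(** * Independent variables with finitely many values *)

Section finite_valued.
Context {R : realType} {disp : measure_display} {T : measurableType disp}.
Variable P : probability T R.

Lemma measure_big_setU_le (I : Type) (s : seq I) (Q : pred I) (A : I -> set T) :
  (forall i, measurable (A i)) ->
  measurable (\big[setU/set0]_(i <- s | Q i) A i) /\
  (P (\big[setU/set0]_(i <- s | Q i) A i) <= \sum_(i <- s | Q i) P (A i))%E.
Proof.
move=> mA; elim: s => [|i s [ms ih]]; first by rewrite !big_nil measure0.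
rewrite !big_cons; case: (Q i) => //; split; first exact: measurableU.
by apply: le_trans (measureU2 P (mA i) ms) _; rewrite leeD2l.
Qed.

Definition prob (A : set T) : R := fine (P A).

Lemma probE A : measurable A -> P A = (prob A)%:E.
Proof.
move=> mA; rewrite /prob fineK// ge0_fin_numE//.
by apply: le_lt_trans (probability_le1 P mA) _; rewrite ltry.
Qed.

Lemma prob_ge0 A : 0 <= prob A. Proof. exact: fine_ge0. Qed.

Section one.
Variables (K : finType) (Z : T -> K).
Hypothesis mZ : forall c, measurable (Z @^-1` [set c]).

Lemma sum_fibers (b : K -> R) : (forall c, 0 <= b c) ->
  (\int[P]_w (b (Z w))%:E = (\sum_c b c * prob (Z @^-1` [set c]))%:E)%E.
Proof.
move=> b0; have mi c : measurable_fun setT (fun w => (\1_(Z @^-1` [set c]) w : R)%:E).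
  exact/measurable_EFinP/measurable_indic.
transitivity (\int[P]_w (\sum_(c : K) (b c * \1_(Z @^-1` [set c]) w)%:E))%E.
  apply: eq_integral => w _; rewrite sumEFin (bigD1 (Z w))//= indicE mem_set// mulr1.
  rewrite big1 ?addr0// => c cZ; rewrite indicE memNset ?mulr0//=.
  by move=> zc; move: cZ; rewrite zc eqxx.
rewrite ge0_integral_sum//.
- rewrite -sumEFin; apply: eq_bigr => c _; under eq_integral do rewrite EFinM.
  rewrite ge0_integralZl_EFin// integral_indic// setIT EFinM.
  by congr (_ * _)%E; exact: probE.
- by move=> c; apply/measurable_EFinP; apply: measurable_funM => //; exact: measurable_indic.
- by move=> c w _; rewrite lee_fin mulr_ge0// indicE.
Qed.

Lemma sum_prob1 : \sum_c prob (Z @^-1` [set c]) = 1.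
Proof.
have := @sum_fibers (fun=> 1) (fun=> ler01).
under eq_bigr do rewrite mul1r.
have -> : (\int[P]_w 1%:E = 1%:E)%E by rewrite integral_cst// mul1e; exact: probability_setT.
by case.
Qed.

End one.

Lemma expRN_le (t : R) : 0 <= t -> expR (- t) <= 1 - t + t ^+ 2.
Proof.
move=> t0; have e1 : 0 < 1 + t by rewrite ltr_wpDr.
apply: (@le_trans _ _ (1 + t)^-1).
  by rewrite expRN lef_pV2 ?posrE ?expR_gt0// expR_ge1Dx.
rewrite -div1r ler_pdivrMr//.
have : 0 <= t ^+ 3 by rewrite exprn_ge0.
have -> : (1 - t + t ^+ 2) * (1 + t) = 1 + t ^+ 3 by ring.
lra.
Qed.

Section independent.
Variables (n : nat) (K : finType) (Z : 'I_n -> T -> K).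
Hypothesis mZ : forall i c, measurable (Z i @^-1` [set c]).
Hypothesis iZ : forall (J : {set 'I_n}) (v : 'I_n -> K),
  P (\bigcap_(i in [set i | i \in J]) Z i @^-1` [set v i]) =
  (\prod_(i in J) P (Z i @^-1` [set v i]))%E.

(** Exponential Markov inequality, written as a finite sum over the value vectors v. As a is at most
    1, [a ^+ 2 <= a], so the second moment is bounded by V. In the applications V has the size of a
    ball volume, and this leaves a single volume factor in the exponent where a bound using only the
    range of a would leave two. *)
Lemma chernoff (a : K -> R) (m V tau : R) :
  (forall c, 0 <= a c) -> (forall c, a c <= 1) -> 0 < V -> 0 < tau ->
  (forall i, m <= \sum_c a c * prob (Z i @^-1` [set c])) ->
  (forall i, \sum_c a c * prob (Z i @^-1` [set c]) <= V) ->
  exists E, [/\ measurable E,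
    [set w | \sum_i a (Z i w) <= n%:R * (m - tau)] `<=` E &
    (P E <= (expR (- (n%:R * tau ^+ 2 / (4 * V))))%:E)%E].
Proof.
move=> a0 a1 V0 tau0 mle leV.
(* This s minimizes [- s * tau + s ^+ 2 * V]. *)
pose t := n%:R * (m - tau); pose s := tau / (2 * V).
have s0 : 0 <= s by rewrite divr_ge0 ?mulr_ge0// ltW.
pose C (v : {ffun 'I_n -> K}) := \bigcap_(i in [set i | i \in [set: 'I_n]%SET]) Z i @^-1` [set v i].
have mC v : measurable (C v).
  by apply: fin_bigcap_measurable.
have PC v : P (C v) = (\prod_i prob (Z i @^-1` [set v i]))%:E.
  rewrite /C iZ -prodEFin; apply: eq_big => [i|i _]; last exact: probE.
  exact: finset.in_setT.
pose Q (v : {ffun 'I_n -> K}) := \sum_i a (v i) <= t.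
have [mE PE] := measure_big_setU_le (index_enum {ffun 'I_n -> K}) Q mC.
exists (\big[setU/set0]_(v | Q v) C v); split => //.
  move=> w /= wt; rewrite -bigcup_seq_cond; exists [ffun i => Z i w] => /=.
    rewrite mem_index_enum/= /Q; under eq_bigr do rewrite ffunE.
    exact: wt.
  by move=> i _ /=; rewrite ffunE.
apply: le_trans PE _.
under eq_bigr do rewrite PC.
rewrite sumEFin lee_fin.
apply: (@le_trans _ _ (\sum_(v : {ffun 'I_n -> K}) (\prod_i prob (Z i @^-1` [set v i])) *
    expR (s * (t - \sum_i a (v i))))).
  rewrite big_mkcond/=; apply: ler_sum => v _.
  have p0 : 0 <= \prod_i prob (Z i @^-1` [set v i]).
    by apply: prodr_ge0 => i _; exact: prob_ge0.
  case: ifPn => [vt|_]; last by rewrite mulr_ge0// expR_ge0.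
  rewrite ler_peMr// -[leLHS]expR0 ler_expR mulr_ge0// subr_ge0//.
have -> : \sum_(v : {ffun 'I_n -> K}) (\prod_i prob (Z i @^-1` [set v i])) *
    expR (s * (t - \sum_i a (v i))) =
    expR (s * t) * \prod_i \sum_c prob (Z i @^-1` [set c]) * expR (- (s * a c)).
  rewrite bigA_distr_bigA/= mulr_sumr; apply: eq_bigr => v _.
  rewrite mulrBr expRD mulr_sumr -sumrN expR_sum big_split/=.
  by rewrite mulrCA.
apply: (@le_trans _ _ (expR (s * t) * \prod_(i < n) expR (- (s * m) + s ^+ 2 * V))).
  rewrite ler_wpM2l ?expR_ge0//; apply: ler_prod => i _; apply/andP; split.
    by apply: sumr_ge0 => c _; rewrite mulr_ge0 ?expR_ge0// prob_ge0.
  apply: le_trans (expR_ge1Dx _).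
  apply: (@le_trans _ _ (\sum_c prob (Z i @^-1` [set c]) *
      (1 - s * a c + s ^+ 2 * a c))).
    apply: ler_sum => c _; rewrite ler_wpM2l ?prob_ge0//.
    apply: le_trans (expRN_le _) _; first by rewrite mulr_ge0.
    rewrite lerD2l exprMn ler_wpM2l ?sqr_ge0// expr2 ler_piMl//.
  have -> : \sum_c prob (Z i @^-1` [set c]) * (1 - s * a c + s ^+ 2 * a c) =
      1 - s * (\sum_c a c * prob (Z i @^-1` [set c])) +
      s ^+ 2 * (\sum_c a c * prob (Z i @^-1` [set c])).
    rewrite -[X in _ = X - _ + _](sum_prob1 (mZ i)) !mulr_sumr -sumrB -big_split/=.
    by apply: eq_bigr => c _; ring.
  have h1 := ler_wpM2l s0 (mle i).
  have h2 := ler_wpM2l (sqr_ge0 s) (leV i).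
  lra.
rewrite prodr_const card_ord -expRM_natl -expRD ler_expR.
rewrite le_eqVlt; apply/orP; left; apply/eqP; rewrite /t /s.
by field; rewrite gt_eqF.
Qed.

(** Union over pairs and values: for a pair, the products of the two probabilities sum over the
    values to at most s, because the second factors sum to 1. *)
Lemma collision (s : R) :
  (forall i c, prob (Z i @^-1` [set c]) <= s) ->
  exists E, [/\ measurable E,
    [set w | exists i j, i != j /\ Z i w = Z j w] `<=` E &
    (P E <= (n%:R ^+ 2 * s)%:E)%E].
Proof.
move=> zs; pose C (u : ('I_n * 'I_n) * K) := Z u.1.1 @^-1` [set u.2] `&` Z u.1.2 @^-1` [set u.2].
pose Q (u : ('I_n * 'I_n) * K) := u.1.1 != u.1.2.
have mC u : measurable (C u) by exact: measurableI.
have [mE PE] := measure_big_setU_le (index_enum (('I_n * 'I_n) * K)%type) Q mC.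
exists (\big[setU/set0]_(u | Q u) C u); split => //.
  move=> w /= [i [j [ij ijw]]]; rewrite -bigcup_seq_cond.
  by exists ((i, j), Z i w) => //=; rewrite mem_index_enum.
apply: le_trans PE _.
have PC u : Q u -> P (C u) = (prob (Z u.1.1 @^-1` [set u.2]) * prob (Z u.1.2 @^-1` [set u.2]))%:E.
  move=> Qu; have u12 : u.1.1 \notin [set u.1.2]%SET by rewrite finset.in_set1.
  have E : (\prod_(i in [set u.1.1; u.1.2]%SET) P (Z i @^-1` [set u.2]))%E =
      (prob (Z u.1.1 @^-1` [set u.2]) * prob (Z u.1.2 @^-1` [set u.2]))%:E.
    by rewrite (big_setU1 _ u12)/= big_set1 EFinM -!probE.
  rewrite -E -(iZ _ (fun=> u.2)); congr (P _); apply/seteqP; split => [w [w1 w2] i /=|w H].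
    by rewrite finset.in_set2 => /orP[/eqP ->|/eqP ->].
  by split; [apply: (H u.1.1)|apply: (H u.1.2)]; rewrite /= finset.in_set2 eqxx ?orbT.
rewrite (eq_bigr _ PC) sumEFin lee_fin big_mkcond/=.
apply: (@le_trans _ _ (\sum_(u : ('I_n * 'I_n) * K) s * prob (Z u.1.2 @^-1` [set u.2]))).
  apply: ler_sum => u _; case: ifP => _; first by rewrite ler_wpM2r ?prob_ge0.
  rewrite mulr_ge0 ?prob_ge0//; exact: le_trans (prob_ge0 _) (zs u.1.1 u.2).
rewrite -(pair_bigA _ (fun ij c => s * prob (Z ij.2 @^-1` [set c])))/=.
rewrite (eq_bigr (fun=> s)) => [|ij _]; last by rewrite -mulr_sumr sum_prob1// mulr1.
by rewrite sumr_const card_prod !card_ord -[X in X <= _]mulr_natl natrM expr2.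
Qed.

End independent.
End finite_valued.

(** * Lower tails and coincidences for the sample *)

Section sample.
Context {R : realType} {d : nat} {disp : measure_display} {T : measurableType disp}.
Variables (P : probability T R) (n : nat) (X : 'I_n -> {RV P >-> 'rV[R]_d.+1}).
Variables (Omega : set 'rV[R]_d.+1) (rho : 'rV[R]_d.+1 -> R) (L rho1 : R).
Hypotheses (iX : mutually_independent X) (oO : open Omega)
  (rL : elipschitz Omega L rho) (r0 : forall y, Omega y -> 0 <= rho y)
  (r1 : forall y, Omega y -> rho y <= rho1) (rho10 : 0 < rho1)
  (dX : forall i, has_density (lebesgue_rV d.+1) Omega rho (X i)).
Local Notation mu := (lebesgue_rV d.+1).

Section one_test.
Variable F : 'rV[R]_d.+1 -> R.
Hypotheses (mF : measurable_fun setT F) (F0 : forall y, 0 <= F y)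
  (F1 : forall y, F y <= 1).

Let mcell N c : measurable (cell N F @^-1` [set c]).
Proof. exact: measurable_cell. Qed.

Let mZ N i c : measurable ((fun w => cell N F (X i w)) @^-1` [set c]).
Proof.
rewrite (_ : _ @^-1` _ = X i @^-1` (cell N F @^-1` [set c]))//.
rewrite -[X in measurable X]setTI.
exact: (@measurable_funPT _ _ _ _ (X i) measurableT _ (mcell c)).
Qed.

Let iZ N (J : {set 'I_n}) (v : 'I_n -> 'I_N.+2) :
  P (\bigcap_(i in [set i | i \in J]) (fun w => cell N F (X i w)) @^-1` [set v i]) =
  (\prod_(i in J) P ((fun w => cell N F (X i w)) @^-1` [set v i]))%E.
Proof. exact: (iX J (A := fun i => cell N F @^-1` [set v i])). Qed.

(** [chernoff] for the rounded test function. One tau pays for the rounding, the other for the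
    deviation. The mean is bounded below through the density on B and above by rho1 v, a bound for
    the probability of B. *)
Lemma lower_tail (B : set 'rV[R]_d.+1) (rho0 M v tau : R) : measurable B ->
  B `<=` Omega -> (mu B <= v%:E)%E -> 0 < v -> (forall y, ~ B y -> F y = 0) ->
  0 <= rho0 -> (forall y, B y -> rho0 <= rho y) -> 0 < tau ->
  (M%:E <= \int[mu]_y (F y)%:E)%E ->
  exists E, [/\ measurable E,
    [set w | \sum_i F (X i w) < n%:R * (rho0 * M - 2 * tau)] `<=` E &
    (P E <= (expR (- (n%:R * tau ^+ 2 / (4 * (rho1 * v)))))%:E)%E].
Proof.
move=> mB BO Bv v0 BF rho00 rhoB tau0 MF.
pose k := Num.truncn ((rho0 * v + 1) / tau); pose N := k.
have Ntau : rho0 * (N.+1%:R^-1 * v) <= tau.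
  have q0 : 0 <= (rho0 * v + 1) / tau by rewrite divr_ge0 ?(ltW tau0)// addr_ge0// mulr_ge0// ltW.
  have /andP[_] := truncn_itv q0; rewrite -/k -/N ltr_pdivrMr// => h.
  rewrite mulrCA ler_pdivrMl//; have : 0 < rho0 * v + 1 by rewrite ltr_wpDl// mulr_ge0// ltW.
  lra.
have Ntau' : N.+1%:R^-1 <= tau.
  have q0 : 0 <= (rho0 * v + 1) / tau by rewrite divr_ge0 ?(ltW tau0)// addr_ge0// mulr_ge0// ltW.
  have /andP[_] := truncn_itv q0; rewrite -/k -/N ltr_pdivrMr// => h.
  rewrite invf_ple ?posrE// -div1r ler_pdivrMr// mulrC.
  have : 0 <= rho0 * v by rewrite mulr_ge0// ltW.
  rewrite mulrC; lra.
pose a : 'I_N.+2 -> R := @level R N.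
pose q i c := prob P ((fun w => cell N F (X i w)) @^-1` [set c]).
have suppB c : a c != 0 -> cell N F @^-1` [set c] `<=` B by exact: cell_support.
have Blt : (mu B < +oo)%E by apply: le_lt_trans Bv _; rewrite ltry.
have low i : rho0 * M - tau <= \sum_c a c * q i c.
  have H := integral_cells N mF F0 F1 mB BF Blt.
  have : (rho0%:E * M%:E <= rho0%:E * (\sum_(c < N.+2) (level c)%:E *
       mu (cell N F @^-1` [set c]) + N.+1%:R^-1%:E * mu B))%E.
    by apply: lee_wpmul2l; rewrite ?lee_fin//; apply: le_trans MF H.
  have l0 c : (0 <= (level c)%:E * mu (cell N F @^-1` [set c]))%E.
    by rewrite mule_ge0// lee_fin level_ge0.
  rewrite ge0_muleDr; last 2 first.
  - exact: sume_ge0.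
  - by rewrite mule_ge0// lee_fin invr_ge0.
  rewrite ge0_sume_distrr//.
  move=> h.
  have : (rho0%:E * M%:E <= (\sum_c a c * q i c + tau)%:E)%E.
    apply: le_trans h _; rewrite EFinD -sumEFin; apply: leeD.
      apply: lee_sum => c _; rewrite /a; have [->|ac] := eqVneq (level c) (0 : R).
        by rewrite mul0e mule0 mul0r.
      rewrite muleCA (EFinM (level c) (q i c)); apply: lee_wpmul2l; first by rewrite lee_fin level_ge0.
      rewrite /q -probE//.
      apply: (density_ge oO rL (dX i)) => //.
        by move=> y cy; apply: BO; apply: suppB cy.
      by move=> y cy; apply: rhoB; apply: suppB cy.
    apply: (@le_trans _ _ (rho0 * (N.+1%:R^-1 * v))%:E); last by rewrite lee_fin.
    rewrite 2!EFinM; apply: lee_wpmul2l; rewrite ?lee_fin//.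
    by apply: lee_wpmul2l; rewrite ?lee_fin// invr_ge0.
  rewrite -EFinM lee_fin; lra.
have up i : \sum_c a c * q i c <= rho1 * v.
  rewrite -lee_fin /q -(sum_fibers P (mZ (N := N) i)); last by move=> c; exact: level_ge0.
  have mXB : measurable (X i @^-1` B).
    rewrite -[X in measurable X]setTI.
    exact: (@measurable_funPT _ _ _ _ (X i) measurableT _ mB).
  apply: (@le_trans _ _ (P (X i @^-1` B))); last first.
    apply: le_trans (density_le oO rL r0 (dX i) mB mB _ (ltW rho10) r1) _.
      by move=> y [].
    by rewrite EFinM; apply: lee_wpmul2l; rewrite ?lee_fin// ltW.
  apply: (@le_trans _ _ (\int[P]_w (\1_(X i @^-1` B) w)%:E)%E); last first.
    by rewrite integral_indic// setIT.
  apply: ge0_le_integral => //.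
  - by move=> w _; rewrite lee_fin level_ge0.
  - apply/measurable_EFinP.
    have -> : (fun w => a (cell N F (X i w))) =
        (fun w => \sum_c a c * \1_((fun w => cell N F (X i w)) @^-1` [set c]) w).
      apply/funext => w; rewrite (bigD1 (cell N F (X i w)))//= indicE mem_set// mulr1.
      rewrite big1 ?addr0// => c cZ; rewrite indicE memNset ?mulr0//=.
      by move=> zc; move: cZ; rewrite zc eqxx.
    apply: measurable_sum => c; apply: measurable_funM => //.
  - exact/measurable_EFinP/measurable_indic.
  - move=> w _; rewrite lee_fin indicE; have [|nB] := boolP (w \in _).
      by move=> _; exact: level_le1.
    have -> : a (cell N F (X i w)) = 0; last by [].
    apply/eqP; apply: contraNT nB => an0; apply/mem_set.
    exact: (suppB _ an0).
have V0 : 0 < rho1 * v by rewrite mulr_gt0.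
have [E [mE sE PE]] := chernoff (mZ (N := N)) (@iZ N) (@level_ge0 R N) (@level_le1 R N)
  V0 tau0 low up.
exists E; split => // w /= wF; apply: sE => /=.
apply: (@le_trans _ _ (\sum_i F (X i w))).
  by apply: ler_sum => i _; have /andP[] := level_cell N F0 F1 (X i w).
by apply: ltW; apply: lt_le_trans wF _; rewrite ler_wpM2l//; lra.
Qed.

End one_test.

(** Coincidences matter because the graph operator sums over the set of sample points, not over
    indices. Rounding the first coordinate cuts Omega into slabs of probability O(1 / N), and
    [collision] then makes the probability as small as desired. *)
Lemma samples_distinct (dl : R) : bounded_set Omega -> 0 < dl ->
  exists E, [/\ measurable E,
    [set w | exists i j, i != j /\ X i w = X j w] `<=` E & (P E <= dl%:E)%E].
Proof.
move=> bO dl0; have [M M0 OM] := bounded_set_enorm bO.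
pose F (y : 'rV[R]_d.+1) := Num.max 0 (Num.min 1 ((y ord0 ord0 + M) / (2 * M))).
have mF : measurable_fun setT F.
  apply: measurable_maxr => //; apply: measurable_minr => //.
  apply: measurable_funM => //; apply: measurable_funD => //.
  exact: measurable_rV_coord.
have F0 y : 0 <= F y by rewrite le_max lexx.
have F1 y : F y <= 1 by rewrite ge_max ler01/= ge_min lexx.
pose W := rho1 * (2 * M * (2 * M) ^+ d).
have W0 : 0 < W by rewrite !mulr_gt0// exprn_gt0// mulr_gt0.
pose N := Num.truncn (n%:R ^+ 2 * W / dl).
have NW : n%:R ^+ 2 * (W / N.+1%:R) <= dl.
  have q0 : 0 <= n%:R ^+ 2 * W / dl.
    by apply: divr_ge0; [apply: mulr_ge0; [exact: sqr_ge0|exact: ltW]|exact: ltW].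
  have /andP[_] := truncn_itv q0; rewrite -/N ltr_pdivrMr// => h.
  by rewrite mulrA ler_pdivrMr// (mulrC dl); exact: ltW.
have mcell c : measurable (cell N F @^-1` [set c]) by exact: measurable_cell.
have mZ i c : measurable ((fun w => cell N F (X i w)) @^-1` [set c]).
  rewrite (_ : _ @^-1` _ = X i @^-1` (cell N F @^-1` [set c]))//.
  rewrite -[X in measurable X]setTI.
  exact: (@measurable_funPT _ _ _ _ (X i) measurableT _ (mcell c)).
have iZ (J : {set 'I_n}) (v : 'I_n -> 'I_N.+2) :
  P (\bigcap_(i in [set i | i \in J]) (fun w => cell N F (X i w)) @^-1` [set v i]) =
  (\prod_(i in J) P ((fun w => cell N F (X i w)) @^-1` [set v i]))%E.
  exact: (iX J (A := fun i => cell N F @^-1` [set v i])).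
have [i c|E [mE sE PE]] := collision mZ iZ (s := W / N.+1%:R); last first.
  exists E; split => //.
    by move=> w [i [j [ij ijw]]]; apply: sE; exists i, j; rewrite ijw.
  by apply: le_trans PE _; rewrite lee_fin.
pose l : R := - M + 2 * M * level c.
pose A (k : 'I_d.+1) : set R :=
  if k == ord0 then `[l, l + 2 * M / N.+1%:R]%classic else `[- M, M]%classic.
have mA k : measurable (A k) by rewrite /A; case: ifP => _; exact: measurable_itv.
pose B := [set v : 'rV[R]_d.+1 | forall k, A k (v ord0 k)].
have mB : measurable B by exact: measurable_rV_box.
have M2 : 0 < 2 * M by rewrite mulr_gt0.
have BE : mu B = (2 * M / N.+1%:R * (2 * M) ^+ d)%:E.
  rewrite /B lebesgue_rV_box// big_ord_recl /A eqxx.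
  rewrite (eq_bigr (fun=> (2 * M)%:E)) => [|k _]; last first.
    rewrite lift_eqF/= lebesgue_measure_itv/= lte_fin.
    rewrite (_ : - M < M); last by lra.
    by rewrite -EFinD; congr (_%:E); ring.
  rewrite prodEFin prodr_const card_ord lebesgue_measure_itv/= lte_fin ltrDl divr_gt0//.
  by rewrite -EFinB -EFinM; congr (_ * _)%:E; ring.
rewrite -lee_fin -probE//.
apply: le_trans (density_le oO rL r0 (dX i) (mcell c) mB _ (ltW rho10) r1) _.
  move=> y [/= yc Oy] k; rewrite /A; have yM := OM y Oy.
  have ykM := le_trans (enorm_coord y k) yM.
  case: ifP => [/eqP k0|_]; rewrite /= in_itv/=; last by rewrite -ler_norml.
  subst k; have := level_cell N F0 F1 y; rewrite yc.
  move: ykM; rewrite ler_norml => /andP[y1 y2].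
  have q0 : 0 <= (y ord0 ord0 + M) / (2 * M) by rewrite divr_ge0 ?(ltW M2)//; lra.
  have q1 : (y ord0 ord0 + M) / (2 * M) <= 1 by rewrite ler_pdivrMr//; lra.
  have -> : F y = (y ord0 ord0 + M) / (2 * M).
    by rewrite /F (min_idPr q1) (max_idPr q0).
  move=> /andP[a1 a2]; rewrite ler_pdivlMr// in a1; rewrite ler_pdivrMr// in a2.
  move: a2; rewrite mulrDl /l => a2.
  have -> : 2 * M / N.+1%:R = N.+1%:R^-1 * (2 * M) by rewrite mulrC.
  move: a1 a2; move: (level c) (N.+1%:R^-1) => u v a1 a2.
  apply/andP; split; lra.
have WE : (rho1%:E * mu B = (W / N.+1%:R)%:E)%E.
  transitivity (rho1%:E * (2 * M / N.+1%:R * (2 * M) ^+ d)%:E)%E.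
    by congr (_ * _)%E; exact: BE.
  rewrite -EFinM /W; congr (_%:E); field.
  by rewrite addrC natr1 pnatr_eq0.
by rewrite -WE.
Qed.

End sample.

(** * Nets, and the passage from net points to all points *)

Section nets.
Context {R : realType} {d : nat}.
Implicit Types (x y z e : 'rV[R]_d.+1).

(** Each grid cell of side h / (d + 1) that meets A gets a representative in A, since the tails are
    available only for centres in A; other indices are sent to [a0], and an empty A has the empty
    index type. *)
Lemma net_exists (A : set 'rV[R]_d.+1) (M h : R) : 0 < M -> 0 < h ->
  (forall x, A x -> enorm x <= M) ->
  exists (J : finType) (y : J -> 'rV[R]_d.+1),
  [/\ (#|J|)%:R <= (2 * d.+1%:R * M / h + 1) ^+ d.+1 :> R,
    forall j, A (y j) & forall x, A x -> exists j, enorm (x - y j) <= h].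
Proof.
move=> M0 h0 AM; have q0 : 0 <= 2 * d.+1%:R * M / h by rewrite !mulr_ge0 ?invr_ge0 ?(ltW M0) ?(ltW h0).
have [->|/set0P[a0 Aa0]] := eqVneq A set0.
  exists void, (fun=> 0); split; [|by case|by []].
  by rewrite card_void exprn_ge0// addr_ge0.
pose h' := h / d.+1%:R; have h'0 : 0 < h' by rewrite divr_gt0.
pose m := Num.truncn (2 * M / h').
have qE : 2 * M / h' = 2 * d.+1%:R * M / h by rewrite /h'; field; rewrite gt_eqF//= addrC natr1 pnatr_eq0.
have nn x i : A x -> 0 <= (x ord0 i + M) / h' <= 2 * M / h'.
  move=> Ax; have := le_trans (enorm_coord x i) (AM x Ax); rewrite ler_norml => /andP[x1 x2].
  by rewrite divr_ge0 ?(ltW h'0)//= ?ler_pdivrMr// ?divfK ?gt_eqF//; lra.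
pose idx x : {ffun 'I_d.+1 -> 'I_m.+1} := [ffun i => inord (Num.truncn ((x ord0 i + M) / h'))].
have idxE x i : A x -> idx x i = Num.truncn ((x ord0 i + M) / h') :> nat.
  move=> Ax; have /andP[n1 n2] := nn x i Ax.
  rewrite ffunE inordK// ltnS; exact: le_truncn.
pose y j := if pselect (exists x, A x /\ idx x = j) is left H then projT1 (cid H) else a0.
exists {ffun 'I_d.+1 -> 'I_m.+1}, y; split.
- rewrite card_ffun !card_ord natrX lerXn2r ?nnegrE ?addr_ge0//.
  rewrite -natr1 lerD2r -qE; have q0' : 0 <= 2 * M / h' by rewrite qE.
  by have /andP[] := truncn_itv q0'.
- by move=> j; rewrite /y; case: pselect => // H; have [] := projT2 (cid H).
move=> x Ax; exists (idx x).
have [Ay yx] : A (y (idx x)) /\ idx (y (idx x)) = idx x.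
  by rewrite /y; case: pselect => [H|[]]; [exact: projT2 (cid H)|exists x].
have -> : h = d.+1%:R * h' by rewrite /h' mulrC divfK// pnatr_eq0.
apply: cube_enorm; first exact: ltW.
move=> i; rewrite /= in_itv/=.
have /(congr1 (fun f : {ffun 'I_d.+1 -> 'I_m.+1} => nat_of_ord (f i))) := yx.
rewrite !idxE// => E.
have /andP[x0 _] := nn x i Ax; have /andP[y0 _] := nn _ i Ay.
have /andP[] := truncn_itv x0; have /andP[] := truncn_itv y0; rewrite E.
move: (Num.truncn _) => k.
rewrite -!natr1 !ler_pdivlMr// !ltr_pdivrMr// mulrDl mul1r; lra.
Qed.

End nets.

Section kernel_tests.
Context {R : realType} {d : nat}.
Variables (eta : R -> R) (p : R).
Hypotheses (kP : kernel_profile (d := d) eta) (p1 : 1 <= p).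
Implicit Types (x y z e : 'rV[R]_d.+1).

(** Replacing centre and direction by net points costs kap each in the argument of the power. The
    third kap of [ktest] survives on the right, where it will absorb the quadratic term of the
    barrier. *)
Lemma ktest_transfer (kap eps : R) z z' e e' y : 0 <= kap -> 0 < eps ->
  enorm e = 1 -> enorm (z - z') <= kap * eps -> enorm (e - e') <= kap ->
  ktest eta p kap (enorm (z' - y) / eps) (edot e' (z' - y) / eps) <=
  eta (enorm (z - y) / eps) * Num.max (edot e (z - y) / eps - kap) 0 `^ p.
Proof.
move=> k0 eps0 ee zz ee'.
have q0 (u : 'rV[R]_d.+1) : 0 <= enorm u / eps by rewrite divr_ge0// ltW.
rewrite /ktest ger0_norm//.
have [out|inn] := ltP 1 (enorm (z' - y) / eps + kap).
  by rewrite (kernel_out kP out) mul0r mulr_ge0 ?powR_ge0// (kernel_ge0 kP).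
have zy : enorm (z - y) <= enorm (z - z') + enorm (z' - y) by exact: enorm_tri.
have z'y : enorm (z' - y) <= eps.
  have : enorm (z' - y) / eps <= 1 by lra.
  by rewrite ler_pdivrMr// mul1r.
rewrite ler_pM ?powR_ge0 ?(kernel_ge0 kP) ?addr_ge0//.
  apply: (kernel_nincr kP) => //.
  rewrite -(ler_pM2r eps0) mulrDl !divfK ?gt_eqF//; lra.
apply: ler_powR2; first by exact: le_trans ler01 p1.
  by rewrite le_max lexx orbT.
rewrite ge_max !le_max lexx orbT andbT; apply/orP; left.
rewrite -(ler_pM2r eps0) !mulrBl !divfK ?gt_eqF//.
have E : edot e (z - y) = edot e' (z' - y) + edot (e - e') (z' - y) + edot e (z - z').
  by rewrite edotBl !edotBr; ring.
have h1 := edot_abs_le (e - e') (z' - y); have h2 := edot_abs_le e (z - z').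
rewrite ee mul1r ler_norml in h2; rewrite ler_norml in h1.
move: h1 h2 => /andP[h1 _] /andP[h2 _].
have h3 : enorm (e - e') * enorm (z' - y) <= kap * eps by exact: ler_pM.
rewrite E; lra.
Qed.

End kernel_tests.

Section sample_tails.
Context {R : realType} {d : nat} {disp : measure_display} {T : measurableType disp}.
Variables (P : probability T R) (n : nat) (X : 'I_n -> {RV P >-> 'rV[R]_d.+1}).
Variables (Omega : set 'rV[R]_d.+1) (rho : 'rV[R]_d.+1 -> R) (L rho0 rho1 : R).
Hypotheses (iX : mutually_independent X) (oO : open Omega)
  (rL : elipschitz Omega L rho) (r0 : forall y, Omega y -> rho0 <= rho y)
  (rho00 : 0 < rho0)
  (r1 : forall y, Omega y -> rho y <= rho1) (rho10 : 0 < rho1)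
  (dX : forall i, has_density (lebesgue_rV d.+1) Omega rho (X i)).
Variables (eta : R -> R) (p : R).
Hypotheses (kP : kernel_profile (d := d) eta) (p1 : 1 <= p).
Implicit Types (x y z e : 'rV[R]_d.+1).
Local Notation mu := (lebesgue_rV d.+1).

Let r00 y : Omega y -> 0 <= rho y.
Proof. by move=> /r0; apply: le_trans; exact: ltW. Qed.

Lemma cube_tail z (a : R) : 0 < a -> cube z a `<=` Omega ->
  exists E, [/\ measurable E,
    [set w | \sum_i (\1_(cube z a) (X i w) : R) < n%:R * (rho0 / 2 * (2 * a) ^+ d.+1)] `<=` E &
    (P E <= (expR (- (n%:R * (rho0 ^+ 2 * (2 * a) ^+ d.+1 / (64 * rho1)))))%:E)%E].
Proof.
move=> a0 aO; pose v := (2 * a) ^+ d.+1.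
have v0 : 0 < v by rewrite exprn_gt0// mulr_gt0.
have mi : measurable_fun setT (\1_(cube z a) : 'rV[R]_d.+1 -> R).
  by apply: measurable_indic; exact: measurable_cube.
have i0 y : 0 <= \1_(cube z a) y :> R by rewrite indicE.
have i1 y : \1_(cube z a) y <= 1 :> R by rewrite indicE lern1 leq_b1.
have mc := measurable_cube z a.
have muc : (mu (cube z a) <= v%:E)%E by rewrite (volume_cube z a0).
have sc y : ~ cube z a y -> \1_(cube z a) y = 0 :> R.
  by move=> ny; rewrite indicE memNset.
have rc y : cube z a y -> rho0 <= rho y by move=> /aO; exact: r0.
have tau0 : 0 < rho0 * v / 4 by rewrite divr_gt0// mulr_gt0.
have Mi : (v%:E <= \int[mu]_y (\1_(cube z a) y)%:E)%E by rewrite integral_indic_cube.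
have [E [mE sE PE]] := lower_tail iX oO rL r00 r1 rho10 dX mi i0 i1 mc aO muc v0 sc
  (ltW rho00) rc tau0 Mi.
exists E; split => //.
  move=> w wE; apply: sE; rewrite /=; move: wE => /=; rewrite -/v.
  by have -> : rho0 * v - 2 * (rho0 * v / 4) = rho0 / 2 * v by field.
apply: le_trans PE _; rewrite lee_fin ler_expR lerN2 -/v.
rewrite le_eqVlt; apply/orP; left; apply/eqP; field.
by rewrite !gt_eqF.
Qed.

Lemma kernel_tail z e (kap eps tau C : R) : 0 < eps -> 0 < kap -> kap <= 1 -> 0 < tau ->
  enorm e = 1 -> [set y | enorm (z - y) < eps] `<=` Omega -> `|L| * eps <= rho0 ->
  ((sigma_p (d := d) eta p - C * kap)%:E <=
     \int[mu]_y (ktest eta p kap (enorm y) (y ord0 ord0))%:E)%E ->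
  exists E, [/\ measurable E,
    [set w | \sum_i ktest eta p kap (enorm (z - X i w) / eps) (edot e (z - X i w) / eps) <
      n%:R * eps ^+ d.+1 * ((rho z - `|L| * eps) * (sigma_p (d := d) eta p - C * kap) -
        2 * eta 0 * tau)] `<=` E &
    (P E <= (expR (- (n%:R * eps ^+ d.+1 * tau ^+ 2 / (4 * rho1 * 2 ^+ d.+1))))%:E)%E].
Proof.
move=> eps0 k00 k1 tau0 ee BO Leps hC; have e00 := kernel0_gt0 kP; have k0 := ltW k00.
pose B := [set y | enorm (z - y) < eps]; have mB : measurable B by exact: measurable_eball.
pose F y := ktest eta p kap (enorm (z - y) / eps) (edot e (z - y) / eps) / eta 0.
have epsD : 0 < eps ^+ d.+1 by rewrite exprn_gt0.
have q0 (u : 'rV[R]_d.+1) : 0 <= enorm u / eps by rewrite divr_ge0// ltW.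
have mzy : measurable_fun setT (fun y => z - y).
  by apply: measurable_rV_addf => //; exact: measurable_rV_oppf.
have mF : measurable_fun setT F.
  apply: measurable_funM => //; apply: (measurable_ktest p kP k0).
    apply: measurable_funM => //; apply: measurableT_comp mzy; exact: measurable_enorm.
  apply: measurable_funM => //; apply: measurableT_comp mzy; exact: measurable_edot.
have F0 y : 0 <= F y by rewrite divr_ge0 ?(ktest_ge0 p kP)// ltW.
have F1 y : F y <= 1.
  rewrite ler_pdivrMr// mul1r (ktest_le kP p1)// ger0_norm//.
  rewrite ler_pM2r ?invr_gt0//; apply: le_trans (edot_le _ _) _.
  by rewrite ee mul1r.
have Bv : (mu B <= ((2 * eps) ^+ d.+1)%:E)%E.
  rewrite -(volume_cube z eps0); apply: le_measure; rewrite ?inE//.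
    exact: measurable_cube.
  by move=> y /ltW; exact: enorm_cube.
have v0 : 0 < (2 * eps) ^+ d.+1 by rewrite exprn_gt0// mulr_gt0.
have BF y : ~ B y -> F y = 0.
  move=> /negP; rewrite -leNgt => yB; rewrite /F /ktest ger0_norm//.
  have : 1 <= enorm (z - y) / eps by rewrite ler_pdivlMr// mul1r.
  by move=> h; rewrite (kernel_out kP) ?mul0r//; lra.
have sg y : B y -> rho z - `|L| * eps <= rho y.
  move=> By; have Oz : Omega z by apply: BO; rewrite /= subrr enorm0.
  have := rL (mem_set Oz) (mem_set (BO y By)) => /(le_trans (ler_norm _)).
  have : L * enorm (z - y) <= `|L| * eps.
    apply: (@le_trans _ _ (`|L| * enorm (z - y))); first by rewrite ler_wpM2r// ler_norm.
    by rewrite ler_wpM2l// ltW.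
  lra.
have Oz : Omega z by apply: BO; rewrite /= subrr enorm0.
have s0 : 0 <= rho z - `|L| * eps by have := r0 Oz; lra.
have tau0' : 0 < tau * eps ^+ d.+1 by rewrite mulr_gt0.
pose M := eps ^+ d.+1 * (sigma_p (d := d) eta p - C * kap) / eta 0.
have MF : (M%:E <= \int[mu]_y (F y)%:E)%E.
  have mK : measurable_fun setT (fun y : 'rV[R]_d.+1 => (ktest eta p kap (enorm y) (y ord0 ord0))%:E).
    apply/measurable_EFinP; apply: (measurable_ktest p kP k0).
      exact: measurable_enorm.
    exact: measurable_rV_coord.
  have mKe : measurable_fun setT (fun y : 'rV[R]_d.+1 => (ktest eta p kap (enorm y) (y ord0 ord0) / eta 0)%:E).
    by apply/measurable_EFinP; apply: measurable_funM => //; exact/measurable_EFinP.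
  have := @integral_radial R d (fun s t => (ktest eta p kap s t / eta 0)%:E) z e eps mKe.
  move=> /(_ _ ee eps0) ->; last by move=> s t; rewrite lee_fin divr_ge0 ?(ktest_ge0 p kP)// ltW.
  under eq_integral do rewrite mulrC EFinM.
  rewrite ge0_integralZl_EFin ?invr_ge0 ?(ltW e00)//; last by move=> y _; rewrite lee_fin (ktest_ge0 p kP).
  rewrite /M -mulrA EFinM; apply: lee_wpmul2l; first by rewrite lee_fin ltW.
  rewrite mulrC EFinM; apply: lee_wpmul2l => //.
  by rewrite lee_fin invr_ge0 ltW.
have [E [mE sE PE]] := lower_tail iX oO rL r00 r1 rho10 dX mF F0 F1 mB BO Bv v0 BF
  s0 sg tau0' MF.
exists E; split => //.
  move=> w wE; apply: sE; rewrite /=; move: wE => /= wE.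
  rewrite -mulr_suml ltr_pdivrMr//; apply: lt_le_trans wE _.
  rewrite le_eqVlt; apply/orP; left; apply/eqP; rewrite /M; field.
  by rewrite gt_eqF.
apply: le_trans PE _; rewrite lee_fin ler_expR lerN2.
rewrite le_eqVlt; apply/orP; left; apply/eqP; rewrite !exprMn; field.
by rewrite !gt_eqF// ?exprn_gt0.
Qed.

End sample_tails.

(** * Arithmetic of the union bound *)

Section union_bound.
Context {R : realType}.

(* The constant in the exponent absorbs the cardinality of the nets. *)
Lemma absorb_nets (c c' A y n dl : R) : 0 < c -> c <= 1 / 2 -> 3 * c <= c' ->
  1 <= n -> 0 <= y -> y ^+ 2 <= n ^+ 4 -> y <= y ^+ 2 -> 0 <= A ->
  3 * n ^+ 2 * expR (- (c * A)) < 1 -> dl = n ^+ 2 * expR (- (c * A)) ->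
  dl + y * expR (- (c' * A)) + y ^+ 2 * expR (- (c' * A)) <=
    3 * n ^+ 2 * expR (- (c * A)).
Proof.
move=> c0 c2 cc n1 y0 yn yy A0 nA ->; set E := expR (- (c * A)).
have E0 : 0 < E by exact: expR_gt0.
(* Tripling the exponent gives E^3, and n^4 E^3 = (n^2 E)(n^2 E) E <= n^2 E. The coincidences, the
   net of points and the net of points and directions thus cost n^2 E each, whence the factor 3. *)
have EE : expR (- (c' * A)) <= E ^+ 3.
  rewrite -expRM_natl ler_expR mulrN lerN2 mulrA.
  by rewrite ler_wpM2r.
have e0 : 0 <= expR (- (c' * A)) by exact: expR_ge0.
move: (expR (- (c' * A))) EE e0 => F EE e0.
have n0 : 0 < n by lra.
have h1 : y * F <= y ^+ 2 * F by rewrite ler_wpM2r.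
have h2 : y ^+ 2 * F <= n ^+ 4 * E ^+ 3.
  by apply: ler_pM => //; rewrite exprn_ge0.
have n2E : n ^+ 2 * E <= 1.
  have n2 : 0 < n ^+ 2 * E by rewrite mulr_gt0// exprn_gt0.
  by move: nA; rewrite -/E -mulrA; lra.
have E1 : E <= 1 by rewrite -[leRHS]expR0 ler_expR oppr_le0 mulr_ge0// ltW.
have h3 : n ^+ 4 * E ^+ 3 <= n ^+ 2 * E.
  have -> : n ^+ 4 * E ^+ 3 = (n ^+ 2 * E) * ((n ^+ 2 * E) * E) by ring.
  rewrite -[leRHS]mulr1 ler_wpM2l//; first by rewrite mulr_ge0// ?exprn_ge0// ltW.
  rewrite -[leRHS]mulr1; apply: ler_pM => //; last exact: ltW.
  by rewrite mulr_ge0// ?exprn_ge0// ltW.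
lra.
Qed.

(** Unless the probability bound is vacuous, [c * A] exceeds log 3. For A = n eps^(d+1) lam^2 this
    yields n eps^(d+1) >= 1, which turns powers of 1 / eps into powers of n. *)
Lemma large_sample (c A n : R) : 0 < c -> c <= 1 / 2 -> 1 <= n ->
  3 * n ^+ 2 * expR (- (c * A)) < 1 -> 1 <= A.
Proof.
move=> c0 c2 n1 nA; rewrite leNgt; apply/negP => A1.
have : expR (- (c * A)) <= 1 / 3.
  rewrite ler_pdivlMr//; apply: ltW; apply: le_lt_trans nA; rewrite mulrC.
  rewrite ler_wpM2r ?expR_ge0//.
  have : 1 <= n ^+ 2 by rewrite exprn_ege1.
  lra.
have := expR_ge1Dx (- (c * A)).
have : c * A <= 1 / 2 * 1.
  have [A0|A0] := leP 0 A; first by apply: ler_pM => //; lra.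
  have : c * A <= 0 by rewrite mulr_ge0_le0// ltW.
  lra.
lra.
Qed.

(** The meshes are multiples of s, s^2 and s^3, for directions, ball centres and kernel centres; a
    fourth power of 1 / s swallows the constants once s is small. *)
Lemma net_size (K s : R) (k : nat) : 0 <= K -> 0 < s -> (K + 1) * s <= 1 ->
  (k <= 3)%N -> K / s ^+ k + 1 <= s ^- 4.
Proof.
move=> K0 s0 Ks k3; have s1 : s <= 1.
  have : 0 <= K * s by rewrite mulr_ge0// ltW.
  lra.
have s40 : 0 < s ^+ 4 by rewrite exprn_gt0.
have sk0 : 0 < s ^+ k by rewrite exprn_gt0.
rewrite -[leRHS]mul1r ler_pdivlMr// mulrDl mul1r.
have -> : K / s ^+ k * s ^+ 4 = K * s ^+ (4 - k).
  rewrite -mulrA; congr (_ * _); rewrite -{1}(subnK (leqW k3)) exprD mulrCA mulVf ?mulr1//.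
  by rewrite gt_eqF.
have pw (m : nat) : (0 < m)%N -> s ^+ m <= s.
  by case: m => // m _; rewrite exprS ler_piMr ?exprn_ile1 ?(ltW s0).
have h1 : K * s ^+ (4 - k) <= K * s by rewrite ler_wpM2l// pw// subn_gt0 ltnS.
have := pw 4%N isT; lra.
Qed.

End union_bound.

Section sample_event.
Context {R : realType}.

Lemma bigU_fin_prob (disp : measure_display) (T : measurableType disp)
  (P : probability T R) (J : finType) (A : J -> set T) (x : R) :
  (forall j, measurable (A j) /\ (P (A j) <= x%:E)%E) ->
  exists E, [/\ measurable E, forall j, A j `<=` E & (P E <= ((#|J|)%:R * x)%:E)%E].
Proof.
move=> mA; have [mE PE] := measure_big_setU_le P (index_enum J) xpredT (fun j => (mA j).1).
exists (\big[setU/set0]_j A j); split => //.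
  by move=> j w Aw; rewrite -bigcup_seq; exists j => //=; rewrite mem_index_enum.
apply: le_trans PE _; apply: (@le_trans _ _ (\sum_(j : J) x%:E)%E).
  by apply: lee_sum => j _; exact: (mA j).2.
by rewrite sumEFin lee_fin sumr_const mulr_natl.
Qed.

(** The whole probabilistic content. The event involves neither f nor Gamma. The parameter b is left
    free because the barrier dictates it: its slope times b has to be at least 1. *)
Lemma sample_event (d : nat) (eta : R -> R) (p th b rhomin rhomax Lr : R) :
  kernel_profile (d := d) eta -> 1 <= p -> 0 < th -> 0 < b -> 0 < rhomin ->
  exists c c1 C : R, [/\ 0 < c, 0 < c1, 0 < C &
  forall (Omega : set 'rV[R]_d.+1) (rho : 'rV[R]_d.+1 -> R),
    open Omega -> bounded_set Omega -> boundary Omega !=set0 ->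
    elipschitz (closure Omega) Lr rho ->
    (forall x, Omega x -> rhomin <= rho x <= rhomax) ->
  exists2 eps0 : R, 0 < eps0 &
  forall (eps lam : R), 0 < eps -> eps < eps0 -> 0 < lam -> lam <= 1 ->
  forall (n : nat) (disp : measure_display) (T : measurableType disp)
    (P : probability T R) (X : 'I_n -> {RV P >-> 'rV[R]_d.+1}),
    mutually_independent X ->
    (forall i, has_density (lebesgue_rV d.+1) Omega rho (X i)) ->
  prob_ge P
    [set w | [/\ injective (fun i => X i w),
      forall z, Omega z -> th * eps <= sdist (boundary Omega) z ->
        c1 * (n%:R * eps ^+ d.+1) <= \sum_i (enorm (z - X i w) <= th * eps)%R%:R &
      forall z e, Omega z -> eps <= sdist (boundary Omega) z -> enorm e = 1 ->
        n%:R * eps ^+ d.+1 * rho z * (sigma_p (d := d) eta p - C * (Num.sqrt eps + lam)) <=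
        \sum_i eta (enorm (z - X i w) / eps) *
          Num.max (edot e (z - X i w) / eps - b * Num.sqrt eps) 0 `^ p]]
    (1 - 3 * n%:R ^+ 2 * expR (- (c * n%:R * eps ^+ d.+1 * lam ^+ 2)))].
Proof.
move=> kP p1 th0 b0 rho0; have e00 := kernel0_gt0 kP.
have sg0 := sigma_gt0 kP p1; have [C0 C00 hC] := ktest_moment kP p1.
set sg := sigma_p (d := d) eta p in sg0 hC *.
pose D : R := d.+1%:R; have D0 : 0 < D by [].
pose rho1 := Num.max rhomin rhomax; have rho10 : 0 < rho1 by rewrite lt_max rho0.
(* [k1 * eps ^+ d.+1] is the volume of a cube inscribed in a ball of radius th eps / 2. *)
pose k1 := (th / D) ^+ d.+1; have k10 : 0 < k1 by rewrite exprn_gt0// divr_gt0.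
pose c' := Num.min (rhomin ^+ 2 * k1 / (64 * rho1)) (1 / (4 * rho1 * 2 ^+ d.+1)).
have c'0 : 0 < c'.
  have h1 : 0 < rhomin ^+ 2 * k1 by apply: mulr_gt0 => //; exact: exprn_gt0.
  have h2 : 0 < 64 * rho1 by exact: mulr_gt0.
  have h3 : 0 < 4 * rho1 * 2 ^+ d.+1.
    by apply: mulr_gt0; [exact: mulr_gt0|exact: exprn_gt0].
  by rewrite lt_min; apply/andP; split; exact: divr_gt0.
(* At most a third of the exponent of the tails; the rest is spent on the nets. *)
pose c := Num.min (1 / 2) (c' / 3).
have c0 : 0 < c by rewrite lt_min !divr_gt0.
have c2 : c <= 1 / 2 by rewrite ge_min lexx.
have c3 : 3 * c <= c'.
  have : c <= c' / 3 by rewrite ge_min lexx orbT.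
  lra.
pose c1 := rhomin / 2 * k1; have c10 : 0 < c1 by rewrite mulr_gt0// divr_gt0.
(* In order: the slack kap = b sqrt eps of the tests, the oscillation of rho at scale eps, the
   deviation lam. *)
pose C := C0 * b + 2 * `|Lr| * sg / rhomin + 2 * eta 0 / rhomin.
have C_0 : 0 < C.
  rewrite ltr_wpDr ?divr_ge0 ?mulr_ge0 ?(ltW e00) ?(ltW rho0)//.
  by rewrite ltr_wpDr ?divr_ge0 ?mulr_ge0 ?(ltW rho0) ?(ltW sg0)// mulr_gt0.
exists c, c1, C; split => // Omega rho oO bO S0 rL rB.
have rLO : elipschitz Omega Lr rho.
  by move=> x y /set_mem Ox /set_mem Oy; apply: rL; apply/mem_set; exact: subset_closure.
have r0 y : Omega y -> rhomin <= rho y by move=> /rB/andP[].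
have r1 y : Omega y -> rho y <= rho1.
  by move=> /rB/andP[_ ry]; rewrite le_max ry orbT.
have [M M0 OM] := bounded_set_enorm bO.
pose Ka := 2 * D * M / b; pose Kb := 2 * D * 1 / b; pose Kc := 2 * D * M / (th / 2).
have Ka0 : 0 <= Ka by rewrite !mulr_ge0 ?invr_ge0// ltW.
have Kb0 : 0 <= Kb by rewrite !mulr_ge0 ?invr_ge0// ltW.
have Kc0 : 0 <= Kc by rewrite !mulr_ge0 ?invr_ge0// ltW// divr_gt0.
pose L' := `|Lr| / rhomin; have L'0 : 0 <= L' by rewrite divr_ge0// ltW.
pose C' := C0 * b / sg; have C'0 : 0 <= C' by rewrite !mulr_ge0 ?invr_ge0// ltW.
(* One constant that dominates the others, so that [s * Q <= 1] yields every smallness condition. *)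
pose Q := 1 + Ka + Kb + Kc + L' + C' + b.
have Q0 : 0 < Q by rewrite /Q; move: Ka0 Kb0 Kc0 L'0 C'0 b0; clear; lra.
have [Q1 QKa QKb QKc] : [/\ 0 <= Q - 1, Ka <= Q - 1, Kb <= Q - 1 & Kc <= Q - 1].
  by rewrite /Q; move: Ka0 Kb0 Kc0 L'0 C'0 b0; clear; split; lra.
have [QL QC Qb] : [/\ L' <= Q - 1, C' <= Q - 1 & b <= Q - 1].
  by rewrite /Q; move: Ka0 Kb0 Kc0 L'0 C'0 b0; clear; split; lra.
exists (Q^-1 ^+ 2); first by rewrite exprn_gt0// invr_gt0.
move=> eps lam eps0 epsQ lam0 lam1 n disp T P X iX dX.
pose s := Num.sqrt eps; have s0 : 0 < s by rewrite sqrtr_gt0.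
have s2 : s ^+ 2 = eps by rewrite sqr_sqrtr// ltW.
have sQ : s * Q <= 1.
  rewrite -ler_pdivlMr// div1r -(@ler_pXn2r _ 2) ?nnegrE ?(ltW s0) ?invr_ge0 ?(ltW Q0)//.
  by rewrite s2 ltW.
have sK (K : R) : K <= Q - 1 -> (K + 1) * s <= 1.
  move=> KQ; apply: le_trans sQ; rewrite mulrC ler_wpM2l//; first exact: ltW.
  by rewrite -lerBrDr.
have s1 : s <= 1 by have := sK 0 Q1; rewrite add0r mul1r.
have epss : eps <= s by rewrite -s2 expr2 ler_piMr// ltW.
pose kap := b * s; have kap0 : 0 < kap by rewrite mulr_gt0.
have kap1 : kap <= 1.
  have := sK b Qb; rewrite mulrDl mul1r -/kap; move: s0; clear; lra.
have Ckap : C0 * kap <= sg.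
  have : C' * s <= 1 by have := sK C' QC; rewrite mulrDl mul1r; move: s0; clear; lra.
  by rewrite /C' mulrAC ler_pdivrMr// mul1r mulrA.
have Leps : `|Lr| * eps <= rhomin.
  have : L' * s <= 1 by have := sK L' QL; rewrite mulrDl mul1r; move: s0; clear; lra.
  rewrite /L' mulrAC ler_pdivrMr// mul1r; apply: le_trans.
  by rewrite ler_wpM2l.
pose A := n%:R * eps ^+ d.+1 * lam ^+ 2.
have epsD : 0 < eps ^+ d.+1 by rewrite exprn_gt0.
have A0 : 0 <= A by rewrite !mulr_ge0// ltW.
have -> : c * n%:R * eps ^+ d.+1 * lam ^+ 2 = c * A by rewrite /A !mulrA.
(* A vacuous bound is witnessed by the empty event. *)
have [nA|nA] := leP 1 (3 * n%:R ^+ 2 * expR (- (c * A))).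
  exists set0; split => //; rewrite measure0 lee_fin; move: nA; clear; lra.
have [n0|n0] := posnP n.
  exists setT; split => //; last first.
    by rewrite probability_setT lee_fin n0 expr0n mulr0 mul0r subr0.
  move=> w _; have z0 (F : 'I_n -> R) : \sum_i F i = 0.
    by rewrite big1// => i _; have := ltn_ord i; rewrite {2}n0.
  split => [i|z _ _|z e _ _ _]; last 2 first.
  - by rewrite z0 n0 mul0r mulr0.
  - by rewrite z0 n0 !mul0r.
  by have := ltn_ord i; rewrite {2}n0.
have n1 : 1 <= n%:R :> R by rewrite ler1n.
have A1 := large_sample c0 c2 n1 nA.
have nD : 1 <= n%:R * eps ^+ d.+1.
  apply: le_trans A1 _; rewrite /A ler_piMr// ?mulr_ge0 ?(ltW epsD)//.
  by rewrite exprn_ile1// ltW.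
have A2 : A <= n%:R * eps ^+ d.+1.
  by rewrite /A ler_piMr// ?mulr_ge0 ?(ltW epsD)// exprn_ile1// ltW.
(* Common bound for the three nets. Its square is the fourth power of [eps ^- d.+1], which is at
   most n^4 because n eps^(d+1) >= 1. *)
pose y := (s ^- 4) ^+ d.+1.
have y2 : y ^+ 2 <= n%:R ^+ 4.
  have -> : y ^+ 2 = (eps ^- d.+1) ^+ 4.
    rewrite /y -s2 !exprVn -!exprM; congr (_ ^+ _)^-1.
    by rewrite mulnCA [RHS]mulnCA.
  apply: lerXn2r; rewrite ?nnegrE ?invr_ge0 ?(ltW epsD)//.
  by rewrite -div1r ler_pdivrMr.
have y1 : 1 <= y.
  rewrite exprn_ege1// -[leLHS]invr1 lef_pV2 ?posrE ?exprn_gt0//.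
  by rewrite exprn_ile1// ltW.
have yy : y <= y ^+ 2 by rewrite expr2 ler_peMr// (le_trans ler01).
have dl0 : 0 < n%:R ^+ 2 * expR (- (c * A)) by rewrite mulr_gt0 ?expR_gt0// exprn_gt0// (lt_le_trans ltr01).
have dlE := erefl (n%:R ^+ 2 * expR (- (c * A))).
have AN := absorb_nets c0 c2 c3 n1 (le_trans ler01 y1) y2 yy A0 nA dlE.
have Tr0 y' : Omega y' -> 0 <= rho y' by move=> /r0; apply: le_trans; exact: ltW.
have [E0 [mE0 sE0 PE0]] := samples_distinct iX oO rLO Tr0 r1 rho10 dX bO dl0.
pose a := th * eps / (2 * D); have a0 : 0 < a by rewrite divr_gt0 ?mulr_gt0.
have aD : D * a = th * eps / 2 by rewrite /a; field; rewrite gt_eqF.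
have thb : 0 < th * eps / 2 by rewrite divr_gt0// mulr_gt0.
have [|J1 [y1_ [cJ1 AJ1 nJ1]]] := @net_exists R d
    [set z | Omega z /\ th * eps <= sdist (boundary Omega) z] M (th * eps / 2) M0 thb.
  by move=> x [Ox _]; exact: OM.
have cub j : cube (y1_ j) a `<=` Omega.
  have [Oj Dj] := AJ1 j; move=> q /(cube_enorm (ltW a0)); rewrite -/D aD => qj.
  apply: (sdist_in_domain oO Oj); apply: le_lt_trans qj _; apply: lt_le_trans Dj.
  by move: thb; clear; lra.
have /choice[F1 hF1] := fun j => cube_tail iX oO rLO r0 rho0 r1 rho10 dX a0 (cub j).
have va : (2 * a) ^+ d.+1 = k1 * eps ^+ d.+1.
  by rewrite /k1 -exprMn; congr (_ ^+ _); rewrite /a; field; rewrite gt_eqF.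
have [|E1 [mE1 sE1 PE1]] := @bigU_fin_prob _ _ P J1 F1 (expR (- (c' * A))).
  move=> j; have [mF sF PF] := hF1 j; split => //; apply: le_trans PF _.
  rewrite lee_fin ler_expR lerN2 va.
  apply: (@le_trans _ _ (c' * (n%:R * eps ^+ d.+1))); first by rewrite ler_wpM2l// ltW.
  have -> : n%:R * (rhomin ^+ 2 * (k1 * eps ^+ d.+1) / (64 * rho1)) =
     rhomin ^+ 2 * k1 / (64 * rho1) * (n%:R * eps ^+ d.+1).
    by field; rewrite gt_eqF.
  by rewrite ler_wpM2r ?mulr_ge0 ?(ltW epsD)// ge_min lexx.
have kepsb : 0 < kap * eps by rewrite mulr_gt0.
have [|J2 [y2_ [cJ2 AJ2 nJ2]]] := @net_exists R d
    [set z | Omega z /\ eps <= sdist (boundary Omega) z] M (kap * eps) M0 kepsb.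
  by move=> x [Ox _]; exact: OM.
have [|J3 [y3_ [cJ3 AJ3 nJ3]]] := @net_exists R d [set e | enorm e = 1] 1 kap ltr01 kap0.
  by move=> x /= ->.
have bal j : [set q | enorm (y2_ j - q) < eps] `<=` Omega.
  have [Oj Dj] := AJ2 j; move=> q /= qj.
  by apply: (sdist_in_domain oO Oj); apply: lt_le_trans Dj.
have hk := hC kap (ltW kap0) kap1.
have /choice[F2 hF2] := fun jk : J2 * J3 => kernel_tail iX oO rLO r0 rho0 r1 rho10 dX kP p1
  eps0 kap0 kap1 lam0 (AJ3 jk.2) (bal jk.1) Leps hk.
have [|E2 [mE2 sE2 PE2]] := @bigU_fin_prob _ _ P (J2 * J3)%type F2 (expR (- (c' * A))).
  move=> j; have [mF sF PF] := hF2 j; split => //; apply: le_trans PF _.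
  rewrite lee_fin ler_expR lerN2.
  have -> : n%:R * eps ^+ d.+1 * lam ^+ 2 / (4 * rho1 * 2 ^+ d.+1) =
     1 / (4 * rho1 * 2 ^+ d.+1) * A.
    by rewrite /A mul1r mulrC.
  by rewrite ler_wpM2r// ge_min lexx orbT.
have cs (K h : R) (k : nat) : 0 <= K -> K <= Q - 1 -> (k <= 3)%N -> h = K / s ^+ k ->
    (h + 1) ^+ d.+1 <= y.
  move=> K0 KQ k3 ->; rewrite lerXn2r ?nnegrE ?invr_ge0 ?exprn_ge0 ?addr_ge0 ?divr_ge0 ?exprn_ge0 ?(ltW s0)//.
  by apply: net_size => //; exact: sK.
have N1 : (#|J1|)%:R <= y.
  apply: le_trans cJ1 _; apply: (cs Kc _ 2) => //.
  by rewrite /Kc -/D -s2; field; rewrite !gt_eqF.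
have N2 : (#|J2|)%:R <= y.
  apply: le_trans cJ2 _; apply: (cs Ka _ 3) => //.
  by rewrite /Ka -/D /kap -s2; field; rewrite !gt_eqF.
have N3 : (#|J3|)%:R <= y.
  apply: le_trans cJ3 _; apply: (cs Kb _ 1%N) => //.
  by rewrite /Kb -/D /kap; field; rewrite !gt_eqF.
have mB : measurable (E0 `|` (E1 `|` E2)) by do 2 apply: measurableU => //.
exists (~` (E0 `|` (E1 `|` E2))); split; first exact: measurableC.
  move=> w nw; split.
  - move=> i j ij; apply: contrapT => nij; apply: nw; left; apply: sE0 => /=.
    by exists i, j; split => //; apply/eqP.
  - move=> z Oz Dz; have [j zj] := nJ1 z (conj Oz Dz).
    have [mF sF _] := hF1 j.
    have : ~ F1 j w by move=> Fw; apply: nw; right; left; exact: (sE1 j).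
    have /contra_not/[apply] := sF w; move=> /negP; rewrite -leNgt va.
    have -> : n%:R * (rhomin / 2 * (k1 * eps ^+ d.+1)) = c1 * (n%:R * eps ^+ d.+1).
      by rewrite /c1; ring.
    move=> /le_trans; apply; apply: ler_sum => i _; rewrite indicE ler_nat.
    have [/set_mem|] := boolP (X i w \in cube _ _); last by [].
    move=> /(cube_enorm (ltW a0)); rewrite -/D aD => Xj.
    suff -> : enorm (z - X i w) <= th * eps by [].
    have := enorm_tri z (y1_ j) (X i w); move: Xj zj; clear; lra.
  - move=> z e Oz Dz ee; have [j zj] := nJ2 z (conj Oz Dz).
    have [k ek] := nJ3 e ee; have [mF sF _] := hF2 (j, k).
    have : ~ F2 (j, k) w by move=> Fw; apply: nw; right; right; exact: (sE2 (j, k)).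
    have /contra_not/[apply] := sF w; move=> /negP; rewrite -leNgt /= => H.
    apply: le_trans (_ : _ <= n%:R * eps ^+ d.+1 * ((rho (y2_ j) - `|Lr| * eps) *
      (sg - C0 * kap) - 2 * eta 0 * lam)) _; last first.
      apply: le_trans H _; apply: ler_sum => i _.
      exact: (ktest_transfer kP p1 _ (ltW kap0) eps0 ee zj ek).
    rewrite -[leLHS]mulrA ler_wpM2l//; first by rewrite mulr_ge0// ltW.
    have [Oj _] := AJ2 j.
    have Lz : rho z <= rho (y2_ j) + `|Lr| * eps.
      have := rLO z (y2_ j) (mem_set Oz) (mem_set Oj) => /(le_trans (ler_norm _)).
      have : Lr * enorm (z - y2_ j) <= `|Lr| * (kap * eps).
        apply: (@le_trans _ _ (`|Lr| * enorm (z - y2_ j))); first by rewrite ler_wpM2r// ler_norm.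
        by rewrite ler_wpM2l.
      have : `|Lr| * (kap * eps) <= `|Lr| * (1 * eps) by rewrite ler_wpM2l// ler_wpM2r// ltW.
      by clear; lra.
    have rz := r0 z Oz.
    have g1 : (rho z - 2 * (`|Lr| * eps)) * (sg - C0 * kap) <=
        (rho (y2_ j) - `|Lr| * eps) * (sg - C0 * kap).
      by rewrite ler_wpM2r ?subr_ge0//; move: Lz; clear; lra.
    have Le0 : 0 <= `|Lr| * eps by rewrite mulr_ge0// ltW.
    have g2 : 0 <= 2 * (`|Lr| * eps) * (C0 * kap) by rewrite !mulr_ge0// ltW.
    have g3 : `|Lr| * eps <= rho z * (`|Lr| * s / rhomin).
      rewrite mulrA ler_pdivlMr// -mulrA [leRHS]mulrCA; apply: ler_wpM2l => //.
      by rewrite [leRHS]mulrC; apply: ler_pM => //; exact: ltW.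
    have g4 : eta 0 * lam <= rho z * (eta 0 * lam / rhomin).
      rewrite mulrA ler_pdivlMr// mulrC; apply: ler_wpM2r => //.
      by apply: mulr_ge0; exact: ltW.
    have g5 : sg * (`|Lr| * eps) <= sg * (rho z * (`|Lr| * s / rhomin)).
      by rewrite ler_wpM2l// ltW.
    have g6 : rho z * (C * (s + lam)) >= rho z * (C0 * kap + 2 * (sg * (`|Lr| * s / rhomin)) + 2 * (eta 0 * lam / rhomin)).
      rewrite ler_wpM2l//; first by apply: le_trans rz; exact: ltW.
      have -> : C * (s + lam) = C0 * kap + 2 * (sg * (`|Lr| * s / rhomin)) +
          2 * (eta 0 * lam / rhomin) + ((C0 * b + 2 * `|Lr| * sg / rhomin) * lam +
          2 * eta 0 / rhomin * s).
        by rewrite /C /kap; field; rewrite gt_eqF.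
      rewrite lerDl addr_ge0// !mulr_ge0 ?addr_ge0 ?mulr_ge0 ?invr_ge0 ?(ltW lam0) ?(ltW s0)
        ?(ltW e00) ?(ltW rho0) ?(ltW C00) ?(ltW b0) ?(ltW sg0)//.
    rewrite -/s; move: g1 g2 g3 g4 g5 g6 Le0 rz Lz; clear; lra.
have PB : (P (E0 `|` (E1 `|` E2)) <= (3 * n%:R ^+ 2 * expR (- (c * A)))%:E)%E.
  apply: le_trans (measureU2 P mE0 (measurableU _ _ mE1 mE2)) _.
  apply: (@le_trans _ _ ((n%:R ^+ 2 * expR (- (c * A)))%:E +
     ((y * expR (- (c' * A)))%:E + (y ^+ 2 * expR (- (c' * A)))%:E)))%E; last first.
    by rewrite -!EFinD lee_fin addrA.
  apply: leeD => //; apply: le_trans (measureU2 P mE1 mE2) _; apply: leeD.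
    by apply: le_trans PE1 _; rewrite lee_fin ler_wpM2r// expR_ge0.
  apply: le_trans PE2 _; rewrite lee_fin ler_wpM2r// ?expR_ge0// card_prod natrM expr2.
  by apply: ler_pM.
rewrite probability_setC// EFinB; apply: leeB => //.
Qed.

End sample_event.

(** * Chains along curves *)

Section smooth_paths.
Context {R : realType}.

Lemma is_derive_quadratic (V : normedModType R) (f : R -> V) (t : R) (l : V) (C : R) :
  (forall h, `|f (t + h) - f t - h *: l| <= C * h ^+ 2) -> is_derive t (1 : R) f l.
Proof.
move=> fC.
have H : h^-1 *: (f (h *: (1 : R) + t) - f t) @[h --> 0^'] --> l.
  have C1 : 0 < `|C| + 1 by rewrite ltr_wpDl.
  have CC : C <= `|C| + 1 by apply: le_trans (ler_norm _) _; rewrite lerDl.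
  apply/cvgrPdist_lt => e e0.
  have eC : 0 < e / (`|C| + 1) by rewrite divr_gt0.
  near=> h.
  have h0 : h != 0 by near: h; exact: nbhs_dnbhs_neq.
  have -> : l - h^-1 *: (f (h *: (1 : R) + t) - f t) =
      - (h^-1 *: (f (t + h) - f t - h *: l)).
    rewrite [h *: (1 : R)]mulr1 (addrC h) [in RHS]scalerBr scalerA mulVf// scale1r.
    by rewrite opprB.
  rewrite normrN normrZ normfV.
  have hp : 0 < `|h| by rewrite normr_gt0.
  rewrite mulrC ltr_pdivrMr//; apply: le_lt_trans (fC h) _.
  rewrite -[h ^+ 2]real_normK ?num_real// expr2 mulrA ltr_pM2r//.
  apply: (@le_lt_trans _ _ ((`|C| + 1) * `|h|)); first exact: ler_wpM2r.
  rewrite mulrC -ltr_pdivlMr//; near: h; exact: dnbhs0_lt.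
by apply: DeriveDef; [apply/cvg_ex; exists l|exact: cvg_lim].
Unshelve. all: by end_near.
Qed.

Definition pos2 (t : R) : R := Num.max t 0 ^+ 2.

Lemma maxr0_lip (t s : R) : `|Num.max t 0 - Num.max s 0| <= `|t - s|.
Proof.
have H (a b : R) : a <= b -> `|Num.max a 0 - Num.max b 0| <= `|a - b|.
  move=> ab; rewrite !ler0_norm ?subr_le0//; last by rewrite ge_max !le_max ab lexx orbT.
  have [a0|a0] := leP a 0; have [b0|b0] := leP b 0; lra.
have [|/ltW] := leP t s; first exact: H.
by rewrite distrC (distrC t); exact: H.
Qed.

Lemma pos2_quadratic (t h : R) : `|pos2 (t + h) - pos2 t - h * (2 * Num.max t 0)| <= h ^+ 2.
Proof.
rewrite /pos2 ler_norml; have := sqr_ge0 h; rewrite expr2.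
have [th|th] := leP (t + h) 0; have [t0|t0] := leP t 0; rewrite ?expr2 => h0; apply/andP; split; nra.
Qed.

(** Quadratic spline with the Lipschitz derivative [dstep], rising from 0 to 1 on [0, 1] and
    constant outside: a segment is traversed with zero speed at both ends. *)
Definition step (t : R) : R := 2 * pos2 t - 4 * pos2 (t - 1 / 2) + 2 * pos2 (t - 1).
Definition dstep (t : R) : R :=
  4 * Num.max t 0 - 8 * Num.max (t - 1 / 2) 0 + 4 * Num.max (t - 1) 0.

Lemma step_quadratic (t h : R) : `|step (t + h) - step t - h * dstep t| <= 8 * h ^+ 2.
Proof.
have -> : step (t + h) - step t - h * dstep t =
  2 * (pos2 (t + h) - pos2 t - h * (2 * Num.max t 0)) -
  4 * (pos2 (t - 1 / 2 + h) - pos2 (t - 1 / 2) - h * (2 * Num.max (t - 1 / 2) 0)) +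
  2 * (pos2 (t - 1 + h) - pos2 (t - 1) - h * (2 * Num.max (t - 1) 0)).
  by rewrite /step /dstep !(addrAC t _ h); ring.
have := pos2_quadratic t h; have := pos2_quadratic (t - 1 / 2) h.
have := pos2_quadratic (t - 1) h; rewrite !ler_norml.
by move=> /andP[a1 a2] /andP[b1 b2] /andP[c1' c2']; apply/andP; split; lra.
Qed.

Lemma dstep_lip (t s : R) : `|dstep t - dstep s| <= 16 * `|t - s|.
Proof.
have -> : dstep t - dstep s = 4 * (Num.max t 0 - Num.max s 0) -
  8 * (Num.max (t - 1 / 2) 0 - Num.max (s - 1 / 2) 0) +
  4 * (Num.max (t - 1) 0 - Num.max (s - 1) 0) by rewrite /dstep; ring.
have H (c : R) : `|Num.max (t - c) 0 - Num.max (s - c) 0| <= `|t - s|.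
  apply: le_trans (maxr0_lip _ _) _.
  by rewrite opprB addrA subrK.
have := maxr0_lip t s; have := H (1 / 2); have := H 1; rewrite !ler_norml.
by move=> /andP[a1 a2] /andP[b1 b2] /andP[c1' c2']; apply/andP; split; lra.
Qed.

Lemma step_le0 t : t <= 0 -> step t = 0.
Proof.
move=> t0; rewrite /step /pos2 !(max_idPr _) ?expr0n/= ?mulr0 ?subr0 ?addr0//; lra.
Qed.

Lemma step_ge1 t : 1 <= t -> step t = 1.
Proof.
move=> t1; rewrite /step /pos2 !(max_idPl _); [by field|lra|lra|lra].
Qed.

Lemma step01 t : 0 <= step t <= 1.
Proof.
have [t0|t0] := leP t 0; first by rewrite step_le0// lexx ler01.
have [t1|t1] := leP 1 t; first by rewrite step_ge1// lexx ler01.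
rewrite /step /pos2 (max_idPl (ltW t0)) (max_idPr (_ : t - 1 <= 0)); last lra.
have [th|th] := leP (t - 1 / 2) 0; rewrite !expr2; apply/andP; split; nra.
Qed.

Context {d : nat}.
Implicit Types (x y z a b : 'rV[R]_d) (Omega : set 'rV[R]_d).

(* Being constant before time 0 and after time 1, two such curves from x to y and
   from y to z concatenate as [t |-> g(2t) + k(2t - 1) - y]. *)
Definition flat_path Omega x y := exists (g g' : R -> 'rV[R]_d) (C : R),
  [/\ forall t h, enorm (g (t + h) - g t - h *: g' t) <= C * h ^+ 2,
      forall t s, enorm (g' t - g' s) <= C * `|t - s|,
      forall t, Omega (g t), forall t, t <= 0 -> g t = x &
      forall t, 1 <= t -> g t = y].

Lemma flat_path_segment Omega x y : (forall s, 0 <= s <= 1 -> Omega (x + s *: (y - x))) ->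
  flat_path Omega x y.
Proof.
move=> sO; exists (fun t => x + step t *: (y - x)), (fun t => dstep t *: (y - x)),
  (16 * enorm (y - x)); split.
- move=> t h.
  have -> : x + step (t + h) *: (y - x) - (x + step t *: (y - x)) - h *: (dstep t *: (y - x)) =
      (step (t + h) - step t - h * dstep t) *: (y - x).
    by apply/rowP => i; rewrite !mxE; ring.
  rewrite enormZ; have := step_quadratic t h; have := sqr_ge0 h => h0 /(ler_wpM2r (enorm_ge0 (y - x))).
  have : 0 <= h ^+ 2 * enorm (y - x) by rewrite mulr_ge0.
  lra.
- move=> t s; rewrite -scalerBl enormZ; have := dstep_lip t s => /(ler_wpM2r (enorm_ge0 (y - x))).
  lra.
- by move=> t; apply: sO; exact: step01.
- by move=> t /step_le0 ->; rewrite scale0r addr0.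
- by move=> t /step_ge1 ->; rewrite scale1r addrC subrK.
Qed.

Lemma flat_path_trans Omega x y z :
  flat_path Omega x y -> flat_path Omega y z -> flat_path Omega x z.
Proof.
move=> [g [g' [C [gq gl gO g0 g1]]]] [k [k' [C' [kq kl kO k0 k1]]]].
exists (fun t => g (2 * t) + k (2 * t - 1) - y),
  (fun t => 2 *: g' (2 * t) + 2 *: k' (2 * t - 1)), (4 * (C + C')); split.
- move=> t h; have := gq (2 * t) (2 * h); have := kq (2 * t - 1) (2 * h).
  rewrite -mulrDr (addrAC _ (- 1)) -mulrDr => hk hg.
  have -> : g (2 * (t + h)) + k (2 * (t + h) - 1) - y - (g (2 * t) + k (2 * t - 1) - y) -
      h *: (2 *: g' (2 * t) + 2 *: k' (2 * t - 1)) =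
      (g (2 * (t + h)) - g (2 * t) - (2 * h) *: g' (2 * t)) +
      (k (2 * (t + h) - 1) - k (2 * t - 1) - (2 * h) *: k' (2 * t - 1)).
    by apply/rowP => i; rewrite !mxE; ring.
  apply: le_trans (enormD _ _) _; apply: le_trans (lerD hg hk) _.
  by rewrite le_eqVlt; apply/orP; left; apply/eqP; ring.
- move=> t s; have := gl (2 * t) (2 * s); have := kl (2 * t - 1) (2 * s - 1).
  have -> : 2 * t - 1 - (2 * s - 1) = 2 * (t - s) by ring.
  rewrite -mulrBr normrM (ger0_norm (ler0n _ 2)) => hk hg.
  have -> : 2 *: g' (2 * t) + 2 *: k' (2 * t - 1) - (2 *: g' (2 * s) + 2 *: k' (2 * s - 1)) =
      2 *: (g' (2 * t) - g' (2 * s)) + 2 *: (k' (2 * t - 1) - k' (2 * s - 1)).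
    by apply/rowP => i; rewrite !mxE; ring.
  apply: le_trans (enormD _ _) _; rewrite !enormZ (ger0_norm (ler0n _ 2)); lra.
- move=> t; have [t2|t2] := leP (2 * t) 1.
    by rewrite (k0 (2 * t - 1)) ?addrK//; lra.
  by rewrite (g1 (2 * t)) 1?addrAC ?subrr ?add0r//; exact: ltW.
- by move=> t t0; rewrite k0 ?addrK ?g0//; lra.
- by move=> t t1; rewrite g1 1?addrAC ?subrr ?add0r ?k1//; lra.
Qed.

Lemma flat_path_C1 Omega x y : flat_path Omega x y -> exists g : R -> 'rV[R]_d,
  [/\ C1_curve g, forall t, Omega (g t), g 0 = x & g 1 = y].
Proof.
move=> [g [g' [C [gq gl gO g0 g1]]]].
have dg (t : R) : is_derive t (1 : R) g (g' t).
  apply: (@is_derive_quadratic _ g t (g' t) C) => h.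
  exact: le_trans (mxnorm_le_enorm _) (gq t h).
have g'E : derive1 g = g'.
  by apply/funext => t; rewrite derive1E; apply: (@derive_val _ _ _ _ _ _ _ (dg t)).
exists g; split; [split|by []|exact: g0|exact: g1].
  by move=> t; exact: (@ex_derive _ _ _ _ _ _ _ (dg t)).
rewrite g'E => t; apply/cvgrPdist_lt => e e0.
apply/nbhs_ballP; exists (e / (`|C| + 1)) => [/=|s]; first by rewrite divr_gt0// ltr_wpDl.
rewrite /ball /= => ts; apply: le_lt_trans (mxnorm_le_enorm _) _.
apply: le_lt_trans (gl t s) _.
have C1 : 0 < `|C| + 1 by rewrite ltr_wpDl.
rewrite ltr_pdivlMr// mulrC in ts; apply: le_lt_trans ts; rewrite ler_wpM2r//.
by apply: le_trans (ler_norm _) _; rewrite lerDl.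
Qed.

(** Guarantees that the infimum in [geodist] runs over a nonempty set, so that it is not the default
    0. The points reachable from x form an open and relatively closed subset of Omega. *)
Lemma connected_path Omega x y : open Omega -> connected Omega -> Omega x -> Omega y ->
  exists g : R -> 'rV[R]_d, [/\ C1_curve g, forall t, Omega (g t), g 0 = x & g 1 = y].
Proof.
move=> oO cO Ox Oy; apply: flat_path_C1.
pose A := [set z | Omega z /\ flat_path Omega x z].
have ball_path z w e : Omega z -> (forall q, enorm (z - q) < e -> Omega q) ->
    enorm (z - w) < e -> flat_path Omega z w /\ flat_path Omega w z.
  move=> Oz eO zw; split; apply: flat_path_segment => s /andP[s0 s1]; apply: eO.
    rewrite opprD addrA subrr sub0r enormN enormZ ger0_norm// enormC.
    by apply: le_lt_trans zw; rewrite ler_piMl.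
  have -> : z - (w + s *: (z - w)) = (1 - s) *: (z - w).
    by apply/rowP => i; rewrite !mxE; ring.
  rewrite enormZ ger0_norm ?subr_ge0//.
  by apply: le_lt_trans zw; rewrite ler_piMl//; lra.
have oA : open A.
  apply/open_enormP => z [Oz xz]; have [e e0 eO] := (open_enormP _).1 oO z Oz.
  exists e => // w zw; split; first exact: eO.
  by apply: flat_path_trans xz _; have [] := ball_path z w e Oz eO zw.
suff : A = Omega by move=> AO; have [] : A y by rewrite AO.
apply: cO.
- exists x; split => //; apply: flat_path_segment => s _.
  by rewrite subrr scaler0 addr0.
- by exists A => //; rewrite setIC; apply/esym/setIidl => z [].
exists (closure A); first exact: closed_closure.
apply/seteqP; split => [z [Oz xz]|z [Oz clz]]; first by split => //; exact: subset_closure.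
split => //; have [e e0 eO] := (open_enormP _).1 oO z Oz.
have [w [Ow xw] zw] := (closure_enormP _ _).1 clz e e0.
by apply: flat_path_trans xw _; have [] := ball_path z w e Oz eO zw.
Qed.

End smooth_paths.


(** * Cutting a curve into pieces of equal length *)

Section arclength.
Context {R : realType}.

Lemma antiderivative (F : R -> R) : continuous F ->
  exists Psi : R -> R, (forall t : R, 0 <= t <= 1 -> is_derive t (1 : R) Psi (F t)) /\
    Psi 1 - Psi 0 = \int[lebesgue_measure]_(t in `[0, 1]) F t.
Proof.
move=> cF.
have iF (a b : R) : lebesgue_measure.-integrable `[a, b] (EFin \o F).
  apply: continuous_compact_integrable; first exact: segment_compact.
  exact: continuous_subspaceT.
(* Starting at -1 makes Psi differentiable from both sides at 0. *)
pose Psi x := (\int[lebesgue_measure]_(t in [set` Interval (BLeft (- 1)) (BRight x)]) (F t))%R.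
have dP (t : R) : -1 < t -> is_derive t (1 : R) Psi (F t).
  move=> t1.
  have := @continuous_FTC1 R F (BLeft (- 1)) t (t + 1) _ (iF _ _) _ (cF t).
  case; [by rewrite ltrDl|by rewrite /=|move=> dt tE].
  by apply: DeriveDef; [exact: dt|rewrite -derive1E].
exists Psi; split => [t /andP[t0 _]|]; first by apply: dP; apply: lt_le_trans t0.
have cP (t : R) : -1 < t -> {for t, continuous Psi}.
  move=> /dP dt; apply: differentiable_continuous; apply/derivable1_diffP.
  exact: (@ex_derive _ _ _ _ _ _ _ dt).
rewrite /Rintegral (@continuous_FTC2 R F Psi 0 1 ltr01)//.
- exact: continuous_subspaceT.
- split.
  + move=> t; rewrite in_itv/= => /andP[t0 _].
    have t1 : -1 < t by apply: lt_trans t0.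
    exact: (@ex_derive _ _ _ _ _ _ _ (dP t t1)).
  + by apply: cvg_at_right_filter; apply: cP.
  + by apply: cvg_at_left_filter; apply: cP; apply: lt_trans ltr01.
- move=> t; rewrite in_itv/= => /andP[t0 _].
  have t1 : -1 < t by apply: lt_trans t0.
  by rewrite derive1E; apply: (@derive_val _ _ _ _ _ _ _ (dP t t1)).
Qed.

Lemma derive_ge0_le (f f' : R -> R) (a b : R) : a <= b ->
  (forall t : R, a <= t <= b -> is_derive t (1 : R) f (f' t)) ->
  (forall t, a <= t <= b -> 0 <= f' t) -> f a <= f b.
Proof.
move=> ab df f0.
have cf : {within `[a, b], continuous f}.
  apply: derivable_within_continuous => t; rewrite in_itv/= => tab.
  exact: (@ex_derive _ _ _ _ _ _ _ (df t tab)).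
have [|c cab fE] := MVT_segment ab _ cf (df := f').
  move=> t; rewrite in_itv/= => /andP[ta tb]; apply: df.
  by rewrite !ltW.
rewrite -subr_ge0 fE mulr_ge0 ?subr_ge0//; apply: f0.
by move: cab; rewrite in_itv.
Qed.

Context {d : nat}.
Implicit Types (x y : 'rV[R]_d) (gamma : R -> 'rV[R]_d).

Lemma continuous_edot x : continuous (edot x).
Proof.
apply: (@lipschitz_continuous_enorm _ _ _ (enorm x)) => y z.
by rewrite -edotBr edot_abs_le.
Qed.

Lemma is_derive_edot x gamma (t : R) : derivable gamma t 1 ->
  is_derive t (1 : R) (fun s => edot x (gamma s)) (edot x (derive1 gamma t)).
Proof.
move=> dg.
have H : h^-1 *: (edot x (gamma (h *: (1 : R) + t)) - edot x (gamma t)) @[h --> 0^']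
    --> edot x (derive1 gamma t).
  have -> : (fun h : R => h^-1 *: (edot x (gamma (h *: (1 : R) + t)) - edot x (gamma t))) =
      (fun h : R => edot x (h^-1 *: (gamma (h *: (1 : R) + t) - gamma t))).
    by apply/funext => h; rewrite edotZr edotBr.
  rewrite derive1E; apply: continuous_cvg; first exact: continuous_edot.
  exact: dg.
by apply: DeriveDef; [apply/cvg_ex; eexists; exact: H|exact: cvg_lim].
Qed.

(** Projecting onto the direction of the chord reduces the claim to a monotone real function. *)
Lemma chord_le gamma (Phi : R -> R) (a b : R) : a <= b ->
  (forall t, derivable gamma t 1) ->
  (forall t : R, a <= t <= b -> is_derive t (1 : R) Phi (enorm (derive1 gamma t))) ->
  enorm (gamma b - gamma a) <= Phi b - Phi a.
Proof.
move=> ab dg dP; set v := gamma b - gamma a.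
have [v0|v0] := eqVneq v 0.
  rewrite v0 enorm0 subr_ge0; apply: derive_ge0_le ab dP _ => t _; exact: enorm_ge0.
pose e := (enorm v)^-1 *: v.
have ev : edot e v = enorm v.
  rewrite edotZl -sqr_enorm expr2 mulrA mulVf ?mul1r// enorm_eq0//.
have e1 : enorm e = 1 by exact: enorm_dirE.
have := @derive_ge0_le (fun t => Phi t - edot e (gamma t))
  (fun t => enorm (derive1 gamma t) - edot e (derive1 gamma t)) a b ab.
have -> : Phi a - edot e (gamma a) <= Phi b - edot e (gamma b) =
    (enorm v <= Phi b - Phi a).
  by rewrite -ev edotBr; apply/idP/idP; lra.
apply => t tab.
  by apply: is_deriveB; [exact: dP|exact: is_derive_edot].
rewrite subr_ge0; apply: le_trans (edot_le _ _) _.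
by rewrite e1 mul1r.
Qed.

(** The division times are preimages under arclength of the multiples of L / m. On each piece g
    changes at most by the factor 1 + c L / m, so [(1 + c * h) * Psi - g (zeta k) * Phi] is
    nondecreasing there, where Psi and Phi are the weighted and the plain arclength. *)
Lemma arclength_chain (A : set 'rV[R]_d) (g : 'rV[R]_d -> R) (c G : R) gamma (m : nat) :
  C1_curve gamma -> (forall t, 0 <= t <= 1 -> A (gamma t)) ->
  0 <= c -> (forall a, A a -> 0 <= g a <= G) ->
  (forall a b, A a -> A b -> g a <= (1 + c * enorm (a - b)) * g b) ->
  (0 < m)%N ->
  let L := \int[lebesgue_measure]_(t in `[0, 1]) enorm (derive1 gamma t) in
  exists zeta : nat -> 'rV[R]_d,
   [/\ zeta 0%N = gamma 0, zeta m = gamma 1, (forall k, A (zeta k)),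
       (forall k, (k < m)%N -> enorm (zeta k - zeta k.+1) <= L / m%:R) &
       \sum_(k < m) g (zeta k) * (L / m%:R) <= (1 + c * (L / m%:R)) *
         \int[lebesgue_measure]_(t in `[0, 1]) (g (gamma t) * enorm (derive1 gamma t))].
Proof.
move=> [dgam cgam] Agam c0 g0 gr m0 L.
have cs : continuous (fun t => enorm (derive1 gamma t)).
  by move=> t; apply: continuous_comp; [exact: cgam|exact: continuous_enorm].
have [Phi [dPhi PhiL]] := antiderivative cs.
(* The curve is known to stay in A only for times in [0, 1], while [antiderivative] wants an
   integrand continuous on R; hence the clamped time. *)
pose cl (t : R) := Num.max 0 (Num.min 1 t).
have cl01 t : 0 <= cl t <= 1.
  by rewrite /cl le_max lexx/= ge_max ler01 ge_min lexx.
have clE t : 0 <= t <= 1 -> cl t = t.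
  by move=> /andP[t0 t1]; rewrite /cl (min_idPr t1) (max_idPr t0).
have ccl : continuous cl.
  move=> t; apply: continuous_max; first exact: cst_continuous.
  by apply: continuous_min; [exact: cst_continuous|exact: cvg_id].
have cgc : continuous (gamma \o cl).
  move=> t; apply: continuous_comp; first exact: ccl.
  by apply: differentiable_continuous; apply/derivable1_diffP.
have glip a b : A a -> A b -> `|g a - g b| <= c * G * enorm (a - b).
  move=> Aa Ab; have h1 := gr a b Aa Ab; have h2 := gr b a Ab Aa.
  have /andP[ga0 ga1] := g0 _ Aa; have /andP[gb0 gb1] := g0 _ Ab.
  rewrite (enormC b) in h2; move: (enorm_ge0 (a - b)) h1 h2; move: (enorm (a - b)) => q q0 h1 h2.
  have h3 : c * q * g b <= c * q * G by rewrite ler_wpM2l ?mulr_ge0.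
  have h4 : c * q * g a <= c * q * G by rewrite ler_wpM2l ?mulr_ge0.
  by rewrite ler_norml; apply/andP; split; lra.
have cgg : continuous (fun t => g (gamma (cl t))).
  move=> t; apply/cvgrPdist_lt => e e0.
  have q1 : 0 < `|c * G| + 1 by rewrite ltr_wpDl.
  have eq : 0 < e / (`|c * G| + 1) by rewrite divr_gt0.
  have := continuous_comp (cgc t) (@continuous_enormB _ _ (gamma (cl t)) _) => ct.
  have /cvgrPdist_lt/(_ _ eq) := ct.
  rewrite /= subrr enorm0; apply: filterS => s.
  rewrite sub0r normrN ger0_norm// ltr_pdivlMr// mulrC => hs.
  apply: le_lt_trans (glip _ _ (Agam _ (cl01 _)) (Agam _ (cl01 _))) _.
  apply: le_lt_trans hs; rewrite ler_wpM2r//.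
  by apply: le_trans (ler_norm _) _; rewrite lerDl.
have [Psi [dPsi PsiI]] := antiderivative (fun t => cvgM (cgg t) (cs t)).
have IE : \int[lebesgue_measure]_(t in `[0, 1]) (g (gamma t) * enorm (derive1 gamma t)) =
    Psi 1 - Psi 0.
  rewrite PsiI; apply: eq_Rintegral => t; rewrite inE/= in_itv/= => t01.
  by rewrite /= (clE _ t01).
have m0' : 0 < m%:R :> R by rewrite ltr0n.
have L0 : 0 <= L.
  rewrite /L -PhiL; rewrite subr_ge0; apply: derive_ge0_le ler01 dPhi _ => t _; exact: enorm_ge0.
have Pmono a b : 0 <= a -> a <= b -> b <= 1 -> Phi a <= Phi b.
  move=> a0 ab b1; apply: (@derive_ge0_le Phi (fun t => enorm (derive1 gamma t)) a b ab).
    by move=> t /andP[at_ tb]; apply: dPhi; rewrite (le_trans a0 at_) (le_trans tb b1).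
  by move=> t _; exact: enorm_ge0.
have P1E : Phi 1 = Phi 0 + L by rewrite /L -PhiL addrC subrK.
(* Arclength need not be injective, so the times 0 and 1 are imposed at the two ends. *)
have ex k : exists t : R, [/\ 0 <= t <= 1, (k = 0%N -> t = 0), (k = m -> t = 1) &
    ((k <= m)%N -> Phi t = Phi 0 + k%:R * (L / m%:R))].
  have [k0|k0] := posnP k.
    by exists 0; split; rewrite ?lexx ?ler01// k0 ?mul0r ?addr0// => mE; rewrite -mE in m0.
  have [km|mk] := ltnP k m; last first.
    exists 1; split; rewrite ?lexx ?ler01//; first by move=> k0'; rewrite k0' in k0.
    move=> km; have -> : k = m by apply/eqP; rewrite eqn_leq km mk.
    by rewrite mulrCA divff ?mulr1// gt_eqF.
  have [||t t01 tE] := @IVT R Phi 0 1 (Phi 0 + k%:R * (L / m%:R)) ler01.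
  - apply: derivable_within_continuous => t; rewrite in_itv/= => t01.
    exact: (@ex_derive _ _ _ _ _ _ _ (dPhi t t01)).
  - rewrite P1E (min_idPl _) ?lerDl// (max_idPr _) ?lerDl// lerD2l.
    rewrite mulr_ge0 ?divr_ge0//= mulrA ler_pdivrMr// mulrC ler_wpM2l// ler_nat.
    exact: ltnW.
  exists t; split.
  - by move: t01; rewrite in_itv/=.
  - by move=> k0'; rewrite k0' in k0.
  - by move=> kE; rewrite kE ltnn in km.
  - by [].
have [tau tauP] := choice ex.
have tau01 k : 0 <= tau k <= 1 by have [] := tauP k.
have PhiS k : (k < m)%N -> Phi (tau k.+1) - Phi (tau k) = L / m%:R.
  move=> km; have [_ _ _ /(_ km) ->] := tauP k.+1.
  have [_ _ _ /(_ (ltnW km)) ->] := tauP k.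
  by rewrite -[k.+1]addn1 natrD; ring.
have tauS k : (k < m)%N -> 0 < L -> tau k <= tau k.+1.
  move=> km L1; rewrite leNgt; apply/negP => /ltW ts.
  have /andP[a0 a1] := tau01 k; have /andP[b0 b1] := tau01 k.+1.
  have := PhiS k km; have : Phi (tau k.+1) <= Phi (tau k).
    exact: Pmono.
  have : 0 < L / m%:R by rewrite divr_gt0.
  lra.
have piece k : (k < m)%N -> 0 < L -> forall t, tau k <= t <= tau k.+1 ->
    enorm (gamma t - gamma (tau k)) <= L / m%:R.
  move=> km L1 t /andP[kt tk]; have /andP[a0 a1] := tau01 k; have /andP[b0 b1] := tau01 k.+1.
  apply: (@le_trans _ _ (Phi t - Phi (tau k))).
    apply: chord_le => // s /andP[ks st]; apply: dPhi.
    by rewrite (le_trans a0 ks) (le_trans st (le_trans tk b1)).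
  rewrite -(PhiS k km) lerD2r; apply: Pmono => //; exact: le_trans a0 kt.
have L_eq0 : L = 0 -> gamma 0 = gamma 1.
  move=> LE; apply/esym/eqP; rewrite -subr_eq0 -enorm_eq0 eq_le enorm_ge0 andbT.
  by have := chord_le ler01 dgam dPhi; rewrite PhiL -/L LE.
(* For L = 0 all arclength values coincide and the times need not be ordered; a constant chain
   serves. *)
have [L1|L1] := ltP 0 L; last first.
  have LE : L = 0 by apply/eqP; rewrite eq_le L1 L0.
  exists (fun _ => gamma 0); split => //.
  - by rewrite L_eq0.
  - by move=> _; apply: Agam; rewrite lexx ler01.
  - by move=> k _; rewrite subrr enorm0 LE mul0r.
  - rewrite LE !mul0r big1 => [|k _]; last by rewrite mulr0.
    rewrite mulr0 addr0 mul1r.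
    apply: Rintegral_ge0 => t /=; rewrite in_itv/= => t01.
    by rewrite mulr_ge0//; have /andP[] := g0 _ (Agam t t01).
exists (fun k => gamma (tau k)); split.
- by have [_ -> //] := tauP 0%N.
- by have [_ _ -> //] := tauP m.
- by move=> k; exact: Agam.
- move=> k km; rewrite enormC; apply: piece => //; rewrite lexx andbT; exact: tauS.
rewrite IE.
have -> : Psi 1 - Psi 0 = \sum_(k < m) (Psi (tau k.+1) - Psi (tau k)).
  rewrite -(big_mkord xpredT (fun k => Psi (tau k.+1) - Psi (tau k))) telescope_sumr//.
  by have [_ -> // _ _] := tauP 0%N; have [_ _ -> // _] := tauP m.
rewrite mulr_sumr; apply: ler_sum => k _.
set h := L / m%:R; have km := ltn_ord k.
have h0 : 0 <= h by rewrite divr_ge0.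
have /andP[a0 a1] := tau01 k; have /andP[b0 b1] := tau01 k.+1.
have t01 t : tau k <= t <= tau k.+1 -> 0 <= t <= 1.
  by move=> /andP[kt tk]; rewrite (le_trans a0 kt) (le_trans tk b1).
rewrite -[X in _ * X](PhiS k km).
have := @derive_ge0_le (fun t => (1 + c * h) * Psi t - g (gamma (tau k)) * Phi t)
  (fun t => (1 + c * h) * (g (gamma (cl t)) * enorm (derive1 gamma t)) -
     g (gamma (tau k)) * enorm (derive1 gamma t)) _ _ (tauS k km L1).
move=> H; have {}H : (1 + c * h) * Psi (tau k) - g (gamma (tau k)) * Phi (tau k) <=
    (1 + c * h) * Psi (tau k.+1) - g (gamma (tau k)) * Phi (tau k.+1).
  apply: H => t tk; last first.
    rewrite (clE _ (t01 _ tk)) mulrA -mulrBl mulr_ge0 ?enorm_ge0// subr_ge0.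
    apply: le_trans (gr _ _ (Agam _ (tau01 k)) (Agam _ (t01 _ tk))) _.
    have /andP[ga0 _] := g0 _ (Agam _ (t01 _ tk)).
    rewrite ler_wpM2r// lerD2l ler_wpM2l// enormC; exact: piece.
  apply: is_deriveB.
    by apply: is_deriveZ; apply: dPsi; exact: t01.
  by apply: is_deriveZ; apply: dPhi; exact: t01.
by move: H; rewrite !mulrBr; lra.
Qed.
End arclength.

(** * Chains at a positive distance from the boundary *)

Section pushed_chains.
Context {R : realType} {d : nat}.
Implicit Types (x y z a b : 'rV[R]_d) (g : 'rV[R]_d -> R).
Variables (Omega : set 'rV[R]_d) (r : R).
Hypotheses (oO : open Omega) (C11O : C11_boundary Omega) (r0 : 0 < r)
  (rO : reach (boundary Omega) = r%:E).
Local Notation D := (sdist (boundary Omega)).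

(** The division points may lie on the boundary, where [push_exists] does not apply; they are first
    moved by at most mu into Omega and then pushed. The steps grow as in [push_lipschitz], which is
    the factor on the left of the last inequality; y is deep enough to stay fixed. *)
Lemma pushed_chain g (c G : R) gamma z y (delta h0 nu : R) :
  0 <= c -> (forall a, closure Omega a -> 0 <= g a <= G) ->
  (forall a b, closure Omega a -> closure Omega b -> g a <= (1 + c * enorm (a - b)) * g b) ->
  C1_curve gamma -> (forall t, 0 <= t <= 1 -> closure Omega (gamma t)) ->
  gamma 0 = z -> gamma 1 = y -> Omega z -> Omega y ->
  0 < delta -> 2 * delta <= r -> delta <= D y -> 0 < h0 -> 0 < nu ->
  exists (m : nat) (h : R) (a : nat -> 'rV[R]_d),
    [/\ 0 < h, h <= h0, a m = y /\ enorm (z - a 0%N) <= delta,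
      forall k, Omega (a k) /\ delta <= D (a k) &
      [/\ forall k, (k < m)%N -> enorm (a k - a k.+1) <= h,
      m%:R * h0 <= 4 * \int[lebesgue_measure]_(t in `[0, 1]) enorm (derive1 gamma t) + h0 &
      (1 - delta / r) * (\sum_(k < m) g (a k) * h) <= (1 + c * (delta + h0)) ^+ 2 *
       (\int[lebesgue_measure]_(t in `[0, 1]) (g (gamma t) * enorm (derive1 gamma t)) + nu)]].
Proof.
move=> c0 g0 gr gC1 gO gam0 gam1 Oz Oy d0 dr dy h00 nu0.
set L := Rintegral _ _ _; set I := Rintegral _ _ _.
have L0 : 0 <= L by apply: Rintegral_ge0 => t _; exact: enorm_ge0.
have I0 : 0 <= I.
  apply: Rintegral_ge0 => t /=; rewrite in_itv/= => t01.
  by rewrite mulr_ge0//; have /andP[] := g0 _ (gO t t01).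
(* The 4 leaves room for the displacement 2 mu and for 1 / (1 - delta / r) <= 2 while keeping h <=
   h0; the successor keeps m positive. *)
pose m := (Num.truncn (4 * L / h0)).+1.
have q0 : 0 <= 4 * L / h0 by rewrite divr_ge0 ?mulr_ge0// ltW.
have /andP[m1 m2] := truncn_itv q0.
have m0 : 0 < m%:R :> R by rewrite ltr0n.
have Lm : L / m%:R <= h0 / 4.
  by move: m2; rewrite ler_pdivrMr// ltr_pdivrMr// -/m => m2; lra.
have [zeta [z0 zm zO zs zI]] := arclength_chain gC1 gO c0 g0 gr (ltn0Sn _ : (0 < m)%N).
rewrite -/L -/I in zs zI.
have G0 : 0 <= G by have /andP[a1 a2] := g0 _ (subset_closure Oz); exact: le_trans a1 a2.
(* The second bound keeps the cost [2 * mu * (m%:R * G)] of the displacement below nu. *)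
pose mu := Num.min (h0 / 8) (nu / (2 * m%:R * (G + 1))).
have mu0 : 0 < mu by rewrite lt_min !divr_gt0// !mulr_gt0// ltr_wpDl.
have mu1 : mu <= h0 / 8 by rewrite ge_min lexx.
have mu2 : 2 * mu * (m%:R * G) <= nu.
  have : mu <= nu / (2 * m%:R * (G + 1)) by rewrite ge_min lexx orbT.
  rewrite ler_pdivlMr; last by rewrite !mulr_gt0// ltr_wpDl.
  have : 0 <= mu * m%:R by rewrite mulr_ge0// ltW.
  nra.
have dr1 : delta / r <= 1 / 2 by rewrite ler_pdivrMr//; lra.
have dlt : delta < r by lra.
have q1 : 0 < 1 - delta / r by lra.
have exk k : exists b, [/\ Omega b, enorm (zeta k - b) <= mu, k = 0%N -> b = z & k = m -> b = y].
  have [k0|k0] := posnP k.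
    by exists z; rewrite k0 z0 gam0 subrr enorm0; split => //; exact: ltW.
  have [km|km] := eqVneq k m.
    exists y; rewrite km zm gam1 subrr enorm0; split => //; exact: ltW.
  have [b Ob zb] := (closure_enormP _ _).1 (zO k) mu mu0.
  exists b; split => //; first exact: ltW.
    by move=> k0'; rewrite k0' in k0.
  by move=> km'; rewrite km' eqxx in km.
have [b bP] := choice exk.
have Ob k : Omega (b k) by have [] := bP k.
have [a aP] := choice (fun k => push_exists oO C11O r0 rO (Ob k) d0 dlt).
pose h := (L / m%:R + 2 * mu) / (1 - delta / r).
have Lm0 : 0 <= L / m%:R by rewrite divr_ge0.
have hp : 0 < L / m%:R + 2 * mu by lra.
have h_gt0 : 0 < h by rewrite divr_gt0.
have za k : enorm (zeta k - a k) <= delta + mu.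
  have [_ zb _ _] := bP k; have [_ _ ba _ _] := aP k.
  by apply: le_trans (enorm_tri _ (b k) _) _; lra.
exists m, h, a; split => //.
- rewrite ler_pdivrMr//; move: q1 dr1 Lm mu1 h00; move: (L / m%:R) (delta / r) => v w; nra.
- split.
    have [_ _ _ /(_ erefl) bm] := bP m; have [_ _ _ am _] := aP m.
    by rewrite am bm.
  by have [_ _ /(_ erefl) bm _] := bP 0%N; have [_ _ am _ _] := aP 0%N; rewrite -bm.
- by move=> k; have [] := aP k.
split.
- move=> k km; rewrite ler_pdivlMr// mulrC.
  have [Oa da _ _ /(_ (a k.+1)) ak] := aP k; have [Oa' da' _ _ /(_ (a k)) ak'] := aP k.+1.
  apply: le_trans (push_lipschitz r0 d0 dlt (ak Oa' da') (ak' Oa da)) _.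
  have [_ zb _ _] := bP k; have [_ zb' _ _] := bP k.+1.
  have := enorm_tri (b k) (zeta k) (b k.+1); have := enorm_tri (zeta k) (zeta k.+1) (b k.+1).
  have := zs k km; rewrite (enormC (b k) (zeta k)); lra.
- have -> : m%:R = (Num.truncn (4 * L / h0))%:R + 1 :> R by rewrite natr1.
  by rewrite mulrDl mul1r lerD2r -ler_pdivlMr.
have cO k : closure Omega (a k) by apply: subset_closure; have [] := aP k.
set q := 1 + c * (delta + h0).
have q_ge1 : 1 <= q by rewrite lerDl mulr_ge0// addr_ge0// ltW.
rewrite -mulr_suml mulrCA /h [(1 - delta / r) * _]mulrC divfK ?gt_eqF//.
have ga k : g (a k) <= q * g (zeta k).
  apply: le_trans (gr _ _ (cO k) (zO k)) _.
  have /andP[gz0 _] := g0 _ (zO k).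
  rewrite ler_wpM2r// lerD2l ler_wpM2l// enormC; apply: le_trans (za k) _; lra.
apply: (@le_trans _ _ ((\sum_(k < m) q * g (zeta k)) * (L / m%:R + 2 * mu))).
  by apply: ler_wpM2r; [exact: ltW|apply: ler_sum => k _; exact: ga].
rewrite -mulr_sumr -mulrA expr2 -mulrA ler_pM2l; last by apply: lt_le_trans ltr01 _.
rewrite mulrDr mulr_suml.
have gs : \sum_(k < m) g (zeta k) <= m%:R * G.
  apply: le_trans (_ : \sum_(k < m) G <= _); first by apply: ler_sum => k _; have /andP[] := g0 _ (zO k).
  by rewrite sumr_const card_ord mulr_natl.
have e2 : (\sum_(k < m) g (zeta k)) * (2 * mu) <= nu.
  by apply: le_trans mu2; rewrite mulrC ler_wpM2l//; lra.
apply: le_trans (lerD zI e2) _.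
have cL : c * (L / m%:R) <= c * (delta + h0) by rewrite ler_wpM2l//; lra.
have := ler_wpM2r I0 cL; rewrite /q; move: cL q_ge1; rewrite /q; move: (c * (L / m%:R)) (c * (delta + h0)) => v w; nra.
Qed.

End pushed_chains.

Section geodesics.
Context {R : realType} {d : nat}.
Implicit Types (x y z a b : 'rV[R]_d) (g : 'rV[R]_d -> R).
Variables (Omega : set 'rV[R]_d).
Hypotheses (oO : open Omega) (cO : connected Omega).

Definition admissible x y gamma := [/\ C1_curve gamma,
  forall t, 0 <= t <= 1 -> closure Omega (gamma t), gamma 0 = x & gamma 1 = y].

Lemma geodist_curve g x y (nu : R) : Omega x -> Omega y -> 0 < nu -> exists2 gamma,
  admissible x y gamma &
  \int[lebesgue_measure]_(t in `[0, 1]) (g (gamma t) * enorm (derive1 gamma t)) <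
    geodist Omega g x y + nu.
Proof.
move=> Ox Oy nu0; have [gam [gC1 gO g0 g1]] := connected_path oO cO Ox Oy.
set E := [set Rintegral lebesgue_measure `[0, 1]%classic
  (fun t => g (gamma t) * enorm (derive1 gamma t)) | gamma in admissible x y].
have E0 : E !=set0.
  by eexists; exists gam => //; split => // t _; exact: subset_closure.
have : inf E < inf E + nu by rewrite ltrDl.
by move=> /(inf_lt E0)[_ [gamma gP <-]] gl; exists gamma.
Qed.

Lemma geodist_ge0 g x y : (forall a, closure Omega a -> 0 <= g a) ->
  Omega x -> Omega y -> 0 <= geodist Omega g x y.
Proof.
move=> g0 Ox Oy; have [gam [gC1 gO gam0 gam1]] := connected_path oO cO Ox Oy.
apply: lb_le_inf.
  by eexists; exists gam => //; split => // t _; exact: subset_closure.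
apply/lbP => _ [k [kC1 kO _ _] <-]; apply: Rintegral_ge0 => t /=.
by rewrite in_itv/= => t01; rewrite mulr_ge0 ?enorm_ge0// g0//; exact: kO.
Qed.

Lemma geodist_le_diam (diam : R) x y : geodiam Omega = diam%:E -> Omega x -> Omega y ->
  geodist Omega (cst 1) x y <= diam.
Proof.
move=> dE Ox Oy; rewrite -lee_fin -dE; apply: ereal_sup_ubound.
by exists x; [exact: subset_closure|exists y => //; exact: subset_closure].
Qed.

Lemma length_curve (diam : R) x y : geodiam Omega = diam%:E -> Omega x -> Omega y ->
  exists2 gamma, admissible x y gamma &
    \int[lebesgue_measure]_(t in `[0, 1]) enorm (derive1 gamma t) <= diam + 1.
Proof.
move=> dE Ox Oy; have [gamma gP gl] := geodist_curve (cst 1) Ox Oy ltr01.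
exists gamma => //; apply: le_trans (_ : geodist Omega (cst 1) x y + 1 <= _); last first.
  by rewrite lerD2r; exact: geodist_le_diam.
apply: le_trans (ltW gl); rewrite le_eqVlt; apply/orP; left; apply/eqP.
by apply: eq_Rintegral => t _; rewrite mul1r.
Qed.

End geodesics.

(** * Subsolutions of the graph equation *)

Section perron.
Context {R : realType} {n : nat}.
Variables (w : 'I_n -> 'I_n -> R) (p : R) (F : 'I_n -> R) (G : 'I_n -> Prop).
Hypotheses (w0 : forall i j, 0 <= w i j) (p1 : 1 <= p) (F0 : forall i, 0 <= F i).
Implicit Types v : 'I_n -> R.

Definition upwind v i := \sum_j w i j * Num.max (v i - v j) 0 `^ p.

Definition subsolution v :=
  (forall i, G i -> v i <= 0) /\ (forall i, ~ G i -> upwind v i <= F i).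

Let p0 : 0 <= p := le_trans ler01 p1.

Lemma pospow_le (a b : R) : a <= b -> Num.max a 0 `^ p <= Num.max b 0 `^ p.
Proof.
move=> ab; apply: ler_powR2 => //; first by rewrite le_max lexx orbT.
by rewrite ge_max !le_max ab lexx orbT.
Qed.

(** [powR_sub_le] rescaled by K: a one-sided Lipschitz bound for arguments up to K, which is the
    continuity that Perron's method needs. *)
Lemma pospow_lip (K a e : R) : 0 < K -> a <= K -> 0 <= e ->
  Num.max a 0 `^ p <= Num.max (a - e) 0 `^ p + p * K `^ p / K * e.
Proof.
move=> K0 aK e0; have [a0|a0] := leP a 0.
  rewrite powR0; last by rewrite gt_eqF// (lt_le_trans ltr01 p1).
  by rewrite addr_ge0 ?powR_ge0// mulr_ge0// divr_ge0 ?mulr_ge0 ?powR_ge0// ltW.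
have h1 : 0 <= a / K by rewrite divr_ge0// ltW.
have h2 : a / K <= 1 by rewrite ler_pdivrMr// mul1r.
have h3 : 0 <= e / K by rewrite divr_ge0// ltW.
have := powR_sub_le p1 h1 h2 h3.
have Ki : 0 <= K^-1 by rewrite invr_ge0 ltW.
have m0 : 0 <= Num.max (a - e) 0 by rewrite le_max lexx orbT.
rewrite -mulrBl -[X in Num.max _ X](mul0r K^-1) -maxr_pMl//.
rewrite !(powRM _ _ Ki)// ?(ltW a0)//.
have Kp : 0 < K `^ p by rewrite powR_gt0.
have KK : K^-1 `^ p * K `^ p = 1.
  by rewrite -powRM ?(ltW K0)// mulVf ?powR1// gt_eqF.
move=> /(ler_wpM2r (ltW Kp)); rewrite mulrDl -!mulrA KK !mulr1 => H.
by apply: le_trans H _; rewrite lerD2l !mulrA le_eqVlt; apply/orP; left; apply/eqP; ring.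
Qed.

(** Take the pointwise supremum V of the subsolutions. The operator is nondecreasing in the value at
    i and nonincreasing in the others, so V is a subsolution; at a point of strict inequality,
    raising V there alone by a small e would give a larger one. *)
Lemma perron (Bd : R) : (forall v, subsolution v -> forall i, v i <= Bd) ->
  exists v, (forall i, G i -> v i = 0) /\ (forall i, ~ G i -> upwind v i = F i).
Proof.
move=> bd.
have sub0 : subsolution (fun _ => 0).
  split => // i _; rewrite /upwind big1// => j _.
  by rewrite subrr maxxx powR0 ?mulr0// gt_eqF// (lt_le_trans ltr01 p1).
pose E i := [set v i | v in subsolution].
have E0 i : E i !=set0 by exists 0; exists (fun _ => 0).
have Eub i : has_ubound (E i) by exists Bd; apply/ubP => _ [v sv <-]; exact: bd.
pose V i := sup (E i).
have leV v i : subsolution v -> v i <= V i.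
  by move=> sv; apply: ub_le_sup => //; exists v.
have V0 i : 0 <= V i by exact: (leV _ i sub0).
have VB i : V i <= Bd by apply: ge_sup => // _ [v sv <-]; exact: bd.
pose H i s := \sum_j w i j * Num.max (s - V j) 0 `^ p.
pose K := Num.max Bd 0 + 1.
have K0 : 0 < K by rewrite /K ltr_wpDl// le_max lexx orbT.
have BK : Bd + 1 <= K by rewrite /K lerD2r le_max lexx.
pose L i := \sum_j w i j * (p * K `^ p / K).
have L0 i : 0 <= L i.
  by apply: sumr_ge0 => j _; rewrite mulr_ge0// divr_ge0 ?mulr_ge0 ?powR_ge0// ltW.
have HL i s e : s <= Bd + 1 -> 0 <= e -> H i s <= H i (s - e) + L i * e.
  move=> sB e0; rewrite /H /L mulr_suml -big_split/=; apply: ler_sum => j _.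
  rewrite -mulrA -mulrDr ler_wpM2l// addrAC; apply: pospow_lip => //.
  by have := V0 j; lra.
have VG i : G i -> V i <= 0.
  by move=> Gi; apply: ge_sup => // _ [v [vG _] <-]; exact: vG.
have VF i : ~ G i -> upwind V i <= F i.
  move=> Gi; apply/ler_addgt0Pr => e e0; rewrite -[upwind V i]/(H i (V i)).
  pose e1 := e / (L i + 1).
  have L1 : 0 < L i + 1 by rewrite ltr_wpDl.
  have e10 : 0 < e1 by rewrite divr_gt0.
  have [_ [v sv <-] vV] := sup_adherent e10 (conj (E0 i) (Eub i)).
  have [_ vF] := sv.
  have VB1 : V i <= Bd + 1 by have := VB i; lra.
  apply: le_trans (HL i (V i) e1 VB1 (ltW e10)) _; apply: lerD.
    apply: le_trans (vF _ Gi); apply: ler_sum => j _; rewrite ler_wpM2l//.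
    apply: pospow_le; apply: lerB; [exact: ltW|exact: leV].
  by rewrite /e1 mulrCA ger_pMr// ler_pdivrMr// mul1r lerDl.
have sV : subsolution V by split.
exists V; split => i Gi; first by apply/eqP; rewrite eq_le V0 VG.
apply/eqP; rewrite eq_le VF//= leNgt; apply/negP => lt.
pose e := Num.min 1 ((F i - upwind V i) / (L i + 1)).
have L1 : 0 < L i + 1 by rewrite ltr_wpDl.
have e0 : 0 < e by rewrite lt_min ltr01 divr_gt0// subr_gt0.
pose V' j := if j == i then V i + e else V j.
have VV' j : V j <= V' j.
  by rewrite /V'; case: eqP => [->|//]; rewrite lerDl ltW.
have : subsolution V'.
  split => j Gj.
    by rewrite /V'; case: eqP => [jE|_]; [rewrite jE in Gj|exact: VG].
  have [->|ji] := eqVneq j i; last first.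
    apply: le_trans (VF _ Gj); apply: ler_sum => k _; rewrite ler_wpM2l//.
    by apply: pospow_le; rewrite {1}/V' (negbTE ji) lerB.
  have : upwind V' i <= H i (V i + e).
    apply: ler_sum => k _; rewrite ler_wpM2l//.
    by apply: pospow_le; rewrite {1}/V' eqxx lerB.
  have Ve : V i + e <= Bd + 1 by apply: lerD => //; rewrite ge_min lexx.
  move=> /le_trans; apply; apply: le_trans (HL i (V i + e) e Ve (ltW e0)) _.
  rewrite addrK -[H i (V i)]/(upwind V i) -lerBrDl.
  have : e <= (F i - upwind V i) / (L i + 1) by rewrite ge_min lexx orbT.
  rewrite ler_pdivlMr// => he; apply: le_trans he; rewrite mulrC ler_wpM2l ?ltW//.
  lra.
by move=> /(leV _ i); rewrite /V' eqxx leNgt ltrDl e0.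
Qed.

End perron.

(** * Bounds for subsolutions on the sample *)

Section graph_bounds.
Context {R : realType} {d : nat}.
Variables (eta : R -> R) (p eps : R) (n : nat) (X : 'I_n -> 'rV[R]_d.+1).
Hypotheses (kP : kernel_profile (d := d) eta) (p1 : 1 <= p) (eps0 : 0 < eps).
Local Notation sig := (sigma_p (d := d) eta p).
Implicit Types (v : 'I_n -> R) (u : 'rV[R]_d.+1 -> R) (z : 'rV[R]_d.+1).

Let p_gt0 : 0 < p := lt_le_trans ltr01 p1.
Let p0 : 0 <= p := ltW p_gt0.

Definition gweight (i j : 'I_n) : R := eta (enorm (X i - X j) / eps).

Local Notation op := (upwind gweight p).

Lemma gweight_ge0 i j : 0 <= gweight i j.
Proof. by apply: kernel_ge0 kP _ _; rewrite divr_ge0// ltW. Qed.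

Lemma gweight_ge t0 i j : enorm (X i - X j) <= t0 * eps -> eta t0 <= gweight i j.
Proof.
move=> ij; apply: kernel_nincr kP _ _ _ _; first by rewrite divr_ge0// ltW.
by rewrite ler_pdivrMr.
Qed.

Lemma pospow_root (a b x : R) : 0 < a -> 0 <= b -> a * Num.max x 0 `^ p <= b ->
  x <= (b / a) `^ p^-1.
Proof.
move=> a0 b0; rewrite mulrC -ler_pdivlMr// => h.
have m0 : 0 <= Num.max x 0 by rewrite le_max lexx orbT.
have pi : 0 <= p^-1 by rewrite invr_ge0.
have := ler_powR2 pi (powR_ge0 _ _) h.
rewrite -powRrM divff ?gt_eqF// powRr1//; apply: le_trans.
by rewrite le_max lexx.
Qed.

Lemma graph_op_upwind u i : injective X ->
  graph_op n eta p eps (range X) u (X i) =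
  (n%:R * eps ^+ d.+1 * eps `^ p * sig)^-1 * op (u \o X) i.
Proof.
move=> Xinj; rewrite /graph_op fsbig_image; last by move=> a b _ _ /Xinj.
rewrite (@fsbigE _ _ _ _ _ (index_enum 'I_n)) => [||//|j _]; last 2 first.
- exact: index_enum_uniq.
- by rewrite mem_index_enum.
under eq_bigl => j do rewrite in_setT.
under eq_bigr => j _ do rewrite /eta_eps -mulrA.
rewrite -mulr_sumr /= !invfM -/(op _ _) mulrA; congr (_ * _).
by rewrite -[in RHS]mulrA mulrAC [in RHS]mulrC; move: (n%:R^-1) (sig^-1) => a b; ring.
Qed.

Lemma edge_sum v i j t0 : enorm (X i - X j) <= t0 * eps ->
  eta t0 * Num.max (v i - v j) 0 `^ p <= op v i.
Proof.
move=> ij; rewrite /upwind (bigD1 j)//=.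
rewrite -[leLHS]addr0; apply: lerD.
  by rewrite ler_wpM2r ?powR_ge0// gweight_ge.
by apply: sumr_ge0 => k _; rewrite mulr_ge0 ?powR_ge0 ?gweight_ge0.
Qed.

Lemma ball_sum v i z (rad t0 N al : R) : 0 <= t0 -> 0 <= al ->
  N <= \sum_j (enorm (z - X j) <= rad)%R%:R ->
  (forall j, enorm (z - X j) <= rad ->
     enorm (X i - X j) <= t0 * eps /\ al <= v i - v j) ->
  N * eta t0 * al `^ p <= op v i.
Proof.
move=> t00 al0 Nle H.
have c0 : 0 <= eta t0 * al `^ p by rewrite mulr_ge0 ?powR_ge0// (kernel_ge0 kP).
rewrite -mulrA; apply: le_trans (ler_wpM2r c0 Nle) _.
rewrite mulr_suml; apply: ler_sum => j _.
have [ji|ji] := boolP (enorm (z - X j) <= rad); last first.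
  by rewrite mul0r mulr_ge0 ?powR_ge0 ?gweight_ge0.
have [ij aij] := H j ji; rewrite mul1r ler_pM ?powR_ge0 ?(kernel_ge0 kP) ?gweight_ge//.
by apply: ler_powR2 => //; rewrite le_max aij.
Qed.

Variables (G : 'I_n -> Prop) (Omega : set 'rV[R]_d.+1) (fmax t0 th c1 : R).
Local Notation D := (sdist (boundary Omega)).
Local Notation N := (n%:R * eps ^+ d.+1).
Local Notation F := (N * eps `^ p * sig * fmax).
Local Notation B0 := ((N * eps `^ p) `^ p^-1).
Local Notation CB := ((sig * fmax / eta t0) `^ p^-1).
Local Notation S := ((sig * fmax / (c1 * eta t0)) `^ p^-1).
Hypotheses (f0 : 0 < fmax) (t00 : 0 < t0) (et0 : 0 < eta t0) (c10 : 0 < c1)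
  (th0 : 0 < th) (tht : 4 * th <= t0)
  (E1 : forall z, Omega z -> th * eps <= D z ->
     c1 * N <= \sum_j (enorm (z - X j) <= th * eps)%R%:R).

Let sig0 : 0 < sig := sigma_gt0 kP p1.
Let N0 : 0 <= N. Proof. by rewrite mulr_ge0// exprn_ge0// ltW. Qed.
Let F0 : 0 <= F.
Proof. by rewrite !mulr_ge0 ?powR_ge0 ?(ltW sig0) ?(ltW f0)// exprn_ge0// ltW. Qed.

Let Npos (i : 'I_n) : 0 < N.
Proof. by rewrite mulr_gt0 ?exprn_gt0// ltr0n (leq_trans _ (ltn_ord i)). Qed.

(** A single neighbour of weight at least [eta t0] limits the increase, but nothing cancels the
    factor [N] of [F]: this is the origin of the term (n eps^(p+d))^(1/p). It is needed next to
    Gamma, which may be a single point. *)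
Lemma single_edge_bound v i j : op v i <= F -> enorm (X i - X j) <= t0 * eps ->
  v i <= v j + CB * B0.
Proof.
move=> vF ij; rewrite -lerBlDl.
apply: le_trans (pospow_root et0 F0 (le_trans (edge_sum v ij) vF)) _.
have -> : F / eta t0 = (sig * fmax / eta t0) * (N * eps `^ p) by ring.
have sfe : 0 <= sig * fmax / eta t0 by rewrite divr_ge0 ?mulr_ge0 ?ltW.
have NE : 0 <= N * eps `^ p by apply: mulr_ge0 => //; exact: powR_ge0.
by rewrite (powRM p^-1 sfe NE).
Qed.

(** Against c1 N neighbours the factor [N] of [F] cancels, and the increase is [S * eps] with [S]
    independent of n and eps. *)
Lemma ball_bound v i z b : op v i <= F -> Omega z -> th * eps <= D z ->
  enorm (X i - z) <= 3 * th * eps ->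
  (forall j, enorm (z - X j) <= th * eps -> v j <= b) -> v i <= b + S * eps.
Proof.
move=> vF Oz Dz iz vb; have Ni := Npos i.
rewrite -lerBlDl; set al := Num.max (v i - b) 0.
have al0 : 0 <= al by rewrite le_max lexx orbT.
have [vib|bvi] := leP (v i) b.
  by apply: le_trans (_ : 0 <= _); rewrite ?subr_le0// mulr_ge0 ?powR_ge0// ltW.
have alE : al = v i - b by rewrite /al; apply/max_idPl; rewrite subr_ge0 ltW.
have H : c1 * N * eta t0 * al `^ p <= op v i.
  apply: (@ball_sum v i z (th * eps)) => //; [exact: ltW|exact: E1|].
  move=> j zj; split; last by rewrite alE lerB// vb.
  apply: le_trans (enorm_tri _ z _) _; apply: le_trans (lerD iz zj) _.
  by rewrite -mulrDl ler_pM2r//; have := tht; have := th0; lra.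
have q0 : 0 < c1 * N * eta t0 by apply: (mulr_gt0 _ et0); exact: mulr_gt0.
apply: le_trans (pospow_root q0 F0 (le_trans H vF)) _.
have E (a c b' e s : R) : 0 < a -> 0 < c -> 0 < e ->
    a * b' * s * fmax / (c * a * e) = s * fmax / (c * e) * b'.
  by move=> a0 c0 e0; field; rewrite !gt_eqF.
rewrite E//.
have sf : 0 <= sig * fmax / (c1 * eta t0) by rewrite divr_ge0 ?mulr_ge0 ?ltW.
rewrite (powRM p^-1 sf (powR_ge0 _ _)).
by rewrite -powRrM divff ?gt_eqF// powRr1// ltW.
Qed.

(** The same count used for the barrier: a drop of more than [S * eps] towards one ball of
    neighbours is already too steep for the equation. *)
Lemma ball_strict v i z al : Omega z -> th * eps <= D z -> S * eps < al ->
  (forall j, enorm (z - X j) <= th * eps ->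
     enorm (X i - X j) <= t0 * eps /\ al <= v i - v j) -> F < op v i.
Proof.
move=> Oz Dz Sal H; have Ni := Npos i.
have Se : 0 <= S * eps by rewrite mulr_ge0 ?powR_ge0// ltW.
have al0 := le_trans Se (ltW Sal).
apply: lt_le_trans (ball_sum (ltW t00) al0 (E1 Oz Dz) H).
have sf : 0 <= sig * fmax / (c1 * eta t0) by rewrite divr_ge0 ?mulr_ge0 ?ltW.
have E (a c b' e s : R) : 0 < c -> 0 < e ->
    a * b' * s * fmax = c * a * e * (s * fmax / (c * e) * b').
  by move=> c0 e0; field; rewrite !gt_eqF.
rewrite (E _ _ _ _ _ c10 et0) ltr_pM2l; last by apply: (mulr_gt0 _ et0); exact: mulr_gt0.
have -> : sig * fmax / (c1 * eta t0) * eps `^ p = (S * eps) `^ p.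
  rewrite powRM ?powR_ge0 ?(ltW eps0)// -powRrM mulVf ?gt_eqF// powRr1//.
by apply: gt0_ltr_powR => //; rewrite nnegrE.
Qed.

(** Induction backwards from the end of the chain: only the last ball pays for a single edge, every
    other one pays [S * eps]. *)
Lemma chain_bound v (m : nat) (z : nat -> 'rV[R]_d.+1) j0 :
  (forall i, G i -> v i <= 0) -> (forall i, ~ G i -> op v i <= F) ->
  G j0 -> z m = X j0 -> (forall k, Omega (z k) /\ th * eps <= D (z k)) ->
  (forall k, (k < m)%N -> enorm (z k - z k.+1) <= th * eps) ->
  forall i, enorm (X i - z 0%N) <= 2 * th * eps -> v i <= CB * B0 + S * eps * m%:R.
Proof.
move=> vG vF Gj zm zO zs i iz.
have B00 : 0 <= CB * B0 by rewrite mulr_ge0 ?powR_ge0.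
have Se0 : 0 <= S * eps by rewrite mulr_ge0 ?powR_ge0// ltW.
have H l : (l <= m)%N -> forall i, enorm (X i - z (m - l)%N) <= 2 * th * eps ->
    v i <= CB * B0 + S * eps * l%:R.
  elim: l => [_|l ih lm] i1; rewrite ?subn0 => i1z.
    rewrite mulr0 addr0; have [Gi1|Gi1] := pselect (G i1); first by apply: le_trans (vG _ Gi1) _.
    have ij : enorm (X i1 - X j0) <= t0 * eps.
      by rewrite -zm; apply: le_trans i1z _; rewrite ler_pM2r//; have := tht; have := th0; lra.
    apply: le_trans (single_edge_bound (vF _ Gi1) ij) _.
    by rewrite gerDr; exact: vG.
  have [Gi1|Gi1] := pselect (G i1).
    by apply: le_trans (vG _ Gi1) _; rewrite addr_ge0// mulr_ge0.
  have ml : (m - l = (m - l.+1).+1)%N by rewrite -subSn// subSS.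
  have zz := zs (m - l.+1)%N _; rewrite -ml in zz.
  have {}zz : enorm (z (m - l.+1)%N - z (m - l)%N) <= th * eps.
    by apply: zz; rewrite leq_subr.
  have [Oz Dz] := zO (m - l)%N.
  rewrite -natr1 mulrDr mulr1 addrA; apply: ball_bound (vF _ Gi1) Oz Dz _ _.
    apply: le_trans (enorm_tri _ (z (m - l.+1)%N) _) _.
    by apply: le_trans (lerD i1z zz) _; rewrite -mulrDl ler_pM2r//; have := tht; have := th0; lra.
  move=> j zj; apply: ih; first exact: ltnW.
  by rewrite enormC; apply: le_trans zj _; rewrite ler_pM2r//; have := tht; have := th0; lra.
by apply: (H m) => //; rewrite subnn.
Qed.

End graph_bounds.

(** * The barrier *)

(** At a maximum i of [v - om] every difference [v i - v j] is at least [om i - om j]. Strictness is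
    asked only where [om i < v i], which lets the a priori bound on v confine the points to be
    examined. *)
Lemma comparison (R : realType) (n : nat) (w : 'I_n -> 'I_n -> R) (p : R)
    (F : 'I_n -> R) (G : 'I_n -> Prop) (v om : 'I_n -> R) :
  (forall i j, 0 <= w i j) -> 1 <= p -> subsolution w p F G v ->
  (forall i, 0 <= om i) ->
  (forall i, ~ G i -> om i < v i -> F i < upwind w p om i) ->
  forall i, v i <= om i.
Proof.
move=> w0 p1 [vG vF] om0 omF i0.
case: (@arg_maxP _ _ _ i0 xpredT (fun i => v i - om i)) => // i _ imax.
suff vi : v i <= om i by have := imax i0 isT => /=; rewrite -subr_le0; lra.
rewrite leNgt; apply/negP => lt.
have Gi : ~ G i by move=> Gi; have := vG i Gi; have := om0 i; lra.
have := omF i Gi lt; apply/negP; rewrite -leNgt; apply: le_trans (vF i Gi).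
apply: ler_sum => j _; rewrite ler_wpM2l//; apply: pospow_le => //.
have := imax j isT => /=; lra.
Qed.

(** * Strict supersolution property: boundary, cone and interior *)

Section barrier_cases.
Context {R : realType} {d : nat}.
Variables (eta : R -> R) (p eps : R) (n : nat) (X : 'I_n -> 'rV[R]_d.+1).
Hypotheses (kP : kernel_profile (d := d) eta) (p1 : 1 <= p) (eps0 : 0 < eps).
Local Notation sig := (sigma_p (d := d) eta p).
Local Notation op := (upwind (gweight eta eps X) p).
Local Notation N := (n%:R * eps ^+ d.+1).
Variables (Omega : set 'rV[R]_d.+1) (fmax t0 th c1 tau r : R).
Local Notation D := (sdist (boundary Omega)).
Local Notation F := (N * eps `^ p * sig * fmax).
Local Notation S := ((sig * fmax / (c1 * eta t0)) `^ p^-1).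
Hypotheses (f0 : 0 < fmax) (t00 : 0 < t0) (et0 : 0 < eta t0) (c10 : 0 < c1)
  (th0 : 0 < th) (tht : 4 * th <= tau) (taut : 4 * tau <= t0) (t01 : t0 < 1)
  (E1 : forall z, Omega z -> th * eps <= D z ->
     c1 * N <= \sum_j (enorm (z - X j) <= th * eps)%R%:R)
  (oO : open Omega) (C11O : C11_boundary Omega) (r0 : 0 < r)
  (rO : reach (boundary Omega) = r%:E) (XO : forall i, Omega (X i)).
Implicit Types (om : 'I_n -> R) (z : 'rV[R]_d.+1).

Let tau0 : 0 < tau. Proof. by move: th0 tht; lra. Qed.

(** On the ball of [boundary_inner_ball] with t = tau the linear term of the paraboloid drops by at
    least [tau * eps * A / 2], and [36 * tau * (K * eps) <= A] lets the quadratic term, at most K (3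
    tau eps)^2, take away no more than half of that. *)
Lemma boundary_case om i z (K A : R) :
  (forall j, K * (2 * edot (X i - z) (X i - X j) - enorm (X i - X j) ^+ 2) <= om i - om j) ->
  Omega z -> D (X i) < eps -> 2 * D (X i) <= D z -> enorm (X i - z) <= r / 8 ->
  0 < enorm (X i - z) -> eps <= r * tau / 36 -> 0 < K ->
  A <= 2 * K * enorm (X i - z) -> 36 * tau * (K * eps) <= A -> 4 * S < tau * A ->
  F < op om i.
Proof.
move=> omK Oz Dx Dz xz xz0 epsr K0 AL KA SA.
have tau1 : tau <= 1 by move: taut t01 t00; lra.
have [c [Oc Dc xc cxz]] := boundary_inner_ball oO C11O r0 rO (XO i) Oz Dx Dz xz xz0 tau0 tau1 epsr.
have thc : th * eps <= D c.
  by apply: le_trans Dc; rewrite mulrAC ler_pM2r//; move: tht th0; lra.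
have t43 : th * eps <= tau / 4 * eps by rewrite ler_pM2r//; move: tht; lra.
apply: (@ball_strict R d eta p eps n X kP p1 eps0 Omega fmax t0 th c1 f0 t00 et0 c10 E1
  om i c (eps * (tau * A / 4))) => //.
  by rewrite mulrC ltr_pM2l//; lra.
move=> j cj; have xj : enorm (X i - X j) <= 3 * tau * eps.
  apply: le_trans (enorm_tri _ c _) _; have := mulr_gt0 tau0 eps0; lra.
split.
  by apply: le_trans xj _; rewrite ler_pM2r//; move: taut tau0; lra.
apply: le_trans (omK j).
have e1 : edot (X i - z) (X i - X j) = edot (X i - z) (X i - c) + edot (X i - z) (c - X j).
  by rewrite -edotDr addrA subrK.
have e2 := edot_abs_le (X i - z) (c - X j).
have e3 : `|edot (X i - z) (c - X j)| <= enorm (X i - z) * (tau / 4 * eps).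
  by apply: le_trans e2 _; rewrite ler_pM2l// (le_trans cj t43).
have e4 : tau * eps / 2 * enorm (X i - z) <= edot (X i - z) (X i - X j).
  rewrite e1; move: e3; rewrite ler_norml => /andP[e3 _]; lra.
have e5 : enorm (X i - X j) ^+ 2 <= (3 * tau * eps) ^+ 2.
  by apply: lerXn2r => //; rewrite nnegrE ?enorm_ge0// ?(le_trans _ xj) ?enorm_ge0.
have te := mulr_gt0 tau0 eps0.
have f1 : K * (tau * eps * enorm (X i - z) - (3 * tau * eps) ^+ 2) <=
    K * (2 * edot (X i - z) (X i - X j) - enorm (X i - X j) ^+ 2).
  by rewrite ler_pM2l//; lra.
apply: le_trans f1.
have f2 := ler_wpM2l (ltW te) AL; have f3 := ler_wpM2l (ltW te) KA.
by move: f2 f3; move: (enorm (X i - z)) => q; rewrite exprMn !expr2; lra.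
Qed.

(** The ball is centred at distance 2 tau eps from x towards y, so its points are closer to y than x
    by at least tau eps. *)
Lemma cone_case om i (y : 'rV[R]_d.+1) (M : R) :
  (forall j, M * (enorm (X i - y) - enorm (X j - y)) <= om i - om j) ->
  0 < M -> 2 * tau * eps < enorm (X i - y) -> r / 2 <= D (X i) ->
  3 * tau * eps < r / 2 -> S < M * tau -> F < op om i.
Proof.
move=> omM M0 xy Dx er SM; have S0 := reach_nonempty r0 rO.
have te := mulr_gt0 tau0 eps0.
have t43 : th * eps <= tau / 4 * eps by rewrite ler_pM2r//; move: tht; lra.
have xy0 : 0 < enorm (X i - y) by lra.
pose a := 2 * tau * eps / enorm (X i - y).
have a0 : 0 <= a by rewrite divr_ge0 ?enorm_ge0//; lra.
have a1 : a <= 1 by rewrite ler_pdivrMr// mul1r ltW.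
have aE : a * enorm (X i - y) = 2 * tau * eps by rewrite divfK// gt_eqF.
pose c := X i - a *: (X i - y).
have xc : enorm (X i - c) = 2 * tau * eps.
  by rewrite /c opprB addrCA subrr addr0 enormZ ger0_norm.
have cy : enorm (c - y) = enorm (X i - y) - 2 * tau * eps.
  have -> : c - y = (1 - a) *: (X i - y) by apply/rowP => k; rewrite !mxE; ring.
  by rewrite enormZ ger0_norm ?subr_ge0// mulrBl mul1r aE.
have Oc : Omega c by apply: sdist_in_domain oO (XO i) _; rewrite xc; lra.
apply: (@ball_strict R d eta p eps n X kP p1 eps0 Omega fmax t0 th c1 f0 t00 et0 c10 E1
  om i c (M * tau * eps)) => //.
- have := sdist_tri (X i) c S0; lra.
- by rewrite ltr_pM2r.
move=> j cj; split.
  apply: le_trans (enorm_tri _ c _) _.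
  have tte : 4 * tau * eps <= t0 * eps by rewrite ler_pM2r.
  by apply: le_trans tte; lra.
apply: le_trans (omM j); rewrite -mulrA ler_pM2l//.
have := enorm_tri (X j) c y; rewrite (enormC (X j) c); lra.
Qed.

(** L is the slope of the paraboloid. Within one kernel radius its quadratic term is at most K eps^2
    = s eps, which the shift b s of the test absorbs because L b >= 1. The kernel sum then yields
    L^p, and the excess 1 + C4 q of the slope over g beats the defect C q. *)
Lemma interior_case om i z (K s q C C4 gx rhox fx b : R) :
  (forall j, K * (2 * edot (X i - z) (X i - X j) - enorm (X i - X j) ^+ 2) <= om i - om j) ->
  0 < enorm (X i - z) -> 0 < K -> K * eps = s -> 0 <= s ->
  N * rhox * (sig - C * q) <= \sum_j eta (enorm (X i - X j) / eps) *
    Num.max (edot ((enorm (X i - z))^-1 *: (X i - z)) (X i - X j) / eps - b * s) 0 `^ p ->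
  0 < rhox -> 0 < gx -> gx `^ p * rhox = fx ->
  0 <= C4 * q -> 0 <= sig - C * q -> sig < (1 + C4 * q) * (sig - C * q) ->
  (1 + C4 * q) * gx <= 2 * K * enorm (X i - z) ->
  1 <= 2 * K * enorm (X i - z) * b ->
  N * eps `^ p * sig * fx < op om i.
Proof.
move=> omK xz0 K0 Ke s0 E2 rhox0 gx0 gE C40 sC sig4 gL Lb.
have p0 : 0 < p by apply: lt_le_trans p1.
have N0 : 0 < N by rewrite mulr_gt0 ?exprn_gt0// ltr0n (leq_trans _ (ltn_ord i)).
set L := 2 * K * enorm (X i - z) in gL Lb.
set e := _ *: (X i - z) in E2.
have L0 : 0 < L by rewrite !mulr_gt0.
have key : (L * eps) `^ p * (N * rhox * (sig - C * q)) <= op om i.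
  apply: le_trans (ler_wpM2l (powR_ge0 _ _) E2) _; rewrite mulr_sumr; apply: ler_sum => j _.
  have w0 := gweight_ge0 X kP eps0 i j; rewrite mulrCA.
  have [far|near] := ltP 1 (enorm (X i - X j) / eps).
    by rewrite /gweight (kernel_out kP far) !mul0r.
  rewrite ler_wpM2l//.
  have m0 : 0 <= Num.max (edot e (X i - X j) / eps - b * s) 0 by rewrite le_max lexx orbT.
  have Le0 : 0 <= L * eps by rewrite mulr_ge0 ?ltW.
  rewrite -powRM//; apply: ler_powR2; [exact: ltW|exact: mulr_ge0|].
  rewrite maxr_pMr// mulr0 ge_max !le_max lexx orbT andbT; apply/orP; left.
  apply: le_trans (omK j).
  have -> : edot (X i - z) (X i - X j) = enorm (X i - z) * edot e (X i - X j).
    by rewrite -edotZl enorm_dirK.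
  rewrite ler_pdivrMr// mul1r in near.
  have n2 : enorm (X i - X j) ^+ 2 <= eps ^+ 2.
    by apply: lerXn2r => //; rewrite nnegrE ?enorm_ge0 ?ltW.
  have n3 : K * enorm (X i - X j) ^+ 2 <= L * eps * (b * s).
    apply: le_trans (ler_wpM2l (ltW K0) n2) _.
    rewrite expr2 (mulrA K) Ke (mulrC s) -[leLHS]mulr1.
    have -> : L * eps * (b * s) = eps * s * (L * b) by ring.
    by rewrite ler_wpM2l// mulr_ge0// ltW.
  have -> : L * eps * (edot e (X i - X j) / eps - b * s) =
      L * edot e (X i - X j) - L * eps * (b * s) by field; rewrite gt_eqF.
  by move: n3; rewrite /L; lra.
apply: lt_le_trans key.
have -> : (L * eps) `^ p * (N * rhox * (sig - C * q)) =
    N * eps `^ p * (L `^ p * rhox * (sig - C * q)).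
  by rewrite powRM ?(ltW L0) ?(ltW eps0)//; ring.
rewrite -mulrA ltr_pM2l; last by rewrite mulr_gt0// powR_gt0.
have c41 : 1 <= 1 + C4 * q by rewrite lerDl.
have h1 : (1 + C4 * q) * gx `^ p <= L `^ p.
  apply: le_trans (ler_powR2 (ltW p0) _ gL); last by rewrite mulr_ge0 ?(ltW gx0)//; lra.
  rewrite powRM ?(ltW gx0)//; last lra.
  rewrite ler_wpM2r ?powR_ge0//.
  exact: le1r_powR.
have fx0 : 0 < fx by rewrite -gE mulr_gt0// powR_gt0.
apply: (@lt_le_trans _ _ ((1 + C4 * q) * (sig - C * q) * fx)).
  by rewrite ltr_pM2r.
have -> : (1 + C4 * q) * (sig - C * q) * fx = (1 + C4 * q) * gx `^ p * (rhox * (sig - C * q)).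
  by rewrite -gE; ring.
by rewrite -[X in _ <= X]mulrA ler_wpM2r// mulr_ge0// ltW.
Qed.

End barrier_cases.

(** Transfers the slope bound from the chain point, where minimality gives it, to x: C3 pays for the
    change of g over the distance gmax s, for the term s and for the excess C4. *)
Lemma slope_arith (R : realFieldType) (gx gz gmin gmax c q s C3 C4 : R) :
  0 < gmin -> 0 <= c -> 0 <= C4 -> 0 < s -> s <= q -> C4 * q <= 1 ->
  C4 + 2 * c * gmax + gmin^-1 <= C3 -> gmin <= gz -> 0 < gmax ->
  gx <= (1 + c * (gmax * s)) * gz -> (1 + C4 * q) * gx <= (1 + C3 * q) * gz - s.
Proof.
move=> gmin0 c0 C40 s0 sq C4q C3E gz1 gmax0 h1.
have q0 : 0 < q by apply: lt_le_trans sq.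
have c4 : 0 <= 1 + C4 * q by rewrite addr_ge0// mulr_ge0// ltW.
apply: le_trans (ler_wpM2l c4 h1) _.
have gz0 : 0 <= gz by rewrite (le_trans (ltW gmin0)).
have cg : c * (gmax * s) <= c * gmax * q.
  by rewrite -mulrA ler_wpM2l// ler_pM2l.
have cg0 : 0 <= c * gmax * q by rewrite !mulr_ge0// ltW.
have t1 : (1 + C4 * q) * (1 + c * (gmax * s)) <= (1 + C4 * q) * (1 + c * gmax * q).
  by rewrite ler_wpM2l// lerD2l.
have t2 : C4 * q * (c * gmax * q) <= c * gmax * q by rewrite ler_piMl.
have h2 : (1 + C4 * q) * (1 + c * (gmax * s)) <= 1 + (C4 + 2 * c * gmax) * q.
  by move: t1 t2; clear; lra.
have h3 : s <= gmin^-1 * q * gz.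
  apply: le_trans sq _; rewrite mulrAC ler_peMl ?(ltW q0)//.
  by rewrite mulrC ler_pdivlMr// mul1r.
have h4 : (C4 + 2 * c * gmax + gmin^-1) * q * gz <= C3 * q * gz.
  by rewrite ler_wpM2r// ler_wpM2r// ltW.
rewrite [leLHS]mulrA; apply: le_trans (ler_wpM2r gz0 h2) _.
by move: h3 h4; clear; lra.
Qed.

Section barrier.
Context {R : realType} {d : nat}.
Variables (eta : R -> R) (p s : R) (n : nat) (X : 'I_n -> 'rV[R]_d.+1).
Hypotheses (kP : kernel_profile (d := d) eta) (p1 : 1 <= p) (s0 : 0 < s).
Local Notation eps := (s ^+ 2).
Local Notation sig := (sigma_p (d := d) eta p).
Local Notation op := (upwind (gweight eta eps X) p).
Local Notation N := (n%:R * eps ^+ d.+1).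
Variables (Omega : set 'rV[R]_d.+1) (fmax t0 th c1 tau r : R).
Local Notation D := (sdist (boundary Omega)).
Local Notation F := (N * eps `^ p * sig * fmax).
Local Notation S := ((sig * fmax / (c1 * eta t0)) `^ p^-1).
Local Notation E := ((sig * fmax / eta t0) `^ p^-1 * (N * eps `^ p) `^ p^-1).
Hypotheses (fmax0 : 0 < fmax) (t00 : 0 < t0) (et0 : 0 < eta t0) (c10 : 0 < c1)
  (th0 : 0 < th) (tht : 4 * th <= tau) (taut : 4 * tau <= t0) (t01 : t0 < 1)
  (E1 : forall z, Omega z -> th * eps <= D z ->
     c1 * N <= \sum_j (enorm (z - X j) <= th * eps)%R%:R)
  (oO : open Omega) (C11O : C11_boundary Omega) (r0 : 0 < r)
  (rO : reach (boundary Omega) = r%:E) (XO : forall i, Omega (X i)).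

Local Ltac section_lra :=
  clear - kP p1 s0 fmax0 t00 et0 c10 th0 tht taut t01 E1 oO C11O r0 rO XO; lra.

(* The barrier [min (b + min_k (ell_k + |x - zeta_k|^2 / s)) (M |x - y|) + E]:
   the quadratic pieces have slope at least g, the cone takes over near y and
   makes the slope of the last piece at least gmax. *)
Lemma barrier_bound (rho f g : 'rV[R]_d.+1 -> R) (gmin gmax c q C C3 C4 M A U h : R)
  (v : 'I_n -> R) (G : 'I_n -> Prop) (j0 : 'I_n) (m : nat)
  (zeta : nat -> 'rV[R]_d.+1) (ell : nat -> R) :
  (forall x, Omega x -> f x <= fmax /\ 0 < rho x) ->
  (forall x, Omega x -> gmin <= g x <= gmax) ->
  (forall x z, Omega x -> Omega z -> g x <= (1 + c * enorm (x - z)) * g z) ->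
  (forall x, Omega x -> g x `^ p * rho x = f x) ->
  (forall i e, eps <= D (X i) -> enorm e = 1 ->
    N * rho (X i) * (sig - C * q) <= \sum_j eta (enorm (X i - X j) / eps) *
      Num.max (edot e (X i - X j) / eps - gmin^-1 * s) 0 `^ p) ->
  subsolution (gweight eta eps X) p (fun i => N * eps `^ p * sig * f (X i)) G v ->
  G j0 -> r <= D (X j0) -> (forall i, v i <= E + U) ->
  zeta m = X j0 -> (forall k, Omega (zeta k) /\ A * s <= D (zeta k)) ->
  (forall k, (k < m)%N -> enorm (zeta k - zeta k.+1) <= h) -> 0 < h -> h <= eps ->
  ell m = 0 -> (forall k, (k < m)%N -> ell k = ell k.+1 + (1 + C3 * q) * g (zeta k) * h) ->
  0 < gmin -> 0 <= c -> 0 <= C3 -> 0 <= C4 -> 0 < M -> 0 <= U ->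
  s <= q -> C3 * q <= 1 -> C4 * q <= 1 -> 0 <= sig - C * q ->
  sig < (1 + C4 * q) * (sig - C * q) ->
  C4 + 2 * c * gmax + gmin^-1 <= C3 ->
  S < M * tau -> 2 * U <= M * r -> 4 * S < tau * A -> 2 * s <= A -> 36 * tau * s <= A ->
  U * s <= (r / 8) ^+ 2 -> eps <= r * tau / 36 -> 3 * tau * eps < r / 2 ->
  forall i, v i <= E + (M * gmax * s + ell 0%N + s^-1 * enorm (X i - zeta 0%N) ^+ 2).
Proof.
move=> fr gb gr gpE E2 sv Gj ry vU zm zO zs h0 he ellm ellS gmin0 c0 C30 C40 M0 U0
  sq C3q C4q sC sig4 C3E SM UM SA sA tA Us er er2.
have eps0 : 0 < eps by rewrite exprn_gt0.
have K0 : 0 < s^-1 by rewrite invr_gt0.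
have Ke : s^-1 * eps = s by rewrite expr2 mulrA mulVf ?mul1r// gt_eqF.
have S0 := reach_nonempty r0 rO.
have E0 : 0 <= E by rewrite mulr_ge0 ?powR_ge0.
have gg : gmin <= gmax by have /andP[a b] := gb _ (XO j0); exact: le_trans a b.
have gmax0 : 0 < gmax by apply: lt_le_trans gg.
have q0 : 0 < q by apply: lt_le_trans sq.
have tau0 : 0 < tau by move: th0 tht; lra.
have ell0 k : (k <= m)%N -> 0 <= ell k.
  move=> km; have : (m - k <= m)%N by rewrite leq_subr.
  rewrite -{2}(subKn km); elim: (m - k)%N => [|l ih lm]; first by rewrite subn0 ellm.
  rewrite ellS; last by rewrite ltn_subrL/= (leq_trans _ lm).
  rewrite -subSn// subSS addr_ge0 ?ih ?(ltnW lm)// !mulr_ge0 ?(ltW h0)//.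
    by rewrite addr_ge0// mulr_ge0// ltW.
  by have [Oz _] := zO (m - l.+1)%N; have /andP[+ _] := gb _ Oz; exact: le_trans (ltW gmin0).
pose Qk i (k : 'I_m.+1) := ell k + s^-1 * enorm (X i - zeta k) ^+ 2.
have exk i : exists k : 'I_m.+1, forall l : 'I_m.+1, Qk i k <= Qk i l.
  case: (@arg_minP _ _ _ ord0 xpredT (Qk i)) => // k _ kmin.
  by exists k => l; exact: kmin.
have [kk kkP] := choice exk.
(* The summand [M * gmax * s] makes the cone the smaller of the two within gmax s of y. *)
pose om i := Num.min (M * gmax * s + Qk i (kk i)) (M * enorm (X i - X j0)) + E.
have Q0 i k : 0 <= Qk i k.
  have km : (k <= m)%N by rewrite -ltnS.
  by rewrite addr_ge0 ?ell0// mulr_ge0 ?exprn_ge0 ?enorm_ge0// ltW.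
have omQ i (k : 'I_m.+1) : om i <= M * gmax * s + Qk i k + E.
  rewrite lerD2r ge_min; apply/orP; left; rewrite lerD2l; exact: kkP.
have omC i : om i <= M * enorm (X i - X j0) + E by rewrite lerD2r ge_min lexx orbT.
have om0 i : 0 <= om i.
  rewrite addr_ge0// le_min; apply/andP; split; last by rewrite mulr_ge0 ?enorm_ge0// ltW.
  by rewrite addr_ge0// ?mulr_ge0// ltW.
have main i : ~ G i -> om i < v i -> N * eps `^ p * sig * f (X i) < op om i.
  move=> Gi omv; have [vG vF] := sv; have Oi := XO i.
  have [fx rx] := fr _ Oi.
  have FF : N * eps `^ p * sig * f (X i) <= F.
    rewrite ler_wpM2l// !mulr_ge0 ?powR_ge0 ?exprn_ge0 ?(ltW (sigma_gt0 kP p1))//.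
    exact: ltW.
  have omU : om i < E + U by apply: lt_le_trans omv _.
  have [cone|quad] := leP (M * enorm (X i - X j0)) (M * gmax * s + Qk i (kk i)).
    have omE : om i = M * enorm (X i - X j0) + E by rewrite /om (min_idPr cone).
    (* Within 2 tau eps of y a single edge keeps v below E, hence below the barrier. *)
    have [near|far] := leP (enorm (X i - X j0)) (2 * tau * eps).
      have ij : enorm (X i - X j0) <= t0 * eps.
        by apply: le_trans near _; rewrite ler_pM2r//; move: taut tau0; section_lra.
      exfalso; have := single_edge_bound kP p1 eps0 fmax0 et0 (le_trans (vF _ Gi) FF) ij.
      have := vG _ Gj; have : 0 <= M * enorm (X i - X j0) by rewrite mulr_ge0 ?enorm_ge0// ltW.
      by move: omv; rewrite omE; section_lra.
    apply: le_lt_trans FF _.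
    apply: (cone_case kP p1 eps0 fmax0 t00 et0 c10 th0 tht taut E1 oO r0 rO XO
      (y := X j0) (M := M)) => // [j|].
      by have := omC j; rewrite omE mulrBr; section_lra.
    (* The a priori bound confines the active cone to a ball of radius r / 2 around y, well inside
       Omega. *)
    have ms : M * enorm (X i - X j0) <= M * (r / 2) by move: omU UM; rewrite omE; section_lra.
    rewrite ler_pM2l// in ms.
    have := sdist_tri (X j0) (X i) S0; rewrite enormC; move: ms ry; section_lra.
  set k := kk i in quad; set z := zeta k.
  have omE : om i = M * gmax * s + Qk i k + E by rewrite /om (min_idPl (ltW quad)).
  have [Oz Dz] := zO k; rewrite -/z in Oz Dz.
  have omK j : s^-1 * (2 * edot (X i - z) (X i - X j) - enorm (X i - X j) ^+ 2) <= om i - om j.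
    have := omQ j k; rewrite omE /Qk -/z.
    have -> : X j - z = (X i - z) - (X i - X j) by rewrite opprB [RHS]addrC addrA subrK.
    rewrite !sqr_enorm edotB2; section_lra.
  set L := 2 * s^-1 * enorm (X i - z).
  have xz0 := enorm_ge0 (X i - z).
  (* Passing from k to k + 1 lowers ell by (1 + C3 q) g z h and raises the quadratic term by at most
     (2 |x - z| h + h^2) / s, so minimality bounds L from below. The last index has no successor;
     there the inactive cone gives |x - y| > gmax s, hence L >= 2 gmax. *)
  have Lk : (1 + C3 * q) * g z - s <= L \/ 2 * gmax <= L.
    have := ltn_ord k; rewrite ltnS leq_eqVlt => /predU1P[km|km].
      right; have zE : z = X j0 by rewrite /z km zm.
      have : M * gmax * s <= M * enorm (X i - z).
        by have := Q0 i k; move: quad; rewrite zE; section_lra.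
      by rewrite -mulrA ler_pM2l// /L mulrAC ler_pdivlMr//; section_lra.
    left; have k1 : (k.+1 < m.+1)%N by [].
    have := kkP i (Ordinal k1); rewrite -/k /Qk /= -/z (ellS k km) -/z.
    have h1 : enorm (X i - zeta k.+1) <= enorm (X i - z) + h.
      by apply: le_trans (enorm_tri _ z _) _; rewrite lerD2l; exact: zs.
    have h2 : enorm (X i - zeta k.+1) ^+ 2 <= (enorm (X i - z) + h) ^+ 2.
      by apply: lerXn2r => //; rewrite nnegrE ?enorm_ge0// addr_ge0// ltW.
    have h3 := ler_wpM2l (ltW K0) h2 => h4.
    have h5 : s^-1 * h <= s by rewrite -[leRHS]Ke ler_pM2l.
    rewrite lerBlDr; apply: le_trans (_ : _ <= L + s^-1 * h) _; last by rewrite lerD2l.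
    rewrite -(ler_pM2r h0) /L; move: h3 h4; rewrite sqrrD; section_lra.
  have /andP[gz1 gz2] := gb _ Oz; have /andP[gx1 gx2] := gb _ Oi.
  have gL : (1 + C4 * q) * g (X i) <= L.
    have big : 2 * gmax <= L -> (1 + C4 * q) * g (X i) <= L.
      apply: le_trans; apply: ler_pM => //.
      - by rewrite addr_ge0// mulr_ge0// ltW.
      - exact: le_trans (ltW gmin0) gx1.
      - by move: C4q; section_lra.
    have [|Ls] := leP (2 * gmax) L; first exact: big.
    case: Lk => [Lk|/big//].
    (* A slope below 2 gmax puts x so close to z that g hardly changes between them. *)
    have xzs : enorm (X i - z) <= gmax * s.
      by rewrite -ler_pdivrMr//; move: Ls; rewrite /L mulrAC; section_lra.
    have h1 : g (X i) <= (1 + c * (gmax * s)) * g z.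
      apply: le_trans (gr _ _ Oi Oz) _; rewrite ler_wpM2r ?(le_trans (ltW gmin0))//.
      by rewrite lerD2l ler_wpM2l.
    apply: le_trans Lk; exact: (slope_arith gmin0 c0 C40 s0 sq C4q C3E gz1 gmax0 h1).
  have L0 : gmin <= L.
    have gX0 : 0 <= g (X i) := le_trans (ltW gmin0) gx1.
    apply: le_trans gL; apply: le_trans gx1 _.
    by rewrite ler_peMl// lerDl mulr_ge0// ltW.
  have xz1 : 0 < enorm (X i - z).
    rewrite lt_neqAle xz0 andbT; apply/eqP => xzE.
    by move: L0; rewrite /L -xzE mulr0 leNgt gmin0.
  (* By the a priori bound the quadratic term |x - z|^2 / s is below U. *)
  have xz8 : enorm (X i - z) <= r / 8.
    have r8 : 0 <= r / 8 by rewrite divr_ge0// ltW.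
    rewrite -(@ler_pXn2r _ 2)// ?nnegrE//; apply: le_trans Us.
    rewrite -ler_pdivrMr//; move: omU; rewrite omE /Qk -/z.
    have kM : (k <= m)%N by rewrite -ltnS.
    have := ell0 k kM; have : 0 <= M * gmax * s by rewrite !mulr_ge0// ltW.
    move: (ell k) (M * gmax * s) E => e1 e2 e3.
    rewrite [s^-1 * _]mulrC; move: (_ / s) => e4; section_lra.
  have [near|far] := ltP (D (X i)) eps.
    apply: le_lt_trans FF _.
    have sA2 : 2 * eps <= A * s by rewrite expr2 mulrA ler_pM2r.
    apply: (boundary_case kP p1 eps0 fmax0 t00 et0 c10 th0 tht taut t01 E1 oO C11O r0 rO XO
      (z := z) (K := s^-1) (A := A)) => //; last by rewrite Ke.
      apply: le_trans Dz; move: sA2 near; section_lra.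
    rewrite -/L /L mulrAC ler_pdivlMr//.
    have := sdist_tri z (X i) S0; rewrite enormC; move: Dz near sA2; section_lra.
  apply: (@interior_case R d eta p eps n X kP p1 eps0 om i z s^-1 s q C C4 (g (X i))
    (rho (X i)) (f (X i)) gmin^-1) => //.
  - exact: ltW.
  - apply: E2 => //; apply: enorm_dirE; by rewrite -enorm_gt0.
  - exact: lt_le_trans gx1.
  - exact: gpE.
  - by rewrite mulr_ge0// ltW.
  - by rewrite ler_pdivlMr// mul1r.
move=> i; apply: le_trans (comparison _ p1 sv om0 main i) _.
  by move=> a b; exact: gweight_ge0.
by have := omQ i ord0; rewrite /Qk /=; section_lra.
Qed.

End barrier.

(** * Constants *)

Section speed.
Context {R : realType} {d : nat}.
Implicit Types (Omega : set 'rV[R]_d) (x z : 'rV[R]_d).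

Lemma closure_bounds Omega (L a b : R) h : elipschitz (closure Omega) L h ->
  (forall x, Omega x -> a <= h x <= b) -> forall x, closure Omega x -> a <= h x <= b.
Proof.
move=> hL hab x clx.
have H e : 0 < e -> a - e <= h x <= b + e.
  move=> e0; have L1 : 0 < `|L| + 1 by rewrite ltr_wpDl.
  have [y Oy xy] := (closure_enormP _ _).1 clx (e / (`|L| + 1)) (divr_gt0 e0 L1).
  have /andP[ha hb] := hab y Oy.
  have cly := subset_closure Oy.
  have := hL x y; rewrite !inE => /(_ clx cly).
  have : L * enorm (x - y) <= e.
    rewrite ltr_pdivlMr// in xy; apply: le_trans (ltW xy); rewrite mulrC ler_wpM2l ?enorm_ge0//.
    by apply: le_trans (ler_norm _) _; rewrite lerDl.
  rewrite ler_norml => h1 /andP[h2 h3]; apply/andP; split; lra.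
apply/andP; split; apply/ler_addgt0Pr => e /H/andP[]; lra.
Qed.

Lemma speedE (p a b : R) : 0 < a -> 0 < b -> a `^ (- p^-1) * b `^ p^-1 = (b / a) `^ p^-1.
Proof.
move=> a0 b0; rewrite powRM ?invr_ge0 ?ltW// mulrC; congr (_ * _).
by rewrite -[a^-1]powR_inv1 ?ltW// -powRrM mulN1r.
Qed.

Lemma lipschitz_ratio Omega (L a : R) h x z : elipschitz (closure Omega) L h -> 0 < a ->
  a <= h z -> closure Omega x -> closure Omega z ->
  h x <= (1 + `|L| / a * enorm (x - z)) * h z.
Proof.
move=> hL a0 az clx clz; have := hL x z; rewrite !inE => /(_ clx clz).
rewrite ler_norml => /andP[_ h1].
have h2 : L * enorm (x - z) <= `|L| * enorm (x - z).
  by rewrite ler_wpM2r ?enorm_ge0// ler_norm.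
have h3 : `|L| * enorm (x - z) <= `|L| / a * enorm (x - z) * h z.
  have -> : `|L| / a * enorm (x - z) * h z = `|L| * enorm (x - z) * (h z / a) by ring.
  by rewrite ler_peMr ?mulr_ge0 ?enorm_ge0// ler_pdivlMr// mul1r.
lra.
Qed.

(** g is the p-th root of f / rho, and 1 / p <= 1 lets the root of a factor above 1 be replaced by
    the factor. The term gmax / gmin serves points at distance at least 1; below that, the product a
    b e^2 is at most a b e. *)
Lemma speed_bounds Omega (p rhomin rhomax Lrho fmin fmax Lf : R) rho f :
  1 <= p -> 0 < rhomin -> rhomin <= rhomax -> 0 < fmin -> fmin <= fmax ->
  elipschitz (closure Omega) Lrho rho ->
  (forall x, Omega x -> rhomin <= rho x <= rhomax) ->
  elipschitz (closure Omega) Lf f ->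
  (forall x, Omega x -> fmin <= f x <= fmax) ->
  let g := fun z => rho z `^ (- p^-1) * f z `^ p^-1 in
  let gmin := (fmin / rhomax) `^ p^-1 in let gmax := (fmax / rhomin) `^ p^-1 in
  let a := `|Lf| / fmin in let b := `|Lrho| / rhomin in
  [/\ forall x, closure Omega x -> gmin <= g x <= gmax,
    forall x z, closure Omega x -> closure Omega z ->
      g x <= (1 + (a + b + a * b + gmax / gmin) * enorm (x - z)) * g z &
    forall x, closure Omega x -> g x `^ p * rho x = f x].
Proof.
move=> p1 rm0 rm fm0 fm rhoL rhob fL fb g gmin gmax a b.
have p0 : 0 < p by apply: lt_le_trans p1.
have pi : 0 <= p^-1 by rewrite invr_ge0 ltW.
have rb := closure_bounds rhoL rhob; have fbb := closure_bounds fL fb.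
have r0 x : closure Omega x -> 0 < rho x by move=> /rb/andP[+ _]; exact: lt_le_trans.
have f0 x : closure Omega x -> 0 < f x by move=> /fbb/andP[+ _]; exact: lt_le_trans.
have gE x : closure Omega x -> g x = (f x / rho x) `^ p^-1.
  by move=> cx; rewrite /g speedE; [|exact: r0|exact: f0].
have rM0 : 0 < rhomax by apply: lt_le_trans rm.
have fM0 : 0 < fmax by apply: lt_le_trans fm.
have gmin0 : 0 < gmin by rewrite powR_gt0// divr_gt0.
have gb x : closure Omega x -> gmin <= g x <= gmax.
  move=> cx; rewrite gE//; have /andP[r1 r2] := rb _ cx; have /andP[f1 f2] := fbb _ cx.
  have rx := r0 _ cx; have fx := f0 _ cx.
  apply/andP; split; apply: (ler_powR2 pi).
  - by apply: divr_ge0; exact: ltW.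
  - by apply: ler_pM; rewrite ?invr_ge0 ?(ltW fm0) ?(ltW rM0)// lef_pV2.
  - by apply: divr_ge0; exact: ltW.
  - by apply: ler_pM; rewrite ?invr_ge0 ?(ltW fx) ?(ltW rx)// lef_pV2.
split=> //; last first.
  move=> x cx; rewrite gE// -powRrM mulVf ?gt_eqF// powRr1 ?divr_ge0 ?ltW ?f0 ?r0//.
  by rewrite divfK// gt_eqF// r0.
move=> x z cx cz; set e := enorm (x - z); have e0 : 0 <= e := enorm_ge0 _.
have a0 : 0 <= a by rewrite divr_ge0// ltW.
have b0 : 0 <= b by rewrite divr_ge0// ltW.
have /andP[gx1 gx2] := gb _ cx; have /andP[gz1 gz2] := gb _ cz.
have gmax0 : 0 < gmax by apply: lt_le_trans gx2; apply: lt_le_trans gx1.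
have gz0 : 0 < g z by apply: lt_le_trans gz1.
have gg0 : 0 <= gmax / gmin by rewrite divr_ge0// ltW.
have ab0 : 0 <= a * b by rewrite mulr_ge0.
have [e1|e1] := leP 1 e.
  apply: le_trans gx2 _; apply: (@le_trans _ _ (gmax / gmin * e * g z)); last first.
    rewrite ler_wpM2r ?ltW// mulrDl; have : 0 <= (a + b + a * b) * e by rewrite mulr_ge0// !addr_ge0.
    lra.
  rewrite mulrAC; apply: (@le_trans _ _ (gmax / gmin * g z)).
    by rewrite mulrAC ler_pdivlMr// ler_pM2l.
  by rewrite ler_peMr// mulr_ge0// ltW.
have /andP[r1 _] := rb _ cx; have /andP[f1 _] := fbb _ cz.
have fxz := lipschitz_ratio fL fm0 f1 cx cz.
have rzx := lipschitz_ratio rhoL rm0 r1 cz cx; rewrite enormC in rzx.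
rewrite -/a -/b -/e in fxz rzx.
have ae0 : 0 <= a * e by rewrite mulr_ge0.
have be0 : 0 <= b * e by rewrite mulr_ge0.
have k1 : 1 <= (1 + a * e) * (1 + b * e) by rewrite mulr_ege1// lerDl.
have fr : f x / rho x <= (1 + a * e) * (1 + b * e) * (f z / rho z).
  have rx := r0 _ cx; have rz := r0 _ cz; have fz := f0 _ cz.
  rewrite ler_pdivrMr//; apply: le_trans fxz _.
  have -> : (1 + a * e) * (1 + b * e) * (f z / rho z) * rho x =
    (1 + a * e) * f z * ((1 + b * e) * rho x / rho z) by field; rewrite gt_eqF.
  rewrite ler_peMr ?mulr_ge0 ?(ltW fz) ?addr_ge0//.
  by rewrite ler_pdivlMr// mul1r.
have fz0 : 0 <= f z / rho z by rewrite divr_ge0// ltW ?f0 ?r0.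
have fx0 : 0 <= f x / rho x by rewrite divr_ge0// ltW ?f0 ?r0.
rewrite !gE//; apply: le_trans (ler_powR2 pi fx0 fr) _.
rewrite (powRM p^-1 (le_trans ler01 k1) fz0).
rewrite ler_wpM2r ?powR_ge0//; apply: le_trans (ler1_powR k1 _) _.
  by rewrite invf_le1.
have abe : a * b * e * e <= a * b * e by apply: ler_piMr; [exact: mulr_ge0|exact: ltW].
have : 0 <= gmax / gmin * e by rewrite mulr_ge0.
lra.
Qed.

End speed.

(** Relative errors of order q in the length become absolute ones because the distance dg is at most
    U. *)
Lemma length_arith (R : realFieldType) (L w a s dg U q C3 C5 x y : R) :
  0 <= L -> 2 * w = y * s -> w <= 1 / 2 -> 0 <= y -> 0 <= a -> 0 <= C3 -> 0 <= dg -> dg <= U ->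
  0 < s -> s <= q -> q <= 1 -> C3 * q <= 1 ->
  (1 - w) * L <= (1 + a * s) ^+ 2 * (dg + 2 * s) ->
  x = 2 * a + a ^+ 2 -> C5 = x + y + x * y ->
  (1 + C3 * q) * L <= dg + (3 + (C3 + 2 * C5) * (U + 3)) * q.
Proof.
move=> L0 wy w2 y0 a0 C30 dg0 dgU s0 sq q1 C3q H xE C5E.
have s1 : s <= 1 by apply: le_trans q1.
have x0 : 0 <= x by rewrite xE addr_ge0 ?mulr_ge0 ?sqr_ge0.
have C50 : 0 <= C5 by rewrite C5E !addr_ge0// mulr_ge0.
have h1 : (1 + a * s) ^+ 2 <= 1 + x * s.
  have : a ^+ 2 * s ^+ 2 <= a ^+ 2 * s.
    by rewrite ler_wpM2l ?sqr_ge0// expr2 ler_piMr// ltW.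
  by rewrite xE sqrrD expr1n mul1r exprMn; lra.
have w0 : 0 <= w.
  have : 0 <= y * s by rewrite mulr_ge0// ltW.
  by rewrite -wy; lra.
have h2 : 1 <= (1 + y * s) * (1 - w) by rewrite -wy; nra.
have ds0 : 0 <= dg + 2 * s by rewrite addr_ge0// mulr_ge0// ltW.
have ys0 : 0 <= 1 + y * s by rewrite addr_ge0// mulr_ge0// ltW.
have h3 : L <= (1 + C5 * s) * (dg + 2 * s).
  apply: (@le_trans _ _ ((1 + y * s) * (1 - w) * L)).
    by rewrite ler_peMl.
  rewrite -mulrA; apply: le_trans (ler_wpM2l ys0 H) _.
  rewrite mulrA ler_wpM2r//; apply: le_trans (ler_wpM2l ys0 h1) _.
  have : x * y * s * s <= x * y * s by apply: ler_piMr => //; rewrite !mulr_ge0// ltW.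
  by rewrite C5E; lra.
have q0 : 0 <= q by apply: le_trans sq; exact: ltW.
have h4 : (1 + C5 * s) * (dg + 2 * s) <= (1 + C5 * q) * (dg + 2 * q).
  by apply: ler_pM => //; rewrite ?addr_ge0 ?mulr_ge0 ?(ltW s0)// lerD2l ler_wpM2l.
have c3 : 0 <= 1 + C3 * q by rewrite addr_ge0// mulr_ge0.
apply: le_trans (ler_wpM2l c3 (le_trans h3 h4)) _.
have h5 : (1 + C3 * q) * (1 + C5 * q) <= 1 + (C3 + 2 * C5) * q.
  have : C3 * q * (C5 * q) <= C5 * q by rewrite ler_piMl// mulr_ge0.
  lra.
have dq0 : 0 <= dg + 2 * q by rewrite addr_ge0// mulr_ge0.
rewrite mulrA; apply: le_trans (ler_wpM2r dq0 h5) _.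
have k0 : 0 <= (C3 + 2 * C5) * q by rewrite mulr_ge0// addr_ge0// mulr_ge0.
have h6 : (C3 + 2 * C5) * q * (dg + 2 * q) <= (C3 + 2 * C5) * q * (U + 3).
  by rewrite ler_wpM2l//; lra.
lra.
Qed.

(** M has to exceed the a priori bound at distance r / 2 and the threshold S on the cone, A the
    threshold S and the quadratic term at the boundary; C4 gives strictness against the defect C q,
    and C3 the transfer of slopes. The last clause asks for the refined bound only when q = s + lam
    is small. *)
Lemma barrier_constants (R : realFieldType) (S CB U c gmin gmax C sig r tau : R) :
  0 <= S -> 0 <= CB -> 0 <= U -> 0 < c -> 0 < gmin -> 0 < gmax -> 0 < C -> 0 < sig ->
  0 < r -> 0 < tau -> tau <= 1 ->
  exists M A C3 C4 K s0 : R,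
   [/\ [/\ 0 < M, 0 < A, 0 < C3, 0 < C4 & 0 < K] , 0 < s0,
     [/\ C4 + 2 * c * gmax + gmin^-1 <= C3, S < M * tau, 2 * U <= M * r,
      4 * S < tau * A & 36 <= A] &
    forall s lam : R, 0 < s -> s <= s0 -> 0 < lam ->
    [/\ s <= 1, 2 * (A * s) <= r, U * s <= (r / 8) ^+ 2, s ^+ 2 <= r * tau / 36 &
     forall dg B0 v, 0 <= dg -> 0 <= B0 -> v <= CB * B0 + U ->
       (C3 * (s + lam) <= 1 -> C4 * (s + lam) <= 1 ->
        0 <= sig - C * (s + lam) -> sig < (1 + C4 * (s + lam)) * (sig - C * (s + lam)) ->
        exists L, [/\ 0 <= L,
          (1 - A * s / r) * L <= (1 + c * (A * s + s ^+ 2)) ^+ 2 * (dg + 2 * s) &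
          v <= CB * B0 + (M * gmax * s + (1 + C3 * (s + lam)) * L + s^-1 * (A * s) ^+ 2)]) ->
       v - dg <= K * (s + B0 + lam)]].
Proof.
move=> S0 CB0 U0 c0 gmin0 gmax0 C0 sig0 r0 tau0 tau1.
pose M := 2 * U / r + S / tau + 1.
pose A := 4 * S / tau + 36.
pose C4 := 2 * C / sig.
pose C3 := C4 + 2 * c * gmax + gmin^-1.
have C40 : 0 < C4 by rewrite divr_gt0// mulr_gt0.
have C34 : C4 <= C3 by rewrite /C3 -addrA lerDl addr_ge0 ?invr_ge0 ?mulr_ge0// ltW.
have C30 : 0 < C3 by apply: lt_le_trans C34.
(* Below c6 all smallness conditions on q hold; above it, U <= (U / c6) q and the a priori bound is
   enough. *)
pose c6 := Num.min 1 (Num.min C3^-1 (sig / (4 * C))).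
have c60 : 0 < c6 by rewrite !lt_min ltr01 invr_gt0 C30 divr_gt0// mulr_gt0.
pose a := c * (A + 1).
have M0 : 0 < M.
  by rewrite ltr_wpDl// addr_ge0 ?(divr_ge0 S0 (ltW tau0))// divr_ge0 ?mulr_ge0// ltW.
have A36 : 36 <= A by rewrite lerDr divr_ge0 ?mulr_ge0// ltW.
have A0 : 0 < A by apply: lt_le_trans A36.
have a0 : 0 < a by rewrite mulr_gt0// addr_gt0.
pose x := 2 * a + a ^+ 2; pose y := 2 * A / r.
have y0 : 0 < y by rewrite divr_gt0// mulr_gt0.
have x0 : 0 < x by rewrite addr_gt0 ?exprn_gt0// mulr_gt0.
pose C5 := x + y + x * y.
have C50 : 0 < C5 by rewrite !addr_gt0// mulr_gt0.
pose K1 := M * gmax + A ^+ 2 + (3 + (C3 + 2 * C5) * (U + 3)).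
pose K := CB + K1 + U / c6.
pose s0 := Num.min (Num.min 1 (r / (2 * A))) (Num.min ((r / 8) ^+ 2 / (U + 1)) (r * tau / 36)).
have U1 : 0 < U + 1 by rewrite ltr_wpDl.
have s00 : 0 < s0.
  have r8 : 0 < (r / 8) ^+ 2 by rewrite exprn_gt0// divr_gt0.
  have q1 : 0 < r / (2 * A) by rewrite divr_gt0// mulr_gt0.
  have q2 := divr_gt0 r8 U1.
  have q3 : 0 < r * tau / 36 by rewrite divr_gt0// mulr_gt0.
  by rewrite !lt_min ltr01 q1 q2 q3.
have U3 : 0 < (C3 + 2 * C5) * (U + 3).
  by apply: mulr_gt0; [rewrite addr_gt0// mulr_gt0|apply: ltr_wpDl].
have k10 : 0 < K1.
  by rewrite /K1 !addr_gt0 ?exprn_gt0// mulr_gt0.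
have k20 : 0 <= U / c6 by rewrite divr_ge0// ltW.
have K0 : 0 < K by rewrite /K -addrA ltr_wpDl// ltr_wpDr.
exists M, A, C3, C4, K, s0; split; [by split|by []| |].
  split => //.
  - have Ur : 0 <= 2 * U / r * tau by rewrite mulr_ge0 ?(ltW tau0)// divr_ge0 ?mulr_ge0// ltW.
    have St : S / tau * tau = S by rewrite divfK ?gt_eqF.
    have -> : M * tau = 2 * U / r * tau + S / tau * tau + tau by rewrite /M; ring.
    by rewrite St; move: Ur tau0; clear; lra.
  - have Sr : 0 <= S / tau * r by rewrite mulr_ge0 ?(ltW r0)// divr_ge0// ltW.
    have Ur : 2 * U / r * r = 2 * U by rewrite divfK ?gt_eqF.
    have -> : M * r = 2 * U / r * r + S / tau * r + r by rewrite /M; ring.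
    by rewrite Ur; move: Sr r0; clear; lra.
  - have St : 4 * S / tau * tau = 4 * S by rewrite divfK ?gt_eqF.
    have -> : tau * A = 4 * S / tau * tau + 36 * tau by rewrite /A; ring.
    by rewrite St ltrDl mulr_gt0.
move=> s lam s_0; rewrite !le_min => /andP[/andP[s1 sA] /andP[sU srt]] lam0.
have s2 : s ^+ 2 <= s by rewrite expr2 ler_piMl// ltW.
have As : 2 * (A * s) <= r by move: sA; rewrite ler_pdivlMr ?mulr_gt0//; clear; lra.
split => //.
- rewrite ler_pdivlMr// in sU; apply: le_trans sU; rewrite mulrC ler_wpM2l ?(ltW s_0)//.
  by rewrite lerDl.
- exact: le_trans srt.
move=> dg B0 v dg0 B00 vU H; set q := s + lam in H *.
have q0 : 0 < q by rewrite addr_gt0.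
have KE : K * (s + B0 + lam) = K * B0 + K * q by rewrite /q; ring.
have KB : CB * B0 <= K * B0.
  by rewrite ler_wpM2r// /K -addrA lerDl addr_ge0// ltW.
have Kq : U / c6 * q <= K * q by rewrite ler_pM2r// /K lerDr addr_ge0// ltW.
have Kq1 : K1 * q <= K * q.
  by rewrite ler_pM2r// /K addrAC lerDr addr_ge0.
have Kq0 : 0 <= K * q by rewrite mulr_ge0 ?ltW.
rewrite KE; have [c6q|qc6] := ltP c6 q.
  have Uq : U <= U / c6 * q by rewrite mulrAC ler_pdivlMr// ler_wpM2l// ltW.
  by move: KB Kq Uq vU dg0; clear; lra.
(* For a distance beyond U the a priori bound is again enough. *)
have [dgU|dgU] := ltP U dg; first by move: dgU vU KB Kq0; clear; lra.
move: qc6; rewrite !le_min => /andP[q1 /andP[qC3 qC]].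
have C3q : C3 * q <= 1 by rewrite mulrC -ler_pdivlMr// mul1r.
have C4q : C4 * q <= 1 by apply: le_trans C3q; rewrite ler_pM2r.
have Cq : 4 * (C * q) <= sig by move: qC; rewrite ler_pdivlMr ?mulr_gt0//; clear; lra.
have Cq0 : 0 < C * q by rewrite mulr_gt0.
have sig3 : 0 <= sig - C * q by move: Cq Cq0; clear; lra.
have sig4 : sig < (1 + C4 * q) * (sig - C * q).
  have C4E : C4 * q * sig = 2 * (C * q) by rewrite /C4; field; rewrite gt_eqF.
  have : C4 * q * (C * q) <= 1 / 2 * (C * q).
    rewrite ler_pM2r// /C4 mulrAC ler_pdivrMr//; move: Cq; clear; lra.
  by move: C4E Cq0; clear; lra.
have [L [L0 HL vL]] := H C3q C4q sig3 sig4.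
have w2 : A * s / r <= 1 / 2 by rewrite ler_pdivrMr//; move: As; clear; lra.
have wy : 2 * (A * s / r) = y * s by rewrite /y; ring.
have sq : s <= q by rewrite lerDl ltW.
have HL' : (1 - A * s / r) * L <= (1 + a * s) ^+ 2 * (dg + 2 * s).
  apply: le_trans HL _; rewrite ler_wpM2r ?addr_ge0 ?mulr_ge0 ?(ltW s_0)//.
  have as_ : c * (A * s + s ^+ 2) <= a * s.
    have -> : a * s = c * (A * s + s) by rewrite /a; ring.
    by rewrite ler_pM2l// lerD2l.
  have c1 : 0 <= c * (A * s + s ^+ 2).
    by rewrite mulr_ge0 ?(ltW c0)// addr_ge0 ?sqr_ge0// mulr_ge0 ?ltW.
  by apply: lerXn2r; rewrite ?nnegrE ?lerD2l// addr_ge0// (le_trans c1).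
have := length_arith L0 wy w2 (ltW y0) (ltW a0) (ltW C30) dg0 dgU s_0 sq q1 C3q HL' erefl erefl.
rewrite -/x -/C5 => La.
have sE : s^-1 * (A * s) ^+ 2 = A ^+ 2 * s by rewrite exprMn; field; rewrite gt_eqF.
have mg : (M * gmax + A ^+ 2) * s <= (M * gmax + A ^+ 2) * q.
  by rewrite ler_wpM2l// addr_ge0 ?sqr_ge0// mulr_ge0 ?ltW.
move: vL La mg KB Kq1; rewrite sE /K1; clear; lra.
Qed.

Lemma scale_arith (R : realFieldType) (s A r tau : R) :
  0 < s -> s <= 1 -> 2 * (A * s) <= r -> 36 <= A -> 0 < tau -> tau <= 1 -> 0 < r ->
  [/\ 2 * s ^+ 2 <= r, 2 * s <= A, 36 * tau * s <= A, A * s <= r &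
    3 * tau * s ^+ 2 < r / 2].
Proof.
move=> s0 s1 As A36 tau0 tau1 r0.
have s2 : s ^+ 2 <= s by rewrite expr2 ler_piMl// ltW.
have As36 : 36 * s <= A * s by rewrite ler_pM2r.
have te : tau * s ^+ 2 <= s ^+ 2 by rewrite ler_piMl// sqr_ge0.
have ts : tau * s <= 1 by rewrite mulr_ile1// ltW.
by split; lra.
Qed.

(** * The deterministic upper bound *)

Section upper_bound.
Context {R : realType} {d : nat}.
Variables (eta : R -> R) (p r diam rhomin rhomax Lrho fmin fmax Lf t0 c1 C : R).
Local Notation sig := (sigma_p (d := d) eta p).
Hypotheses (kP : kernel_profile (d := d) eta) (p1 : 1 <= p) (r0 : 0 < r)
  (rm0 : 0 < rhomin) (rmM : rhomin <= rhomax) (fm0 : 0 < fmin) (fmM : fmin <= fmax)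
  (t00 : 0 < t0) (t01 : t0 < 1) (et0 : 0 < eta t0) (c10 : 0 < c1) (C0 : 0 < C).
Local Notation tau := (t0 / 4).
Local Notation th := (tau / 4).
Local Notation S := ((sig * fmax / (c1 * eta t0)) `^ p^-1).
Local Notation CB := ((sig * fmax / eta t0) `^ p^-1).
Local Notation U := (S * (4 * (`|diam| + 1) / th + 1)).

Let fM0 : 0 < fmax := lt_le_trans fm0 fmM.

(** A chain with weight 1 along a curve of length at most diam + 1, with steps at most th eps, has
    O(1 / eps) balls, and each of them costs [S * eps]. *)
Lemma crude_bound (Omega : set 'rV[R]_d.+1) (eps : R) (n : nat) (X : 'I_n -> 'rV[R]_d.+1)
    (v : 'I_n -> R) (G : 'I_n -> Prop) (j0 : 'I_n) :
  open Omega -> connected Omega -> C11_boundary Omega ->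
  reach (boundary Omega) = r%:E -> geodiam Omega = diam%:E ->
  0 < eps -> eps <= 1 -> 2 * eps <= r -> (forall i, Omega (X i)) ->
  (forall z, Omega z -> th * eps <= sdist (boundary Omega) z ->
     c1 * (n%:R * eps ^+ d.+1) <= \sum_j (enorm (z - X j) <= th * eps)%R%:R) ->
  subsolution (gweight eta eps X) p (fun _ => n%:R * eps ^+ d.+1 * eps `^ p * sig * fmax) G v ->
  G j0 -> r <= sdist (boundary Omega) (X j0) ->
  forall i, v i <= CB * (n%:R * eps ^+ d.+1 * eps `^ p) `^ p^-1 + U.
Proof.
move=> oO cO C11O rO dO eps0 eps1 epsr XO E1 [vG vF] Gj ry i.
have th0 : 0 < th by rewrite !divr_gt0.
have th1 : th <= 1 by move: t01; lra.
have the0 : 0 < th * eps by rewrite mulr_gt0.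
have the1 : th * eps <= eps by rewrite ler_piMl// ltW.
have [gam [gC1 gO g0 g1] gL] := length_curve oO cO dO (XO i) (XO j0).
have the2 : 2 * (th * eps) <= r by lra.
have the3 : th * eps <= sdist (boundary Omega) (X j0) by lra.
have [] := @pushed_chain R d.+1 Omega r oO C11O r0 rO (cst 1) 0 1 gam (X i) (X j0)
  (th * eps) (th * eps) 1 (lexx 0) _ _ gC1 gO g0 g1 (XO i) (XO j0) the0 the2 the3 the0 ltr01.
- by move=> a _; rewrite /= ler01 lexx.
- by move=> a b _ _; rewrite /= mul0r addr0 mulr1.
move=> m [h [a [h0 hth [am a0] aO [as_ mL _]]]].
have tht : 4 * th <= t0 by move: t00; lra.
have := @chain_bound R d eta p eps n X kP p1 eps0 G Omega fmax t0 th c1 fM0 t00 et0 c10 th0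
  tht E1 v m a j0 vG vF Gj am aO _ i _.
move=> H; apply: le_trans (H _ _) _; first by move=> k km; apply: le_trans (as_ k km) _.
  apply: le_trans a0 _; lra.
rewrite lerD2l -mulrA ler_wpM2l ?powR_ge0//.
rewrite -(ler_pM2l th0) mulrDr mulr1 [th * (_ / th)]mulrC divfK ?gt_eqF//.
have th2 : th * eps <= th by rewrite ler_piMr// ltW.
have := ler_norm diam; move: mL gL; set L := Rintegral _ _ _ => mL gL.
by move: th2 mL gL; move: th => q; lra.
Qed.

Local Notation gmin := ((fmin / rhomax) `^ p^-1).
Local Notation gmax := ((fmax / rhomin) `^ p^-1).

(** Stated for subsolutions and for one point [X j0] of Gamma at a time, so that it serves both the
    minimum over Gamma and the bound required by Perron's method. *)
Lemma upper_bound : exists K s0 : R, [/\ 0 < K, 0 < s0 &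
  forall (Omega : set 'rV[R]_d.+1) (rho f : 'rV[R]_d.+1 -> R),
    open Omega -> connected Omega -> C11_boundary Omega ->
    reach (boundary Omega) = r%:E -> geodiam Omega = diam%:E ->
    elipschitz (closure Omega) Lrho rho ->
    (forall x, Omega x -> rhomin <= rho x <= rhomax) ->
    elipschitz (closure Omega) Lf f ->
    (forall x, Omega x -> fmin <= f x <= fmax) ->
  forall (s lam : R) (n : nat) (X : 'I_n -> 'rV[R]_d.+1) (v : 'I_n -> R)
    (G : 'I_n -> Prop) (j0 : 'I_n),
    0 < s -> s <= s0 -> 0 < lam -> (forall i, Omega (X i)) ->
    (forall z, Omega z -> th * s ^+ 2 <= sdist (boundary Omega) z ->
      c1 * (n%:R * s ^+ 2 ^+ d.+1) <= \sum_j (enorm (z - X j) <= th * s ^+ 2)%R%:R) ->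
    (forall z e, Omega z -> s ^+ 2 <= sdist (boundary Omega) z -> enorm e = 1 ->
      n%:R * s ^+ 2 ^+ d.+1 * rho z * (sig - C * (s + lam)) <=
      \sum_j eta (enorm (z - X j) / s ^+ 2) *
        Num.max (edot e (z - X j) / s ^+ 2 - gmin^-1 * s) 0 `^ p) ->
    subsolution (gweight eta (s ^+ 2) X) p
      (fun i => n%:R * s ^+ 2 ^+ d.+1 * (s ^+ 2) `^ p * sig * f (X i)) G v ->
    G j0 -> r <= sdist (boundary Omega) (X j0) ->
  forall i, v i - geodist Omega (fun z => rho z `^ (- p^-1) * f z `^ p^-1) (X i) (X j0) <=
    K * (s + (n%:R * s ^+ 2 ^+ d.+1 * (s ^+ 2) `^ p) `^ p^-1 + lam)].
Proof.
have p0 : 0 < p by apply: lt_le_trans p1.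
have sig0 : 0 < sig := sigma_gt0 kP p1.
have rM0 : 0 < rhomax by apply: lt_le_trans rmM.
have gmin0 : 0 < gmin by rewrite powR_gt0// divr_gt0.
have gmax0 : 0 < gmax by rewrite powR_gt0// divr_gt0.
have tau0 : 0 < tau by rewrite divr_gt0.
have th0 : 0 < th by rewrite divr_gt0.
have S_0 : 0 <= S by rewrite powR_ge0.
have CB0 : 0 <= CB by rewrite powR_ge0.
have dm0 : 0 < `|diam| + 1 by rewrite ltr_wpDl.
have U0 : 0 <= U by rewrite mulr_ge0// addr_ge0// divr_ge0 ?mulr_ge0// ltW.
set aa := `|Lf| / fmin; set bb := `|Lrho| / rhomin.
pose c := aa + bb + aa * bb + gmax / gmin.
have c0 : 0 < c.
  have a0 : 0 <= aa by rewrite divr_ge0// ltW.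
  have b0 : 0 <= bb by rewrite divr_ge0// ltW.
  by rewrite /c ltr_wpDl ?divr_gt0// !addr_ge0// mulr_ge0.
have tau1 : tau <= 1 by move: t01; lra.
have [M [A [C3 [C4 [K [s0 [[M0 A0 C30 C40 K0] s00 [C3E SM UM SA A36] cst]]]]]]] :=
  barrier_constants S_0 CB0 U0 c0 gmin0 gmax0 C0 sig0 r0 tau0 tau1.
have cE : c = aa + bb + aa * bb + gmax / gmin by [].
clearbody c; exists K, s0; split => //.
move=> Omega rho f oO cO C11O rO dO rhoL rhob fL fb s lam n X v G j0 s_0 ss0 lam0 XO E1 E2 sv
  Gj ry i.
have [gb gr gpE] := speed_bounds p1 rm0 rmM fm0 fmM rhoL rhob fL fb.
have [s1 As sU srt fin] := cst s lam s_0 ss0 lam0; clear cst.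
set g := fun z => rho z `^ (- p^-1) * f z `^ p^-1.
have {}gb x : closure Omega x -> gmin <= g x <= gmax by exact: gb.
have {}gr x z : closure Omega x -> closure Omega z ->
    g x <= (1 + c * enorm (x - z)) * g z by rewrite cE; exact: gr.
have {}gpE x : closure Omega x -> g x `^ p * rho x = f x by exact: gpE.
have clO := @subset_closure _ Omega.
have g0 z : closure Omega z -> 0 <= g z.
  by move=> /gb/andP[+ _]; exact: le_trans (ltW gmin0).
have g0G z : closure Omega z -> 0 <= g z <= gmax.
  by move=> cz; have /andP[_ ->] := gb _ cz; rewrite g0.
have eps0 : 0 < s ^+ 2 by rewrite exprn_gt0.
have epss : s ^+ 2 <= s by rewrite expr2 ler_piMl// ltW.
have [e2r sA tAs Asr er2] := scale_arith s_0 s1 As A36 tau0 tau1 r0.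
have crude : forall k, v k <= CB * (n%:R * s ^+ 2 ^+ d.+1 * (s ^+ 2) `^ p) `^ p^-1 + U.
  apply: (crude_bound (G := G) oO cO C11O rO dO eps0 _ e2r XO E1 _ Gj ry).
  - exact: le_trans s1.
  - have [vG vF] := sv; split => // k Gk; apply: le_trans (vF k Gk) _.
    apply: ler_wpM2l; last by have /andP[] := fb _ (XO k).
    by rewrite !mulr_ge0 ?powR_ge0 ?exprn_ge0 ?(ltW sig0) ?(ltW s_0).
apply: fin; [exact: geodist_ge0|exact: powR_ge0|exact: crude|].
move=> C3q C4q sC sig4.
(* An excess s is allowed for the curve and another for the chain; together they are the 2 s in
   [fin]. *)
have [gam [gC1 gO gam0 gam1] gL] := geodist_curve oO cO g (XO i) (XO j0) s_0.
have As0 : 0 < A * s by rewrite mulr_gt0.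
have ADy : A * s <= sdist (boundary Omega) (X j0) by exact: le_trans ry.
have [m [h [zeta [h0 heps [zm z0] zO [zs _ zL]]]]] :=
  pushed_chain oO C11O r0 rO (ltW c0) g0G gr gC1 gO gam0 gam1 (XO i) (XO j0) As0 As ADy eps0 s_0.
set q := s + lam in C3q C4q sC sig4 *.
exists (\sum_(k < m) g (zeta k) * h); split.
- apply: sumr_ge0 => k _; rewrite mulr_ge0 ?(ltW h0)//; apply: g0; apply: clO.
  by have [] := zO k.
- apply: le_trans zL _; rewrite ler_wpM2l ?sqr_ge0// (_ : 2 * s = s + s); last by ring.
  by rewrite addrA lerD2r; exact: ltW.
pose ell k := \sum_(k <= j < m) (1 + C3 * q) * g (zeta j) * h.
have ell0E : ell 0%N = (1 + C3 * q) * (\sum_(k < m) g (zeta k) * h).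
  by rewrite /ell big_mkord mulr_sumr; apply: eq_bigr => k _; rewrite -mulrA.
have thtau : 4 * th <= tau by rewrite mulrC divfK.
have taut : 4 * tau <= t0 by rewrite mulrC divfK.
have sq : s <= q by rewrite lerDl ltW.
have H := @barrier_bound R d eta p s n X kP p1 s_0 Omega fmax t0 th c1 tau r fM0 t00 et0 c10 th0
  thtau taut t01 E1 oO C11O r0 rO XO rho f g gmin gmax c q C C3 C4 M A U h v G j0 m zeta ell.
have fr w : Omega w -> f w <= fmax /\ 0 < rho w.
  move=> Ow; have /andP[_ ->] := fb _ Ow; split => //.
  by have /andP[+ _] := rhob _ Ow; exact: lt_le_trans.
have gbO w : Omega w -> gmin <= g w <= gmax by move=> Ow; apply: gb; exact: clO.
have grO w z : Omega w -> Omega z -> g w <= (1 + c * enorm (w - z)) * g z.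
  by move=> Ow Oz; apply: gr; exact: clO.
have gpO w : Omega w -> g w `^ p * rho w = f w by move=> Ow; apply: gpE; exact: clO.
have ellm : ell m = 0 by rewrite /ell big_geq.
have ellS k : (k < m)%N -> ell k = ell k.+1 + (1 + C3 * q) * g (zeta k) * h.
  by move=> km; rewrite /ell big_ltn// addrC.
apply: le_trans (H fr gbO grO gpO (fun k e => E2 (X k) e (XO k)) sv Gj ry crude zm zO zs h0 heps
  ellm ellS gmin0 (ltW c0) (ltW C30) (ltW C40) M0 U0 sq C3q C4q sC
  sig4 C3E SM UM SA sA tAs sU srt er2 i) _.
rewrite lerD2l ell0E lerD2l ler_wpM2l ?invr_ge0 ?(ltW s_0)//.
by apply: lerXn2r; rewrite ?nnegrE ?enorm_ge0// ltW.
Qed.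

End upper_bound.

Lemma prob_ge_sub (R : realType) (disp : measure_display) (T : measurableType disp)
  (P : probability T R) (A B : set T) (q : R) : A `<=` B -> prob_ge P A q -> prob_ge P B q.
Proof. by move=> AB [F [mF FA qF]]; exists F; split => // w /FA/AB. Qed.

(* The ambient space is R^(d+1), so that every dimension >= 1 is covered. *)
Theorem theorem4p2 (R : realType) (d : nat) (eta : R -> R) (p : R)
  (diam r rhomin rhomax Lrho fmin fmax Lf : R) :
  kernel_profile (d := d) eta -> 1 <= p -> 0 < r -> 0 < rhomin -> 0 < fmin ->
  exists C c : R, [/\ 0 < C, 0 < c &
  forall (Omega : set 'rV[R]_d.+1) (rho f : 'rV[R]_d.+1 -> R),
    open Omega -> bounded_set Omega -> connected Omega ->
    C11_boundary Omega ->
    reach (boundary Omega) = r%:E -> geodiam Omega = diam%:E ->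
    elipschitz (closure Omega) Lrho rho ->
    (forall x, Omega x -> rhomin <= rho x <= rhomax) ->
    elipschitz (closure Omega) Lf f ->
    (forall x, Omega x -> fmin <= f x <= fmax) ->
  exists2 eps0 : R, 0 < eps0 &
  forall (eps lam : R), 0 < eps -> eps < eps0 -> 0 < lam -> lam <= 1 ->
  forall (n : nat) (disp : measure_display) (T : measurableType disp)
    (P : probability T R) (x : 'I_n -> {RV P >-> 'rV[R]_d.+1}),
    mutually_independent x ->
    (forall i, has_density (lebesgue_rV d.+1) Omega rho (x i)) ->
  let g := fun z => rho z `^ (- p^-1) * f z `^ p^-1 in
  prob_ge P
    [set w | let X := range (fun i => x i w) in
      forall Gamma : set 'rV[R]_d.+1,
        Gamma `<=` X -> Gamma !=set0 -> r <= setdist Gamma (boundary Omega) ->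
        (exists u, eikonal_sol n eta p eps X Gamma f u) /\
        forall u, eikonal_sol n eta p eps X Gamma f u ->
        forall z, X z -> u z - geodist_set Omega g z Gamma <=
          C * (Num.sqrt eps + (n%:R * eps `^ (p + d.+1%:R)) `^ p^-1 + lam)]
    (1 - 3 * n%:R ^+ 2 * expR (- (c * n%:R * eps ^+ d.+1 * lam ^+ 2)))].
Proof.
move=> kP p1 r0 rm0 fm0.
have p0 : 0 < p by apply: lt_le_trans p1.
have sig0 := sigma_gt0 kP p1.
have [t0 [t00 t01 et0]] := kernel_pos_radius kP.
(* The constants are fixed before any domain is given; the maxima put the bounds in order. *)
pose RM := Num.max rhomax rhomin; pose FM := Num.max fmax fmin.
have rM : rhomin <= RM by rewrite le_max lexx orbT.
have fM : fmin <= FM by rewrite le_max lexx orbT.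
have RM0 : 0 < RM by apply: lt_le_trans rM.
have th0 : 0 < t0 / 4 / 4 by rewrite !divr_gt0.
have b0 : 0 < ((fmin / RM) `^ p^-1)^-1 by rewrite invr_gt0 powR_gt0// divr_gt0.
have [c [c1 [C [c0 c10 C0 HS]]]] := @sample_event R d eta p _ _ rhomin RM Lrho kP p1 th0 b0 rm0.
have [K [s0 [K0 s00 HU]]] := @upper_bound R d eta p r diam rhomin RM Lrho fmin FM Lf t0 c1 C
  kP p1 r0 rm0 rM fm0 fM t00 t01 et0 c10 C0.
exists K, c; split => // Omega rho f oO bO cO C11O rO dO rhoL rhob fL fb.
have S0 := reach_nonempty r0 rO.
have rhobM z : Omega z -> rhomin <= rho z <= RM.
  by move=> /rhob/andP[-> zR]; rewrite le_max zR.
have fbM z : Omega z -> fmin <= f z <= FM.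
  by move=> /fb/andP[-> zR]; rewrite le_max zR.
have [eps1 eps10 HE] := HS Omega rho oO bO S0 rhoL rhobM.
exists (Num.min eps1 (s0 ^+ 2)); first by rewrite lt_min eps10 exprn_gt0.
move=> eps lam eps0; rewrite lt_min => /andP[ee1 ee2] lam0 lam1 n disp T P x xind xdens g.
apply: prob_ge_sub (HE eps lam eps0 ee1 lam0 lam1 n disp T P x xind xdens).
move=> w /= [Xinj E1 E2] Gamma GX [y0 Gy0] rG.
have [s s_0 sE] : exists2 s, 0 < s & eps = s ^+ 2.
  by exists (Num.sqrt eps); rewrite ?sqrtr_gt0// sqr_sqrtr// ltW.
subst eps; rewrite sqrtr_sqr ger0_norm ?(ltW s_0)// in E2 *.
have ss0 : s <= s0 by rewrite -(@ler_pXn2r _ 2)// ?nnegrE ?(ltW s00) ?(ltW s_0) ?(ltW ee2).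
pose X i := x i w; pose G i := Gamma (X i).
have XO i : Omega (X i) by have [+ _] := xdens i; apply.
have rX j : G j -> r <= sdist (boundary Omega) (X j).
  move=> Gj; apply: sdist_ge => // b bS; apply: le_trans rG _.
  apply: ge_inf; last by exists (X j) => //; exists b.
  by exists 0; apply/lbP => _ [a _ [e _ <-]]; exact: enorm_ge0.
have [j0 _ j0E] := GX _ Gy0.
have Gj0 : G j0 by rewrite /G /X j0E.
have B0E : (n%:R * (s ^+ 2) `^ (p + d.+1%:R)) `^ p^-1 =
    (n%:R * s ^+ 2 ^+ d.+1 * (s ^+ 2) `^ p) `^ p^-1.
  rewrite powRD; last by rewrite (gt_eqF eps0) implybT.
  by rewrite powR_mulrn ?(ltW eps0)// mulrAC mulrA.
rewrite B0E; clear B0E.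
pose Fr i := n%:R * s ^+ 2 ^+ d.+1 * (s ^+ 2) `^ p * sigma_p (d := d) eta p * f (X i).
have n0 : 0 < n%:R :> R by rewrite ltr0n (leq_trans _ (ltn_ord j0)).
have N0 : 0 < n%:R * s ^+ 2 ^+ d.+1 * (s ^+ 2) `^ p * sigma_p (d := d) eta p.
  by rewrite !mulr_gt0// ?powR_gt0// exprn_gt0.
have opE u i : graph_op n eta p (s ^+ 2) (range X) u (X i) = f (X i) <->
    upwind (gweight eta (s ^+ 2) X) p (u \o X) i = Fr i.
  rewrite graph_op_upwind// /Fr; split => [<-|->]; first by rewrite mulrA divff ?mul1r// gt_eqF.
  by rewrite mulrA mulVf ?mul1r// gt_eqF.
have ub v j : subsolution (gweight eta (s ^+ 2) X) p Fr G v -> G j -> forall i,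
    v i - geodist Omega g (X i) (X j) <=
    K * (s + (n%:R * s ^+ 2 ^+ d.+1 * (s ^+ 2) `^ p) `^ p^-1 + lam).
  move=> sv Gj; exact: (HU Omega rho f oO cO C11O rO dO rhoL rhobM fL fbM s lam n X v G j
    s_0 ss0 lam0 XO E1 E2 sv Gj (rX j Gj)).
set Err := K * _ in ub *.
split.
  (* The bound for Perron's method must be uniform in i; a sum of absolute values dominates every
     [bi i]. *)
  pose bi i := Err + geodist Omega g (X i) (X j0).
  have [|||v [vG vF]] := @perron R n (gweight eta (s ^+ 2) X) p Fr G _ p1 _ (\sum_i `|bi i|).
  - by move=> i j; exact: gweight_ge0 kP eps0 i j.
  - move=> i; rewrite mulr_ge0 ?(ltW N0)//.
    by have /andP[+ _] := fb _ (XO i); apply: le_trans; exact: ltW.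
  - move=> v sv i; rewrite (bigD1 i)//=; apply: le_trans (_ : bi i <= _).
      by rewrite /bi -lerBlDr; exact: ub sv Gj0 i.
    apply: le_trans (ler_norm _) _; rewrite lerDl; exact: sumr_ge0.
  (* Extends the values from indices to the whole space; as the sample points are distinct, u agrees
     with v on them. *)
  pose u (z : 'rV[R]_d.+1) := \sum_i (X i == z)%:R * v i.
  have uX i : u (X i) = v i.
    rewrite /u (bigD1 i)//= eqxx mul1r big1 ?addr0// => k ki.
    by case: eqP => [/Xinj kE|_]; [rewrite kE eqxx in ki|rewrite mul0r].
  have uE : u \o X = v by apply/funext => i; exact: uX.
  exists u; split => [_ [[i _ <-] Gi]|z Gz].
    by apply/opE; rewrite uE; exact: vF.
  by have [i _ iE] := GX _ Gz; rewrite -iE uX; apply: vG; rewrite /G /X iE.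
move=> u [uF uG] _ [i _ <-].
have su : subsolution (gweight eta (s ^+ 2) X) p Fr G (u \o X).
  split => k Gk /=; first by rewrite uG.
  by rewrite ((opE u k).1 _)//; apply: uF; split => //; exists k.
rewrite lerBlDr -lerBlDl; apply: lb_le_inf; first by eexists; exists (X j0).
apply/lbP => _ [z Gz <-]; have [j _ jE] := GX _ Gz.
have Gj : G j by rewrite /G /X jE.
by have := ub _ j su Gj i; rewrite /= /X jE; clear; lra.
Qed.
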